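(* Let $Q$ be a quiver and $\alpha\geq 1$. Then the following identity holds in $\mathcal{V}[[t_i,\ i\in Q_0]]$: $$\sum_{\mathbf{r}\in\mathbb{N}^{Q_0}}\frac{\sharp\mu_{Q,\mathbf{r},\alpha}^{-1}(0)}{\sharp \mathrm{GL}(\mathbf{r},\mathcal{O}_\alpha)}\cdot q^{\alpha\langle \mathbf{r},\mathbf{r}\rangle}t^{\mathbf{r}}=\mathrm{Exp}_{q,t}\left(\sum_{\mathbf{r}\in\mathbb{N}^{Q_0}\setminus\{0\}}\frac{A_{Q,\mathbf{r},\alpha}}{1-q^{-1}}\cdot t^{\mathbf{r}}\right).$$
   Context: Fix a finite field $\mathbb{F}_q$. A quiver $Q=(Q_0,Q_1,s,t)$ consists of finite sets $Q_0$ (vertices) and $Q_1$ (arrows) and source and target maps $s,t:Q_1\to Q_0$ (loops and parallel arrows allowed). $\mathbb{N}$ contains $0$. Its Euler form is $\langle \mathbf{d},\mathbf{e}\rangle=\sum_{i\in Q_0}d_ie_i-\sum_{a\in Q_1}d_{s(a)}e_{t(a)}$. For $\mathbb{K}$ a field, $\mathcal{O}_\alpha=\mathbb{K}[t]/(t^\alpha)$. Representations: a locally free representation of $Q$ over $\mathcal{O}_\alpha$ of rank $\mathbf{r}\in\mathbb{N}^{Q_0}$ is a collection of free $\mathcal{O}_\alpha$-modules $M_i$ of rank $r_i$ ($i\in Q_0$) and $\mathcal{O}_\alpha$-linear maps $f_a:M_{s(a)}\to M_{t(a)}$ ($a\in Q_1$); morphisms are families of $\mathcal{O}_\alpha$-linear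 maps commuting with the $f_a$. It is indecomposable if it is nonzero and is not a direct sum of two nonzero subrepresentations. For $\mathbb{K}$ finite, it is absolutely indecomposable if its base change to $\overline{\mathbb{K}}[t]/(t^\alpha)$ is indecomposable. Moment map: let $\mathrm{GL}(\mathbf{r},\mathcal{O}_\alpha)=\prod_{i}\mathrm{GL}(r_i,\mathcal{O}_\alpha)$ and $\mathfrak{gl}(\mathbf{r},\mathcal{O}_\alpha)=\prod_i\mathrm{Mat}_{r_i\times r_i}(\mathcal{O}_\alpha)$. Let $R(\overline{Q},\mathbf{r},\mathcal{O}_\alpha)$ be the space of tuples $(x_a,y_a)_{a\in Q_1}$ with $x_a\in\mathrm{Hom}_{\mathcal{O}_\alpha}(\mathcal{O}_\alpha^{r_{s(a)}},\mathcal{O}_\alpha^{r_{t(a)}})$, $y_a\in\mathrm{Hom}_{\mathcal{O}_\alpha}(\mathcal{O}_\alpha^{r_{t(a)}},\mathcal{O}_\alpha^{r_{s(a)}})$, and $\mu_{Q,\mathbf{r},\alpha}:R(\overline{Q},\mathbf{r},\mathcal{O}_\alpha)\to\mathfrak{gl}(\mathbf{r},\mathcal{O}_\alpha)$, $(x,y)\mapsto\big(\sum_{t(a)=i}x_ay_a-\sum_{s(a)=i}y_ax_a\big)_{i\in Q_0}$. All of these are regarded as algebraic varieties over $\mathbb{K}$. Counting functions: $\mathcal{V}=\prod_{n\geq1}\mathbb{Q}$ as a ring, with Adams operators $\psi_m((a_n)_n)=(a_{mn})_n$. For a variety $X$ over $\mathbb{F}_q$, $\sharp X:=(\sharp X(\mathbb{F}_{q^n}))_{n\geq1}\in\mathcal{V}$;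 a rational function $R(q)$ denotes $(R(q^n))_{n\geq 1}$; $A_{Q,\mathbf{r},\alpha}:=(A_{Q,\mathbf{r},\alpha}(q^n))_{n\geq1}$, where $A_{Q,\mathbf{r},\alpha}(q^n)$ is the number of isomorphism classes of absolutely indecomposable locally free representations of $Q$ over $\mathbb{F}_{q^n}[t]/(t^\alpha)$ of rank $\mathbf{r}$. On $\mathcal{V}[[t_i,\ i\in Q_0]]$, with $t^{\mathbf{r}}=\prod_i t_i^{r_i}$, set $\psi_m(\sum_{\mathbf{r}}f_{\mathbf{r}}t^{\mathbf{r}})=\sum_{\mathbf{r}}\psi_m(f_{\mathbf{r}})t^{m\mathbf{r}}$. For $F$ with zero constant term, $\mathrm{Exp}_{q,t}(F)=\exp\big(\sum_{m\geq1}\psi_m(F)/m\big)$. *)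

(* Defs.v *)
From HB Require Import structures.
From mathcomp Require Import all_boot all_order all_algebra all_field.
From mathcomp Require Import boolp functions.

Set Implicit Arguments.
Unset Strict Implicit.
Unset Printing Implicit Defensive.

Import GRing.Theory.
Local Open Scope ring_scope.

Definition mps (I : finType) (R : Type) := {ffun I -> nat} -> R.

Definition mdegree (I : finType) (r : {ffun I -> nat}) : nat := \sum_i r i.

(* The zmodule (and lmodule) structure of power series is the pointwise one.  *)
HB.instance Definition _ (I : finType) (R : zmodType) :=
  GRing.Zmodule.on (mps I R).
HB.instance Definition _ (I : finType) (K : pzRingType) (V : lmodType K) :=
  GRing.Lmodule.on (mps I V).

(* Exponents all of whose entries are at most N, a finite type.               *)
Definition exp_box (I : finType) (N : nat) := {ffun I -> 'I_N.+1}.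

Definition exp_of_box (I : finType) (N : nat) (d : exp_box I N) :
  {ffun I -> nat} := [ffun i => d i : nat].

Section MpsRing.
Context {I : finType} {R : comPzRingType}.
Implicit Types (F G H : mps I R) (r d e : {ffun I -> nat}).

Definition mps_one : mps I R := fun r => (r == 0)%:R.

(* The Cauchy product; if d + e = r then the entries of d and e are at most   *)
(* mdegree r, so the box does not restrict the range of summation.            *)
Definition mps_mul F G : mps I R := fun r =>
  \sum_(p : exp_box I (mdegree r) * exp_box I (mdegree r)
          | exp_of_box p.1 + exp_of_box p.2 == r)
     F (exp_of_box p.1) * G (exp_of_box p.2).

Lemma leq_mdegree r i : (r i <= mdegree r)%N.
Proof. by rewrite /mdegree (bigD1 i) //= leq_addr. Qed.

Lemma mdegreeD d e : mdegree (d + e) = (mdegree d + mdegree e)%N.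
Proof. by rewrite /mdegree -big_split; apply: eq_bigr => i _; rewrite ffunE. Qed.

Lemma exp_of_box_inj N : injective (@exp_of_box I N).
Proof.
move=> d e /ffunP de; apply/ffunP => i; apply: val_inj.
by have := de i; rewrite !ffunE.
Qed.

Definition box_of_exp N d : exp_box I N := [ffun i => inord (d i)].

Lemma box_of_expK N d : (forall i, (d i <= N)%N) ->
  exp_of_box (box_of_exp N d) = d.
Proof. by move=> dN; apply/ffunP => i; rewrite !ffunE inordK // ltnS. Qed.

Lemma sum_box_widen (f : {ffun I -> nat} -> R) n N : (n <= N)%N ->
  (forall d, f d != 0 -> forall i, (d i <= n)%N) ->
  \sum_(d : exp_box I n) f (exp_of_box d) =
  \sum_(d : exp_box I N) f (exp_of_box d).
Proof.
move=> nN supp; rewrite [RHS](bigID (fun d : exp_box I N => f (exp_of_box d) == 0)) /=.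
rewrite [X in _ = X + _]big1 ?add0r => [|d /eqP //].
rewrite (bigID (fun d : exp_box I n => f (exp_of_box d) == 0)) /= [X in X + _ = _]big1
  ?add0r => [|d /eqP //].
have leN M (d : exp_box I M) i : (exp_of_box d i <= M)%N.
  by rewrite ffunE -ltnS.
have hK (d : exp_box I n) : exp_of_box (box_of_exp N (exp_of_box d)) = exp_of_box d.
  by apply: box_of_expK => i; apply: leq_trans nN.
rewrite [RHS](reindex_onto
  (fun d : exp_box I n => box_of_exp N (exp_of_box d))
  (fun d : exp_box I N => box_of_exp n (exp_of_box d))) /= => [|d fd].
  apply: eq_big => [d|d _]; rewrite hK // [X in _ && X](_ : _ = true) ?andbT //.
  by apply/eqP/exp_of_box_inj; rewrite box_of_expK.
by apply: exp_of_box_inj; rewrite (box_of_expK (d := exp_of_box _)) // => [|i];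
  rewrite box_of_expK //; apply: supp.
Qed.

Definition mps_term F G r d e : R := if d + e == r then F d * G e else 0.

Lemma mps_mulE F G r N : (mdegree r <= N)%N ->
  mps_mul F G r =
  \sum_(d : exp_box I N) \sum_(e : exp_box I N)
     mps_term F G r (exp_of_box d) (exp_of_box e).
Proof.
move=> rN; rewrite /mps_mul big_mkcond /= -(pair_bigA _ (fun d e : exp_box _ _ =>
  mps_term F G r (exp_of_box d) (exp_of_box e))) /=.
have le1 d e : mps_term F G r d e != 0 -> forall i, (d i <= mdegree r)%N.
  rewrite /mps_term; case: (d + e =P r) => [<- _ i|]; last by rewrite eqxx.
  by rewrite mdegreeD (leq_trans (leq_mdegree _ _)) ?leq_addr.
have le2 d e : mps_term F G r d e != 0 -> forall i, (e i <= mdegree r)%N.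
  rewrite /mps_term; case: (d + e =P r) => [<- _ i|]; last by rewrite eqxx.
  by rewrite mdegreeD (leq_trans (leq_mdegree _ _)) ?leq_addl.
under eq_bigr => d _ do rewrite (sum_box_widen rN (le2 (exp_of_box d))).
rewrite exchange_big [RHS]exchange_big /=; apply: eq_bigr => e _.
exact: (sum_box_widen (f := fun d => mps_term F G r d (exp_of_box e)) rN
  (fun d => le1 d (exp_of_box e))).
Qed.

Lemma mps_mulC : commutative mps_mul.
Proof.
move=> F G; apply/funext => r; rewrite !(mps_mulE _ _ (leqnn _)).
rewrite exchange_big; apply: eq_bigr => d _; apply: eq_bigr => e _.
by rewrite /mps_term addrC mulrC.
Qed.

Lemma sum_box_single (f : {ffun I -> nat} -> R) N (x : {ffun I -> nat}) :
  (forall i, (x i <= N)%N) ->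
  \sum_(d : exp_box I N) (if exp_of_box d == x then f (exp_of_box d) else 0) = f x.
Proof.
move=> xN; rewrite -big_mkcond /= (big_pred1 (box_of_exp N x)) ?box_of_expK //.
by move=> d /=; rewrite -{1}(box_of_expK xN) (inj_eq (@exp_of_box_inj N)).
Qed.

Lemma mps_mul1 : left_id mps_one mps_mul.
Proof.
move=> F; apply/funext => r; rewrite (mps_mulE _ _ (leqnn _)) exchange_big /=.
rewrite -[RHS](sum_box_single F (leq_mdegree r)); apply: eq_bigr => e _.
rewrite -[RHS](@sum_box_single (fun d =>
  if exp_of_box e == r then F (exp_of_box e) else 0) (mdegree r) 0);
  last by move=> i; rewrite ffunE.
apply: eq_bigr => d _; rewrite /mps_term /mps_one.
case: (eqVneq (exp_of_box d) 0) => [->|_]; first by rewrite add0r mul1r.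
by rewrite mul0r if_same.
Qed.

Lemma mps_mulDl : left_distributive mps_mul +%R.
Proof.
move=> F G H; apply/funext => r; rewrite /mps_mul.
rewrite [RHS](_ : _ = mps_mul F H r + mps_mul G H r) // /mps_mul -big_split.
apply: eq_bigr => p _; exact: (mulrDl (F _) (G _) (H _)).
Qed.

Lemma mps_mul_triple F G H r N : (mdegree r <= N)%N ->
  mps_mul F (mps_mul G H) r =
  \sum_(d : exp_box I N) \sum_(e : exp_box I N) \sum_(g : exp_box I N)
    (if exp_of_box d + exp_of_box e + exp_of_box g == r then
      F (exp_of_box d) * G (exp_of_box e) * H (exp_of_box g) else 0).
Proof.
move=> rN; rewrite (mps_mulE _ _ rN); apply: eq_bigr => d _.
have -> : \sum_(x : exp_box I N)
    mps_term F (mps_mul G H) r (exp_of_box d) (exp_of_box x) =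
  \sum_(x : exp_box I N) \sum_(e : exp_box I N) \sum_(g : exp_box I N)
    (if exp_of_box x == exp_of_box e + exp_of_box g then
      if exp_of_box d + exp_of_box x == r then
      F (exp_of_box d) * G (exp_of_box e) * H (exp_of_box g) else 0 else 0).
  apply: eq_bigr => x _; rewrite /mps_term; case: eqP => [xr|_]; last first.
    by rewrite big1 // => e _; rewrite big1 // => g _; rewrite if_same.
  rewrite (@mps_mulE _ _ _ N); last first.
    by rewrite (leq_trans _ rN) // -xr mdegreeD leq_addl.
  rewrite mulr_sumr; apply: eq_bigr => e _; rewrite mulr_sumr.
  apply: eq_bigr => g _; rewrite /mps_term eq_sym.
  by case: eqP; rewrite ?mulr0 // mulrA.
rewrite exchange_big; apply: eq_bigr => e _.
rewrite exchange_big; apply: eq_bigr => g _ /=.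
have [dr|ndr] := eqVneq (exp_of_box d + exp_of_box e + exp_of_box g) r.
  rewrite (@sum_box_single (fun x => if exp_of_box d + x == r then _ else 0)).
    by rewrite addrA dr eqxx.
  move=> i; rewrite (leq_trans (leq_mdegree _ _)) // (leq_trans _ rN) //.
  by rewrite -dr -addrA [in leqRHS]mdegreeD leq_addl.
rewrite big1 // => x _; case: eqP => // ->; rewrite addrA.
by rewrite (negbTE ndr).
Qed.

Lemma mps_mulA : associative mps_mul.
Proof.
move=> F G H; apply/funext => r; rewrite [RHS](_ : _ = mps_mul H (mps_mul F G) r).
  rewrite !(mps_mul_triple _ _ _ (leqnn _)) [RHS]exchange_big.
  apply: eq_bigr => d _; rewrite [RHS]exchange_big /=; apply: eq_bigr => e _.
  apply: eq_bigr => g _; rewrite -[in RHS]addrA [in RHS]addrC.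
  by case: eqP => // _; rewrite -[RHS]mulrA [RHS]mulrC.
by rewrite mps_mulC.
Qed.

HB.instance Definition _ := GRing.Zmodule_isComPzRing.Build (mps I R)
  mps_mulA mps_mulC mps_mul1 mps_mulDl.

Lemma mps_mulrE F G : F * G = mps_mul F G. Proof. by []. Qed.

End MpsRing.

(* The sum of a family of power series whose k-th member has no term of total *)
(* degree < k: only the members of index at most mdegree r contribute to the  *)
(* coefficient at r (see mps_sumE). Other families get a junk value.          *)
Definition mps_sum (I : finType) (R : zmodType) (f : nat -> mps I R) :
  mps I R := fun r => \sum_(0 <= k < (mdegree r).+1) f k r.

Definition mps_order_ge (I : finType) (R : zmodType) (k : nat) (F : mps I R) :=
  forall r, (mdegree r < k)%N -> F r = 0.

Lemma mps_sumE (I : finType) (R : zmodType) (f : nat -> mps I R) r N :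
  (forall k, mps_order_ge k (f k)) -> (mdegree r < N)%N ->
  \sum_(0 <= k < N) f k r = mps_sum f r.
Proof.
move=> ford rN; rewrite /mps_sum (big_cat_nat (n := (mdegree r).+1)) //=.
rewrite [X in _ + X]big_nat_cond [X in _ + X]big1 ?addr0 // => k.
by case/andP=> /andP[rk _] _; apply: ford.
Qed.

(* The product of copies of rat indexed by n >= 1; the n-th component of      *)
(* a : Vring is a n.-1.                                                       *)
Definition Vring := nat -> rat.

HB.instance Definition _ := GRing.ComPzRing.on Vring.
HB.instance Definition _ := GRing.Lmodule.copy Vring (nat -> rat^o).

Definition Vseq (a : nat -> rat) : Vring := fun k => a k.+1.

Definition Vdiv (a b : Vring) : Vring := fun k => a k / b k.

(* The Adams operator of index m >= 1.                                        *)
Definition adams (m : nat) (a : Vring) : Vring := fun k => a (m * k.+1).-1.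

Lemma adams_Vseq (m : nat) (a : nat -> rat) : (0 < m)%N ->
  adams m (Vseq a) = Vseq (fun n => a (m * n)%N).
Proof. by case: m. Qed.

Definition mps_adams (I : finType) (m : nat) (F : mps I Vring) :
  mps I Vring := fun r =>
  if [forall i, (m %| r i)%N] then adams m (F [ffun i => (r i %/ m)%N]) else 0.

Lemma mps_adams_mul (I : finType) (m : nat) (F : mps I Vring)
    (r : {ffun I -> nat}) : (0 < m)%N ->
  mps_adams m F [ffun i => (m * r i)%N] = adams m (F r).
Proof.
move=> m0; rewrite /mps_adams ifT; last by apply/forallP => i; rewrite ffunE dvdn_mulr.
by congr (adams _ (F _)); apply/ffunP => i; rewrite !ffunE mulKn.
Qed.

(* Meaningful for F with zero constant term only; both families summed here   *)
(* then satisfy the hypothesis of mps_sumE, by mps_order_exp and              *)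
(* mps_order_adams.                                                           *)
Definition mps_exp (I : finType) (F : mps I Vring) : mps I Vring :=
  mps_sum (fun k => (k`!%:R^-1 : rat) *: (F ^+ k : mps I Vring)).

Definition plethystic_exp (I : finType) (F : mps I Vring) : mps I Vring :=
  mps_exp (mps_sum (fun k => (k.+1%:R^-1 : rat) *: mps_adams k.+1 F)).

Lemma mps_order_exp (I : finType) (F : mps I Vring) k :
  mps_order_ge 1 F -> mps_order_ge k (k`!%:R^-1 *: (F ^+ k : mps I Vring)).
Proof.
move=> F0 r rk; suff Fk : mps_order_ge k (F ^+ k : mps I Vring).
  have -> : (k`!%:R^-1 *: (F ^+ k : mps I Vring)) r = k`!%:R^-1 *: (F ^+ k) r by [].
  by rewrite Fk ?scaler0.
elim: k {r rk} => [//|k IH] r rk; rewrite exprS mps_mulrE /mps_mul.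
rewrite big1 // => p /eqP; move: (exp_of_box p.1) (exp_of_box p.2) => d e.
move=> /(congr1 (@mdegree I)); rewrite mdegreeD => de.
have [d0|] := posnP (mdegree d); first by rewrite F0 ?d0 // mul0r.
case: (mdegree d) de => // n de _; rewrite IH ?mulr0 // -ltnS (leq_trans _ rk) //.
by rewrite ltnS -de addSn ltnS leq_addl.
Qed.

Lemma mps_order_adams (I : finType) (F : mps I Vring) k :
  mps_order_ge 1 F -> mps_order_ge k.+1 (k.+1%:R^-1 *: mps_adams k.+1 F).
Proof.
move=> F0 r rk.
have -> : (k.+1%:R^-1 *: mps_adams k.+1 F) r = k.+1%:R^-1 *: mps_adams k.+1 F r by [].
rewrite /mps_adams; case: forallP => [dvd|_]; last by rewrite scaler0.
rewrite F0 ?scaler0 // ltnS leqn0 /mdegree big1 // => i _; rewrite ffunE divn_small //.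
exact: leq_ltn_trans (leq_mdegree _ _) rk.
Qed.

Lemma finField_ext (F : finFieldType) (n : nat) : (0 < n)%N ->
  {L : finFieldType | #|L| = (#|F| ^ n)%N}.
Proof.
move=> n0; have [p p_pr pF] := finPcharP F.
have cardF : #|F| = (p ^ logn p #|F|)%N.
  by rewrite {1}(card_pprimeChar pF) (card_pprimeChar pF) pfactorK.
have l0 : (0 < logn p #|F|)%N.
  by rewrite lt0n; apply/eqP => l0; have := finNzRing_gt1 F; rewrite cardF l0.
have k0 : (0 < logn p #|F| * n)%N by rewrite muln_gt0 l0.
have [L _ cardL] := pPrimePowerField p_pr k0; exists L.
by rewrite cardL expnM -cardF.
Qed.

(* The field with #|F| ^ n elements, for n >= 1 (unique up to isomorphism).   *)
Definition Fext (F : finFieldType) (n : nat) : finFieldType :=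
  if n is k.+1 then sval (finField_ext F (ltn0Sn k)) else F.

Lemma card_Fext (F : finFieldType) (n : nat) : (0 < n)%N ->
  #|Fext F n| = (#|F| ^ n)%N.
Proof. by case: n => // k _; apply: (svalP (finField_ext F (ltn0Sn k))). Qed.

(* The class of a variety in Vring: (c (F_(q^n)))_n, with c L its number of   *)
(* L-points.                                                                  *)
Definition Vcount (F : finFieldType) (c : finFieldType -> nat) : Vring :=
  Vseq (fun n => (c (Fext F n))%:R).

(* The element of Vring denoted by a rational function f(q).                  *)
Definition Vfun (F : finFieldType) (f : rat -> rat) : Vring :=
  Vseq (fun n => f ((#|F| ^ n)%N%:R)).

Record quiver := Quiver {
  vertex : finType;
  arrow : finType;
  src : arrow -> vertex;
  tgt : arrow -> vertex }.

Definition euler_form (Q : quiver) (d e : {ffun vertex Q -> nat}) : int :=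
  \sum_i (d i)%:Z * (e i)%:Z - \sum_a (d (src a))%:Z * (e (@tgt Q a))%:Z.

(* K[t]/(t^alpha) for alpha > 0 (for alpha = 0 the library takes K[t]/(t)).    *)
Notation truncpoly K alpha := {poly %/ ('X^alpha : {poly K})}.

Definition algebraic_closure (K : countFieldType) : countClosedFieldType :=
  projT1 (countable_algebraic_closure K).

Definition to_closure (K : countFieldType) :
    {rmorphism K -> algebraic_closure K} :=
  sval (projT2 (countable_algebraic_closure K)).

Definition truncpoly_map (alpha : nat) (K L : fieldType) (f : K -> L)
    (p : truncpoly K alpha) : truncpoly L alpha :=
  in_qpoly 'X^alpha (map_poly f (p : {poly K})).

Section Representations.
Context (Q : quiver) (r : {ffun vertex Q -> nat}).

(* The free modules are the modules 'cV[O]_(r i) of column vectors; linear    *)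
(* maps between them are matrices acting on the left.                         *)
Definition lfrep (O : Type) :=
  {dffun forall a : arrow Q, 'M[O]_(r (tgt a), r (src a))}.

Section OverRing.
Context (O : comNzRingType) (x : lfrep O).

Definition subrep (U : forall i, {pred 'cV[O]_(r i)}) : Prop :=
  (forall i, submod_closed (U i)) /\
  (forall a (v : 'cV[O]_(r (src a))), v \in U (src a) -> x a *m v \in U (tgt a)).

Definition nonzero_family (U : forall i, {pred 'cV[O]_(r i)}) : Prop :=
  exists i, exists2 v, v \in U i & v != 0.

Definition is_direct_sum (U W : forall i, {pred 'cV[O]_(r i)}) : Prop :=
  (forall i v, exists u w, [/\ u \in U i, w \in W i & v = u + w]) /\
  (forall i v, v \in U i -> v \in W i -> v = 0).

Definition indecomposable : Prop :=
  nonzero_family (fun i => predT) /\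
  ~ exists U W, [/\ subrep U, subrep W, nonzero_family U, nonzero_family W
                  & is_direct_sum U W].

End OverRing.

Definition is_morphism (O : comNzRingType) (x y : lfrep O)
  (g : forall i, 'M[O]_(r i)) : Prop :=
  forall a, g (tgt a) *m x a = y a *m g (src a).

Definition isomorphic (O : comUnitRingType) (x y : lfrep O) : Prop :=
  exists2 g : forall i, 'M[O]_(r i),
    is_morphism x y g & forall i, g i \in unitmx.

Context (alpha : nat).

Definition base_change (K L : fieldType) (f : K -> L)
    (x : lfrep (truncpoly K alpha)) : lfrep (truncpoly L alpha) :=
  [ffun a => map_mx (truncpoly_map f) (x a)].

Definition abs_indecomposable (K : finFieldType)
    (x : lfrep (truncpoly K alpha)) : Prop :=
  indecomposable (base_change (@to_closure K) x).

Definition nb_abs_indecomposable (K : finFieldType) : nat :=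
  #|[set [set y | `[< isomorphic x y >]]
     | x : lfrep (truncpoly K alpha) & `[< abs_indecomposable x >]]|.

Definition lfrep_double (O : Type) :=
  (lfrep O * {dffun forall a : arrow Q, 'M[O]_(r (src a), r (tgt a))})%type.

Definition gl (O : Type) := {dffun forall i : vertex Q, 'M[O]_(r i)}.

(* conform_mx casts 'M_(r (tgt a)) (resp. 'M_(r (src a))) to 'M_(r i); its    *)
(* default value 0 is never used, since tgt a = i (resp. src a = i).          *)
Definition moment (O : comNzRingType) (xy : lfrep_double O) : gl O :=
  [ffun i => \sum_(a | tgt a == i) conform_mx 0 (xy.1 a *m xy.2 a)
           - \sum_(a | src a == i) conform_mx 0 (xy.2 a *m xy.1 a)].

Definition nb_moment_zero (K : finFieldType) : nat :=
  #|[set xy : lfrep_double (truncpoly K alpha)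
     | moment xy == [ffun i => 0]]|.

Definition nb_GL (K : finFieldType) : nat :=
  #|[set g : gl (truncpoly K alpha) | [forall i, g i \in unitmx]]|.

End Representations.

(* Main.v *)
From HB Require Import structures.
Require Import Defs.
From mathcomp Require Import all_boot all_order all_fingroup all_algebra all_solvable.
From mathcomp Require Import all_field.
From mathcomp Require Import boolp functions.
From mathcomp Require Import zify ring.

(** Both sides are determined by the same recursion in the rank. Fix a component,
    that is a finite field K with q elements, put O = K[t]/(t^alpha), and let |r| be
    the sum of the entries of r.

    _The left-hand side as a weighted count of classes._ For fixed x, the map
    y |-> moment (x, y) is linear, and under the pairing given by the trace followed by
    the top coefficient of O, which is non-degenerate, it is the transpose of the
    map g |-> g x - x g on gl, whose kernel is End(x). Counting the zeros of the
    resulting bilinear form in two ways gives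
    #{y | moment (x, y) = 0} * #gl = #End(x) * #{y} (card_moment_fibre). Summing over x
    and grouping the x into orbits of GL, the coefficient at r becomes
    Z(r), the sum of #End(X) / #Aut(X) over the isomorphism classes X of rank r
    (moment_zero_class_weight); the power of q is the ratio #gl / #{y}.

    _The recursion for Z._ Since O is finite local, idempotents split and the
    endomorphism ring of an indecomposable I is finite local: it is its residue
    field, with kappa elements, plus nilpotents. The multiplicity of I in X is read
    off the index of the radical in Hom(I, X), and the transitivity of Aut(I + M) on
    split monomorphisms gives w(I + M) (1 - kappa^-(mult_I(M) + 1)) = w(M) for
    the weight w = #End / #Aut (weight_dsum_mult). Writing |rank X| as the sum of
    mult_I(X) |rank I|, and each multiplicity j as
    sum_(k >= 1) (1 - Q^-j) ... (1 - Q^-(j - k + 1)) / (1 - Q^-k) with Q = kappa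
    (qfall_sum), one finds
    |r| Z(r) = sum_(I, k >= 1) |rank I| / (1 - kappa_I^-k) * Z(r - k rank I)
    (class_weight_rec).

    _Absolutely indecomposable representations._ Let I be indecomposable with residue
    field F of degree d over K. Over the extension L of degree m the algebra L (x) F
    acts on the extension of I, and its idempotents, one for each K-embedding of F
    in L, cut out all the absolutely indecomposable summands: d of them, pairwise
    non-isomorphic and of rank (rank I) / d, if d divides m, and none otherwise
    (ext_factors). Every absolutely indecomposable N over L arises so, from a unique I,
    because N is a summand of the extension of its restriction of scalars
    (abs_local_summand) and non-isomorphic indecomposables have no common summand
    after extension (ext_common_summand). Hence A_r(q^m) is the sum over d | m of
    d times the number of indecomposables I of rank d r with kappa = q^d, and the
    recursion for Z becomes |r| Z(r) = sum_(d + e = r) |d| G(d) Z(e), where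
    G(r) is the sum over m | r of A_(r/m)(q^m) / (m (1 - q^-m)) (indec_log_abs).

    _Conclusion._ G is the series whose exponential is the right-hand side, and
    exp(G) satisfies that recursion because the Euler derivation D has
    D exp(G) = D(G) exp(G) (mps_exp_rec). Both sides have constant term 1.

    Absolute indecomposability is handled over the base field: it means that every
    endomorphism is a scalar plus a nilpotent (abs_indecomposable_local). *)

Set Implicit Arguments.
Unset Strict Implicit.
Unset Printing Implicit Defensive.
Import GRing.Theory Num.Theory.
Local Open Scope ring_scope.

(** * Local rings whose non-units are nilpotent *)

Definition nilp (E : pzRingType) (x : E) : Prop := exists n, x ^+ n = 0.

Definition invertible (E : pzRingType) (x : E) : Prop :=
  exists y, y * x = 1 /\ x * y = 1.

Definition local_ring (E : pzRingType) : Prop :=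
  1 <> 0 :> E /\ forall x : E, nilp x \/ invertible x.

Section LocalRing.
Context (E : pzRingType).
Implicit Types x y z : E.

Lemma nilp0 : nilp (0 : E).
Proof. by exists 1; rewrite expr1. Qed.

Lemma nilpN x : nilp x -> nilp (- x).
Proof. by case=> n xn; exists n; rewrite exprNn xn mulr0. Qed.

Lemma nilp_comm x y : GRing.comm x y -> nilp x -> nilp (x * y).
Proof. by move=> cxy [n xn]; exists n; rewrite exprMn_comm // xn mul0r. Qed.

Lemma nilp_swap x y : nilp (x * y) -> nilp (y * x).
Proof.
have sw n : (y * x) ^+ n.+1 = y * (x * y) ^+ n * x.
  elim: n => [|n IH]; first by rewrite expr1 expr0 mulr1.
  by rewrite exprS IH [in RHS]exprS !mulrA.
by case=> n xyn; exists n.+1; rewrite sw xyn mulr0 mul0r.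
Qed.

Lemma invertibleM x y : invertible x -> invertible y -> invertible (x * y).
Proof.
case=> x' [x'x xx'] [y' [y'y yy']]; exists (y' * x'); split.
  by rewrite mulrA -[y' * x' * x]mulrA x'x mulr1.
by rewrite mulrA -[x * y * y']mulrA yy' mulr1.
Qed.

Lemma idempotent_nilp x : x * x = x -> nilp x -> x = 0.
Proof.
move=> xx [n xn]; have h k : x ^+ k.+1 = x by elim: k => // k IH; rewrite exprS IH.
by rewrite -(h n) exprS xn mulr0.
Qed.

Lemma idempotent_invertible x : x * x = x -> invertible x -> x = 1.
Proof. by move=> xx [y [yx _]]; rewrite -yx -{2}xx mulrA yx mul1r. Qed.

Lemma nilp_sub1_inv x : nilp x -> invertible (1 - x).
Proof.
case=> n xn; exists (\sum_(i < n) x ^+ i).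
have h : (1 - x) * (\sum_(i < n) x ^+ i) = 1.
  by rewrite -opprB mulNr -subrX1 xn sub0r opprK.
split=> //; rewrite -[RHS]h mulr_suml mulr_sumr; apply: eq_bigr => i _.
by rewrite mulrBl mulrBr mulr1 mul1r -exprS -exprSr.
Qed.

Lemma nilp_invF x y : 1 <> 0 :> E -> nilp x -> x * y = 1 -> False.
Proof.
move=> E1 [n xn] xy; apply: E1; suff <- : x ^+ n * y ^+ n = 1 by rewrite xn mul0r.
elim: n {xn} => [|n IH]; first by rewrite !expr0 mulr1.
by rewrite exprSr [y ^+ n.+1]exprS mulrA -[_ * x * y]mulrA xy mulr1.
Qed.

Hypothesis loc : local_ring E.

Lemma local_nilp_or x : nilp x \/ invertible x. Proof. exact: loc.2. Qed.

Lemma local_nilpMr x y : nilp x -> nilp (x * y).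
Proof.
move=> nx; case: (local_nilp_or (x * y)) => // -[z [_ xyz]].
by case: (nilp_invF (y := y * z) loc.1 nx); rewrite mulrA.
Qed.

Lemma local_nilpMl x y : nilp x -> nilp (y * x).
Proof. by move=> nx; apply/nilp_swap/local_nilpMr. Qed.

Lemma local_nilpD x y : nilp x -> nilp y -> nilp (x + y).
Proof.
move=> nx ny; case: (local_nilp_or (x + y)) => // -[z [zxy _]].
have [w [_ w2]] := nilp_sub1_inv (local_nilpMl z nx).
case: (nilp_invF (x := z * y) (y := w) loc.1 (local_nilpMl z ny)).
by rewrite -[RHS]w2 -zxy mulrDr [z * x + _]addrC addrK.
Qed.

Lemma local_nilpB x y : nilp x -> nilp y -> nilp (x - y).
Proof. by move=> nx /nilpN; apply: local_nilpD. Qed.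

Lemma local_not_nilp1 : ~ nilp (1 : E).
Proof. by move=> n1; apply: (nilp_invF (y := 1) loc.1 n1); rewrite mulr1. Qed.

Lemma local_prod_nilp (s : seq E) :
  (exists2 x, x \in s & nilp x) -> nilp (\prod_(x <- s) x).
Proof.
elim: s => [[x //]|a s IH] [x]; rewrite inE big_cons => /orP[/eqP-> nx|xs nx].
  exact: local_nilpMr.
by apply: local_nilpMl; apply: IH; exists x.
Qed.

End LocalRing.

Section FiniteRing.
Context (E : finPzRingType).
Implicit Types x y z : E.

Lemma finite_power_idempotent x :
  exists2 n, (0 < n)%N & x ^+ n * x ^+ n = x ^+ n.
Proof.
have [a [b [b0 xab]]] : exists a b, (0 < b)%N /\ x ^+ (a + b) = x ^+ a.
  have /injectivePn[i [j nij /= xij]] :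
      ~~ injectiveb (fun i : 'I_#|E|.+1 => x ^+ i).
    apply/injectiveP => inj; have := max_card [set x ^+ i | i : 'I_#|E|.+1].
    by rewrite card_imset //= card_ord ltnn.
  wlog ij : i j nij xij / (i < j)%N.
    move=> W; case: (ltngtP i j) => [lt|lt|/val_inj e]; [exact: (W i j)|apply: (W j i)|]; rewrite // 1?eq_sym //.
    by rewrite e eqxx in nij.
  by exists i, (j - i)%N; rewrite subn_gt0 ij subnKC ?(ltnW ij).
have step k : x ^+ (a + k * b) = x ^+ a.
  by elim: k => [|k IH]; rewrite ?addn0 // mulSn addnA exprD xab -exprD.
exists (a.+1 * b)%N; first by rewrite muln_gt0.
have le : (a <= a.+1 * b)%N by rewrite (leq_trans (leqnSn a)) // leq_pmulr.
have -> : x ^+ (a.+1 * b) = x ^+ (a + (a.+1 * b - a)) by rewrite subnKC.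
by rewrite [in RHS]exprD -(step a.+1) -!exprD; congr (_ ^+ _); lia.
Qed.

End FiniteRing.

(** Some power of each element of a finite ring is idempotent, hence 0 or 1. *)
Lemma finite_local_ring (E : finPzRingType) : 1 <> 0 :> E ->
  (forall e : E, e * e = e -> e = 0 \/ e = 1) -> local_ring E.
Proof.
move=> E1 idem; split=> // x; have [[//|n] _] := finite_power_idempotent x.
case/idem => [x0|x1]; [left; by exists n.+1|right].
by exists (x ^+ n); rewrite -exprS -exprSr.
Qed.

(** If arbitrarily long products of nilpotent elements were non-zero, two
    partial products of a long one would agree, g = g h with h nilpotent, hence
    g = g h^n = 0. *)
Lemma nilp_ideal_nilpotent (E : finPzRingType) : local_ring E ->
  exists N, forall s : seq E, size s = N -> (forall x, x \in s -> nilp x) ->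
    \prod_(x <- s) x = 0.
Proof.
move=> loc; exists #|E| => s sN snil.
pose g (i : 'I_#|E|.+1) := \prod_(x <- take i s) x.
have /injectivePn[i [j nij /= gij]] : ~~ injectiveb g.
  apply/injectiveP => inj; have := max_card [set g i | i : 'I_#|E|.+1].
  by rewrite card_imset //= card_ord ltnn.
wlog ij : i j nij gij / (i < j)%N.
  move=> W; case: (ltngtP i j) => [lt|lt|/val_inj e]; [exact: (W i j)|apply: (W j i)|]; rewrite // 1?eq_sym //.
  by rewrite e eqxx in nij.
have js : (j <= size s)%N by rewrite sN -ltnS.
set h := \prod_(x <- take (j - i) (drop i s)) x.
have gh : g i * h = g i.
  by rewrite [RHS]gij /g /h -big_cat /= -takeD subnKC // ltnW.
have sz : size (take (j - i) (drop i s)) = (j - i)%N.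
  by rewrite size_takel // size_drop leq_sub2r.
have nh : nilp h.
  apply: (local_prod_nilp loc); exists (nth 0 (take (j - i) (drop i s)) 0).
    by apply: mem_nth; rewrite sz subn_gt0.
  apply: snil; apply: (@mem_drop i _ s); apply: (@mem_take (j - i)).
  by apply: mem_nth; rewrite sz subn_gt0.
have gi0 : g i = 0.
  case: nh => n hn; rewrite -(mulr0 (g i)) -hn.
  by elim: n {hn} => [|n IH]; rewrite ?mulr1 // exprS mulrA gh.
have -> : s = take i s ++ drop i s by rewrite cat_take_drop.
by rewrite big_cat /= -/(g i) gi0 mul0r.
Qed.

(** * The residue field of a finite local ring and its lift *)

Section ResidueField.
Context (E : finNzRingType) (loc : local_ring E).
Implicit Types x y : E.

(** The choice depends only on the residue class of x, so that its fixed points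
    realise the quotient as a finite type. *)
Definition resrep x : E := odflt x [pick y | `[< nilp (x - y) >]].

Lemma resrepP x : nilp (x - resrep x).
Proof.
rewrite /resrep; case: pickP => [y /asboolP //|/(_ x) /asboolP[]].
by rewrite subrr; apply: nilp0.
Qed.

Lemma resrep_eq x y : nilp (x - y) -> resrep x = resrep y.
Proof.
move=> nxy; rewrite /resrep (@eq_pick _ _ (fun z => `[< nilp (y - z) >])) => [|z].
  by case: pickP => // /(_ y) /asboolP[]; rewrite subrr; apply: nilp0.
apply: asbool_equiv_eq; split=> h.
  by rewrite -(subrKA x) -opprB addrC; apply: (local_nilpB loc).
by rewrite -(subrKA y); apply: (local_nilpD loc).
Qed.

Lemma resrepK x : resrep (resrep x) = resrep x.
Proof. by apply/esym/resrep_eq/resrepP. Qed.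

Definition resq := {x : E | resrep x == x}.
HB.instance Definition _ := Finite.on resq.

Definition resproj x : resq := exist _ (resrep x) (introT eqP (resrepK x)).

Lemma resproj_eq x y : nilp (x - y) -> resproj x = resproj y.
Proof. by move=> h; apply: val_inj; apply: resrep_eq. Qed.

Lemma resproj_inj x y : resproj x = resproj y -> nilp (x - y).
Proof.
move=> /(congr1 val) /= h; rewrite -(subrKA (resrep x)).
by apply: (local_nilpD loc) (resrepP x) _; rewrite h -opprB; apply/nilpN/resrepP.
Qed.

Lemma resprojK (a : resq) : resproj (val a) = a.
Proof. by apply: val_inj; apply/eqP; exact: (valP a). Qed.

Definition resadd (a b : resq) := resproj (val a + val b).
Definition resopp (a : resq) := resproj (- val a).
Definition resmul (a b : resq) := resproj (val a * val b).

Lemma resprojD x y : resadd (resproj x) (resproj y) = resproj (x + y).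
Proof.
apply/esym/resproj_eq; rewrite opprD addrACA.
by apply: (local_nilpD loc) (resrepP x) (resrepP y).
Qed.

Lemma resprojN x : resopp (resproj x) = resproj (- x).
Proof. by apply/esym/resproj_eq; rewrite -opprD; apply/nilpN/resrepP. Qed.

Lemma resprojM x y : resmul (resproj x) (resproj y) = resproj (x * y).
Proof.
apply/esym/resproj_eq => /=.
have -> : x * y - resrep x * resrep y =
    (x - resrep x) * y + resrep x * (y - resrep y).
  by rewrite mulrBl mulrBr addrA subrK.
apply: (local_nilpD loc).
  by apply: (local_nilpMr loc); apply: resrepP.
by apply: (local_nilpMl loc); apply: resrepP.
Qed.

Lemma resproj_ind (P : resq -> Prop) : (forall x, P (resproj x)) -> forall a, P a.
Proof. by move=> h a; rewrite -(resprojK a). Qed.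

Lemma resaddA : associative resadd.
Proof.
elim/resproj_ind => x; elim/resproj_ind => y; elim/resproj_ind => z.
by rewrite !resprojD addrA.
Qed.
Lemma resaddC : commutative resadd.
Proof. by elim/resproj_ind => x; elim/resproj_ind => y; rewrite !resprojD addrC. Qed.
Lemma resadd0 : left_id (resproj 0) resadd.
Proof. by elim/resproj_ind => x; rewrite resprojD add0r. Qed.
Lemma resaddN : left_inverse (resproj 0) resopp resadd.
Proof. by elim/resproj_ind => x; rewrite resprojN resprojD addNr. Qed.
HB.instance Definition _ := GRing.isZmodule.Build resq resaddA resaddC resadd0 resaddN.

Lemma resmulA : associative resmul.
Proof.
elim/resproj_ind => x; elim/resproj_ind => y; elim/resproj_ind => z.
by rewrite !resprojM mulrA.
Qed.
Lemma resmul1r : left_id (resproj 1) resmul.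
Proof. by elim/resproj_ind => x; rewrite resprojM mul1r. Qed.
Lemma resmulr1 : right_id (resproj 1) resmul.
Proof. by elim/resproj_ind => x; rewrite resprojM mulr1. Qed.
Lemma resmulDl : left_distributive resmul +%R.
Proof.
elim/resproj_ind => x; elim/resproj_ind => y; elim/resproj_ind => z.
by rewrite /+%R /= !(resprojD, resprojM) mulrDl.
Qed.
Lemma resmulDr : right_distributive resmul +%R.
Proof.
elim/resproj_ind => x; elim/resproj_ind => y; elim/resproj_ind => z.
by rewrite /+%R /= !(resprojD, resprojM) mulrDr.
Qed.
Lemma resone_neq0 : resproj 1 != 0.
Proof.
apply/eqP => /resproj_inj; rewrite subr0; exact: local_not_nilp1.
Qed.
HB.instance Definition _ := GRing.Zmodule_isNzRing.Build resq
  resmulA resmul1r resmulr1 resmulDl resmulDr resone_neq0.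

Definition resinv (a : resq) : resq :=
  odflt a [pick b : resq | (b * a == 1) && (a * b == 1)].

Lemma resinvP (a : resq) : a != 0 -> resinv a * a = 1 /\ a * resinv a = 1.
Proof.
rewrite /resinv; case: pickP => [b /andP[/eqP ? /eqP ?] //|none].
elim/resproj_ind: a none => x none x0; exfalso.
have [nx|[y [yx xy]]] := local_nilp_or loc x.
  by case/eqP: x0; apply: resproj_eq; rewrite subr0.
by have := none (resproj y); rewrite /*%R /= !resprojM yx xy eqxx.
Qed.

Lemma resmulV : {in [pred a : resq | a != 0], left_inverse 1 resinv *%R}.
Proof. by move=> a /resinvP[]. Qed.
Lemma resdivV : {in [pred a : resq | a != 0], right_inverse 1 resinv *%R}.
Proof. by move=> a /resinvP[]. Qed.
Lemma resunitP (a b : resq) : b * a = 1 /\ a * b = 1 -> [pred a : resq | a != 0] a.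
Proof.
case=> ba _ /=; apply/eqP => a0.
by have := resone_neq0; rewrite -[resproj 1]ba a0 mulr0 eqxx.
Qed.
Lemma resinv0 : {in [predC [pred a : resq | a != 0]], resinv =1 id}.
Proof.
move=> a; rewrite !inE negbK => /eqP->; rewrite /resinv; case: pickP => // b.
by rewrite mulr0 mul0r eq_sym (negbTE resone_neq0).
Qed.
HB.instance Definition _ := GRing.NzRing_hasMulInverse.Build resq
  resmulV resdivV resunitP resinv0.

Lemma resq_domain (a b : resq) : a * b = 0 -> (a == 0) || (b == 0).
Proof.
move=> ab; case: eqVneq => //= /resinvP[h _].
by rewrite -[b]mul1r -h -mulrA ab mulr0.
Qed.

(** The quotient by the ideal of nilpotents is a finite division ring, hence
    commutative by Wedderburn's theorem. *)
Lemma residue_field :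
  exists (F : finFieldType) (f : {rmorphism E -> F}),
    (forall u, exists x, f x = u) /\ (forall x, f x = 0 <-> nilp x).
Proof.
exists (FinDomainFieldType (R := resq) resq_domain).
pose f : E -> FinDomainFieldType (R := resq) resq_domain := resproj.
have fB : zmod_morphism f.
  move=> x y; rewrite -[RHS]/(resadd (resproj x) (resopp (resproj y))).
  by rewrite resprojN resprojD.
have fM : monoid_morphism f.
  by split=> // x y; rewrite -[RHS]/(resmul (resproj x) (resproj y)) resprojM.
pose m1 := GRing.isZmodMorphism.Build _ _ f fB.
pose m2 := GRing.isMonoidMorphism.Build _ _ f fM.
pose fm : {rmorphism E -> FinDomainFieldType (R := resq) resq_domain} :=
  HB.pack f m1 m2.
exists fm; split=> [u|x]; first by exists (val u); exact: resprojK.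
split=> [/resproj_inj|nx]; first by rewrite subr0.
by apply: resproj_eq; rewrite subr0.
Qed.

End ResidueField.

Section Teichmueller.
Context (E : pzRingType) (p : nat).
Hypotheses (p_pr : prime p) (pE : p%:R = 0 :> E).

Lemma exprD_pchar_comm (x y : E) n : GRing.comm x y ->
  (x + y) ^+ (p ^ n) = x ^+ (p ^ n) + y ^+ (p ^ n).
Proof.
move=> cxy; elim: n => [|n IH]; first by rewrite !expr1.
rewrite expnSr !exprM IH; have := commrX (p ^ n) (commr_sym (commrX (p ^ n) cxy)).
move: (x ^+ _) (y ^+ _) => {cxy IH}a b /commr_sym cab.
rewrite exprDn_comm // -(prednK (prime_gt0 p_pr)) big_ord_recl big_ord_recr /=.
rewrite bin0 binn subn0 subnn !expr0 mulr1 mul1r !mulr1n big1 ?add0r // => i _.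
have /dvdnP[k ->] : (p %| 'C(p.-1.+1, bump 0 i))%N.
  rewrite prednK ?prime_gt0 // prime_dvd_bin // /bump /= add1n /=.
  by have := ltn_ord i; lia.
by rewrite -mulr_natr natrM pE mulr0 mulr0.
Qed.

Lemma exprN_pchar (x : E) n : (- x) ^+ (p ^ n) = - x ^+ (p ^ n).
Proof.
have := exprD_pchar_comm n (commr_sym (commrN (commr_refl x))).
by rewrite addNr expr0n expn_eq0 -leqn0 leqNgt prime_gt0 //= => /eqP; rewrite eq_sym addr_eq0 => /eqP.
Qed.

Lemma exprB_pchar_comm (x y : E) n : GRing.comm x y ->
  (x - y) ^+ (p ^ n) = x ^+ (p ^ n) - y ^+ (p ^ n).
Proof. by move=> cxy; rewrite exprD_pchar_comm ?exprN_pchar //; apply: commrN. Qed.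

Lemma expr_pow_fixed (x : E) e k : x ^+ (p ^ e) = x -> x ^+ (p ^ (e * k)) = x.
Proof. by move=> xe; elim: k => [|k IH]; rewrite ?muln0 // mulnS expnD exprM xe. Qed.

Lemma nilp_pchar (x : E) e : (0 < e)%N -> nilp x ->
  exists k, x ^+ (p ^ (e * k)) = 0.
Proof.
move=> e0 [n xn]; exists n; have le : (n <= p ^ (e * n))%N.
  rewrite (leq_trans (ltnW (ltn_expl n (prime_gt1 p_pr)))) //.
  by rewrite leq_exp2l ?prime_gt1 // leq_pmull.
by rewrite -(subnKC le) exprD xn mul0r.
Qed.

(** Iterated Frobenius is additive on commuting elements, and a large iterate
    kills their difference. *)
Lemma frobenius_fixed_eq (x y : E) e : (0 < e)%N -> GRing.comm x y ->
  x ^+ (p ^ e) = x -> y ^+ (p ^ e) = y -> nilp (x - y) -> x = y.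
Proof.
move=> e0 cxy xe ye nxy; have [k] := nilp_pchar e0 nxy.
by rewrite exprB_pchar_comm // !expr_pow_fixed // => /eqP; rewrite subr_eq0 => /eqP.
Qed.

End Teichmueller.

Lemma finField_generator (F : finFieldType) :
  exists2 x : F, x != 0 & forall y : F, y != 0 -> exists k : nat, y = x ^+ k.
Proof.
have /cyclicP[u Fu] := field_unit_group_cyclic [set: {unit F}]%G.
exists (val u) => [|y y0]; first by rewrite -unitfE (valP u).
have yU : y \is a GRing.unit by rewrite unitfE.
have /cycleP[k yk] : FinRing.unit F yU \in <[u]>%g.
  by rewrite -Fu inE.
by exists k; have /(congr1 val) := yk; rewrite /= FinRing.val_unitX.
Qed.

Lemma expf_card_pred (F : finFieldType) (x : F) : x != 0 -> x ^+ #|F|.-1 = 1.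
Proof.
move=> x0; apply: (mulfI x0); rewrite mulr1 -exprS prednK ?expf_card //.
exact: ltnW (finNzRing_gt1 F).
Qed.

(** Lifting a generator of the cyclic group F^* and raising it to a large power
    of #|F| gives an element whose powers lift F^*; together with 0 they form a
    field because they commute and are fixed by Frobenius, so that each is
    determined by its residue. *)
Lemma teichmueller_lift (E : finPzRingType) (p : nat) (F : finFieldType)
    (f : {rmorphism E -> F}) : prime p -> p%:R = 0 :> E ->
  (forall u, exists x, f x = u) -> (forall x, f x = 0 -> nilp x) ->
  exists h : {rmorphism F -> E}, forall u, f (h u) = u.
Proof.
move=> p_pr pE fsurj fker; have [th th0 thgen] := finField_generator F.
have pF : p \in [pchar F].
  by rewrite inE p_pr -(rmorph_nat f) pE rmorph0 eqxx.
have [e cardF] : exists e, #|F| = (p ^ e)%N by exists (logn p #|F|); exact: (card_pprimeChar pF).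
have e0 : (0 < e)%N.
  by rewrite lt0n; apply/eqP => e0; have := finNzRing_gt1 F; rewrite cardF e0.
have [y0 fy0] := fsurj th.
have n1 : nilp (y0 ^+ (p ^ e).-1 - 1).
  apply: fker; rewrite rmorphB rmorphXn rmorph1 fy0 -cardF.
  by rewrite expf_card_pred // subrr.
have [k yk] := nilp_pchar p_pr e0 n1.
(* The exponent is a power of #|F|, which does not change the residue. *)
pose y := y0 ^+ (p ^ (e * k)).
have fy : f y = th.
  rewrite rmorphXn fy0; elim: k {yk y} => [|k IH]; first by rewrite muln0.
  by rewrite mulnS expnD exprM -cardF expf_card.
have yq1 : y ^+ (p ^ e).-1 = 1.
  rewrite -exprM mulnC exprM; apply/eqP; rewrite -subr_eq0 -yk.
  by rewrite (exprB_pchar_comm p_pr pE) ?expr1n //; exact: commr1.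
have yq : y ^+ (p ^ e) = y.
  have p_gt0 : (0 < p ^ e)%N by rewrite expn_gt0 prime_gt0.
  by rewrite -(prednK p_gt0) exprS yq1 mulr1.
pose teich t := t = 0 \/ exists j : nat, t = y ^+ j.
have yC t u : teich t -> teich u -> GRing.comm t u.
  case=> [->|[i ->]] [->|[j ->]]; try exact: commr0; try exact/commr_sym/commr0.
  by apply/commrX/commr_sym/commrX; exact: commr_refl.
have teichq t : teich t -> t ^+ (p ^ e) = t.
  case=> [->|[j ->]]; last by rewrite -exprM mulnC exprM yq.
  by rewrite expr0n expn_eq0 -leqn0 leqNgt prime_gt0.
have ex u : exists t, teich t /\ f t = u.
  have [->|/thgen[j ->]] := eqVneq u 0.
    by exists 0; split; [left|rewrite rmorph0].
  by exists (y ^+ j); split; [right; exists j|rewrite rmorphXn fy].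
have [h hP] := choice ex.
have uniq_h t u : GRing.comm t (h u) -> t ^+ (p ^ e) = t -> f t = u -> t = h u.
  move=> tc tq ft; have [hu fhu] := hP u.
  apply: (frobenius_fixed_eq p_pr pE e0 tc tq (teichq _ hu)).
  by apply: fker; rewrite rmorphB ft fhu subrr.
have hC u v : GRing.comm (h u) (h v) by apply: yC; apply: (hP _).1.
have hq u : h u ^+ (p ^ e) = h u by apply: teichq; apply: (hP _).1.
have hB : zmod_morphism h.
  move=> u v; apply/esym/uniq_h.
  - by apply/commr_sym/commrB.
  - by rewrite (exprB_pchar_comm p_pr pE) ?hq.
  - by rewrite rmorphB !(hP _).2.
have hM : monoid_morphism h.
  split; first by apply/esym/uniq_h; [exact/commr_sym/commr1|rewrite expr1n|rewrite rmorph1].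
  move=> u v; apply/esym/uniq_h.
  - by apply/commr_sym/commrM.
  - by rewrite exprMn_comm ?hq.
  - by rewrite rmorphM !(hP _).2.
pose m1 := GRing.isZmodMorphism.Build _ _ h hB.
pose m2 := GRing.isMonoidMorphism.Build _ _ h hM.
pose hm : {rmorphism F -> E} := HB.pack h m1 m2.
by exists hm => u; exact: (hP u).2.
Qed.

(** Wedderburn-Malcev decomposition of a finite local ring. *)
Lemma local_ring_residue_lift (E : finNzRingType) (p : nat) :
  prime p -> p%:R = 0 :> E -> local_ring E ->
  exists (F : finFieldType) (f : {rmorphism E -> F}) (h : {rmorphism F -> E}),
    (forall u, f (h u) = u) /\ (forall x, f x = 0 <-> nilp x).
Proof.
move=> p_pr pE loc; have [F [f [fsurj fker]]] := residue_field loc.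
have [|h hK] := teichmueller_lift p_pr pE fsurj; first by move=> x /fker.
by exists F, f, h.
Qed.

(** * Embeddings of finite fields *)

Lemma card_finField_pchar (F : finFieldType) :
  exists p e, [/\ prime p, p \in [pchar F], (0 < e)%N & #|F| = (p ^ e)%N].
Proof.
have [p p_pr pF] := finPcharP F; exists p, (logn p #|F|); split=> //.
  rewrite lt0n; apply/eqP => e0; have := finNzRing_gt1 F.
  by rewrite (card_pprimeChar pF) e0.
exact: (card_pprimeChar pF).
Qed.

Lemma expf_card_exp (F : finFieldType) (x : F) k : x ^+ (#|F| ^ k) = x.
Proof. by elim: k => [|k IH]; rewrite ?expr1 // expnSr exprM IH expf_card. Qed.

(** The j-th power of the Frobenius automorphism of F over K; the embedding of K
    in F makes it a ring morphism. *)
Definition frobenius_over (K F : finFieldType) (f : {rmorphism K -> F}) (j : nat)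
  (x : F) : F := x ^+ (#|K| ^ j).

Lemma sum1_units (F : finFieldType) : \sum_(u : F | u != 0) (1 : F) = -1.
Proof.
rewrite sumr_const; have -> : #|[pred u : F | u != 0]| = #|F|.-1.
  by have := cardC1 (0 : F); rewrite /= => <-; apply: eq_card => u; rewrite !inE.
apply/eqP; rewrite -subr_eq0 opprK -mulrSr prednK; last exact: ltnW (finNzRing_gt1 F).
have [p [e [p_pr pF e0 ->]]] := card_finField_pchar F.
by rewrite -(prednK e0) expnS natrM (pcharf0 pF) mul0r.
Qed.

Section FrobeniusOver.
Context (K F : finFieldType) (f : {rmorphism K -> F}).

Lemma frobenius_over_is_zmod j : zmod_morphism (frobenius_over f j).
Proof.
have [p [e [p_pr pK _ Hq]]] := card_finField_pchar K => x y.
rewrite /frobenius_over Hq -expnM exprB_pchar_comm //; last exact: mulrC.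
by move: pK; rewrite -(fmorph_pchar f) => /andP[_ /eqP].
Qed.

Lemma frobenius_over_is_monoid j : monoid_morphism (frobenius_over f j).
Proof. by rewrite /frobenius_over; split=> [|x y]; rewrite ?expr1n // exprMn. Qed.

HB.instance Definition _ j := GRing.isZmodMorphism.Build F F
  (frobenius_over f j) (frobenius_over_is_zmod j).
HB.instance Definition _ j := GRing.isMonoidMorphism.Build F F
  (frobenius_over f j) (frobenius_over_is_monoid j).

Lemma frobenius_overE j x : frobenius_over f j x = x ^+ (#|K| ^ j).
Proof. by []. Qed.

Lemma frobenius_over_base j c : frobenius_over f j (f c) = f c.
Proof. by rewrite frobenius_overE -rmorphXn expf_card_exp. Qed.

(** The polynomial X^n - X has at most n roots, so its roots do not fill F when
    n < #|F|. *)
Lemma exp_fixed_all n : (1 < n)%N -> (forall x : F, x ^+ n = x) -> (#|F| <= n)%N.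
Proof.
move=> n1 fix_n; have sz : size ('X^n - 'X : {poly F}) = n.+1.
  by rewrite size_polyDl ?size_polyN ?size_polyXn // size_polyX.
have p0 : ('X^n - 'X : {poly F}) != 0 by rewrite -size_poly_eq0 sz.
have := max_poly_roots p0 (rs := enum F).
rewrite sz ltnS -cardE; apply; last exact: enum_uniq.
by apply/allP => x _; rewrite rootE !hornerE fix_n subrr.
Qed.

Lemma frobenius_fixed_base x : x ^+ #|K| = x -> exists c, x = f c.
Proof.
move=> xq; pose n := #|K|; have n1 : (1 < n)%N := finNzRing_gt1 K.
have sz : size ('X^n - 'X : {poly F}) = n.+1.
  by rewrite size_polyDl ?size_polyN ?size_polyXn // size_polyX.
have p0 : ('X^n - 'X : {poly F}) != 0 by rewrite -size_poly_eq0 sz.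
suff /imageP[c _ xc] : x \in codom f by exists c.
apply/negPn/negP => xK; have := max_poly_roots p0 (rs := x :: codom f).
rewrite sz /= size_codom ltnS ltnn => h; suff: false by []; apply: h; last first.
  by rewrite xK; apply/injectiveP; apply: fmorph_inj.
rewrite rootE !hornerE xq subrr eqxx /=; apply/allP => _ /imageP[c _ ->].
by rewrite rootE !hornerE -rmorphXn expf_card subrr.
Qed.

Context (d : nat).
Hypothesis cardF : #|F| = (#|K| ^ d)%N.

(** The Galois group of F over K has order d. *)
Lemma frobenius_over_trivial r : (r < d)%N ->
  (forall x : F, x ^+ (#|K| ^ r) = x) -> r = 0%N.
Proof.
move=> rd fixr; apply/eqP; rewrite -leqn0 leqNgt; apply/negP => r0.
have K1 := finNzRing_gt1 K.
have /exp_fixed_all/(_ fixr) : (1 < #|K| ^ r)%N by rewrite -{1}(exp1n r) ltn_exp2r.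
by rewrite cardF leq_exp2l // leqNgt rd.
Qed.

Lemma card_ext_pos : (0 < d)%N.
Proof.
rewrite lt0n; apply/eqP => d0; have := finNzRing_gt1 F.
by rewrite cardF d0.
Qed.

(** There are more polynomials of degree at most d than elements of F. *)
Lemma annihilating_poly (x : F) :
  exists2 P : {poly K}, P != 0 & (size P <= d.+1)%N /\ (map_poly f P).[x] = 0.
Proof.
pose ev (P : {poly_d.+1 K}) := (map_poly f P).[x].
have /injectivePn[P [P' nPP evP]] : ~~ injectiveb ev.
  apply/injectiveP => inj; have := leq_card ev inj.
  by rewrite card_npoly cardF leq_exp2l ?finNzRing_gt1 // ltnn.
exists (P - P' : {poly K}).
  by rewrite subr_eq0; apply: contra nPP => /eqP e; apply/eqP/val_inj.
split; last by rewrite rmorphB hornerD hornerN; apply/eqP; rewrite subr_eq0; apply/eqP.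
exact: size_npoly (P - P').
Qed.

End FrobeniusOver.

Section Embeddings.
Context (K F : finFieldType) (L : fieldType).
Context (f : {rmorphism K -> F}) (g : {rmorphism K -> L}).
Context (d : nat).
Hypothesis cardF : #|F| = (#|K| ^ d)%N.

(** A root in L of the minimal polynomial over K of a generator of F gives the
    embedding. *)
Lemma finField_embedding :
  (forall P : {poly K}, P %| 'X^#|F| - 'X -> (1 < size P)%N -> exists z, root (map_poly g P) z) ->
  exists h : {rmorphism F -> L}, forall c, h (f c) = g c.
Proof.
move=> has_root; have [th th0 thgen] := finField_generator F.
pose ev (P : {poly K}) := (map_poly f P).[th].
have ex : exists n, `[< exists2 P : {poly K}, P != 0 & size P = n /\ ev P = 0 >].
  by have [P P0 [_ evP]] := annihilating_poly f cardF th; exists (size P); apply/asboolP; exists P.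
case: (ex_minnP ex) => n /asboolP[P P0 [szP evP]] minP.
have evD : forall A B, ev (A - B) = ev A - ev B.
  by move=> A B; rewrite /ev rmorphB hornerD hornerN.
have evM : forall A B, ev (A * B) = ev A * ev B.
  by move=> A B; rewrite /ev rmorphM hornerM.
have kerP A : ev A = 0 -> P %| A.
  move=> evA; apply: contraT => nz.
  have : (n <= size (modp A P))%N.
    apply: minP; apply/asboolP; exists (modp A P) => //; split=> //.
    have -> : modp A P = A - divp A P * P by apply/eqP; rewrite eq_sym subr_eq addrC -divp_eq.
    by rewrite evD evM evA evP mulr0 subr0.
  by rewrite -szP leqNgt ltn_modp P0.
have [||z /eqP Pz] := has_root P.
- by apply: kerP; rewrite evD /ev map_polyXn map_polyX !hornerE expf_card subrr.
- rewrite ltnNge; apply/negP => /size1_polyC Pc.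
  move: evP P0; rewrite /ev Pc map_polyC hornerC => /eqP.
  by rewrite fmorph_eq0 polyC_eq0 => /eqP->; rewrite eqxx.
have /choice[rep repP] : forall u, exists A, ev A = u.
  move=> u; have [->|/thgen[j ->]] := eqVneq u 0.
    by exists 0; rewrite /ev rmorph0 horner0.
  by exists 'X^j; rewrite /ev map_polyXn hornerXn.
pose h u := (map_poly g (rep u)).[z].
have h_uniq A u : ev A = u -> (map_poly g A).[z] = h u.
  move=> evA; apply/eqP; rewrite -subr_eq0 -hornerN -hornerD -rmorphB.
  have : P %| A - rep u by apply: kerP; rewrite evD repP evA subrr.
  by case/dvdpP => B ->; rewrite rmorphM hornerM Pz mulr0.
have hB : zmod_morphism h.
  by move=> u v; rewrite -(h_uniq (rep u - rep v)) ?evD ?repP // rmorphB hornerD hornerN.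
have hM : monoid_morphism h.
  split=> [|u v]; last by rewrite -(h_uniq (rep u * rep v)) ?evM ?repP // rmorphM hornerM.
  by rewrite -(h_uniq 1) /ev ?rmorph1 hornerC.
pose m1 := GRing.isZmodMorphism.Build _ _ h hB.
pose m2 := GRing.isMonoidMorphism.Build _ _ h hM.
pose hm : {rmorphism F -> L} := HB.pack h m1 m2.
by exists hm => c; rewrite /= -(h_uniq c%:P) /ev ?map_polyC ?hornerC.
Qed.

Section FromOne.
Context (h0 : {rmorphism F -> L}).
Hypothesis h0f : forall c, h0 (f c) = g c.

Lemma frobenius_conj_inj (x : F) : (forall y : F, y != 0 -> exists k : nat, y = x ^+ k) ->
  injective (fun j : 'I_d => x ^+ (#|K| ^ j)).
Proof.
move=> xgen i j; wlog ij : i j / (i <= j)%N.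
  by move=> W; case/orP: (leq_total i j) => [/W//|/W h /esym/h].
move=> /= xij; apply: val_inj => /=.
have di : (j - i < d)%N by rewrite (leq_ltn_trans (leq_subr _ _)).
suff /(frobenius_over_trivial cardF di) : forall y : F, y ^+ (#|K| ^ (j - i)) = y by lia.
have fixx : x ^+ (#|K| ^ (j - i)) = x.
  apply: (fmorph_inj (frobenius_over f i)); rewrite /= /frobenius_over.
  by rewrite -exprM -expnD subnK.
move=> y; have [->|/xgen[k ->]] := eqVneq y 0.
  by rewrite expr0n expn_eq0 -leqn0 leqNgt ltnW ?finNzRing_gt1.
by rewrite -exprM mulnC exprM fixx.
Qed.

Definition conj_embedding (j : nat) : {rmorphism F -> L} := h0 \o frobenius_over f j.

Lemma conj_embeddingE j u : conj_embedding j u = h0 u ^+ (#|K| ^ j).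
Proof. by rewrite /= /frobenius_over rmorphXn. Qed.

Lemma conj_embedding_base j c : conj_embedding j (f c) = g c.
Proof. by rewrite /= frobenius_over_base h0f. Qed.

Lemma conj_embedding_inj (i j : 'I_d) : conj_embedding i =1 conj_embedding j -> i = j.
Proof.
have [th _ thgen] := finField_generator F => /(_ th) /= /(fmorph_inj h0).
exact: frobenius_conj_inj.
Qed.

(** The conjugates of a generator of F already exhaust the roots of a polynomial
    over K of degree at most d that annihilates it. *)
Lemma embedding_conj (h : {rmorphism F -> L}) : (forall c, h (f c) = g c) ->
  exists j : 'I_d, h =1 conj_embedding j.
Proof.
move=> hf; have [th th0 thgen] := finField_generator F.
have [P P0 [szP evP]] := annihilating_poly f cardF th.
have rootP (h' : {rmorphism F -> L}) : (forall c, h' (f c) = g c) ->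
    root (map_poly g P) (h' th).
  move=> h'f; have -> : map_poly g P = map_poly h' (map_poly f P).
    by rewrite -map_poly_comp; apply: eq_map_poly => c /=.
  by rewrite rootE horner_map evP rmorph0.
have [/imageP[j _ hj]|nin] := boolP (h th \in codom (fun j : 'I_d => conj_embedding j th)).
  exists j => u; have [->|/thgen[k ->]] := eqVneq u 0; first by rewrite !rmorph0.
  by rewrite !rmorphXn hj.
have gP0 : map_poly g P != 0 by rewrite map_poly_eq0.
have := max_poly_roots gP0 (rs := h th :: codom (fun j : 'I_d => conj_embedding j th)).
rewrite /= size_codom card_ord size_map_poly => lt.
suff : (d.+1 < d.+1)%N by rewrite ltnn.
apply: leq_trans szP; apply: lt; last first.
  rewrite nin; apply/injectiveP => i j /(fmorph_inj h0).
  exact: frobenius_conj_inj.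
rewrite rootP //=; apply/allP => _ /imageP[j _ ->]; exact: (rootP (conj_embedding j) (conj_embedding_base j)).
Qed.

End FromOne.
End Embeddings.

(** X^#|F| - X divides X^#|L| - X, which splits into linear factors over L. *)
Lemma finField_embedding_finite (K F L : finFieldType) (f : {rmorphism K -> F})
    (g : {rmorphism K -> L}) d k : #|F| = (#|K| ^ d)%N -> #|L| = (#|F| ^ k)%N ->
  exists h : {rmorphism F -> L}, forall c, h (f c) = g c.
Proof.
move=> cardF cardL; apply: (finField_embedding f cardF) => P dP szP.
have : map_poly g P %| \prod_x ('X - x%:P).
  rewrite -finField_genPoly cardL.
  have := dP; rewrite -(dvdp_map g) rmorphB /= map_polyXn map_polyX => /dvdp_trans; apply.
  elim: k {cardL} => [|k IH]; first by rewrite expn0 expr1 subrr dvdp0.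
  have -> : 'X^(#|F| ^ k.+1) - 'X = ('X^(#|F| ^ k.+1) - 'X^#|F|) + ('X^#|F| - 'X) :> {poly L}.
    by rewrite addrA subrK.
  rewrite dvdp_addl ?dvdpp // expnSr exprM.
  by rewrite subrXX dvdp_mulr.
rewrite -big_enum /= => /dvdp_prod_XsubC[m eqp_m].
move: szP; rewrite -(size_map_poly g) (eqp_size eqp_m) size_prod_XsubC.
case: (mask m _) eqp_m => // z s eqp_m _.
by exists z; rewrite (eqp_root eqp_m) root_prod_XsubC mem_head.
Qed.

(** The Frobenius of L over K, which has order m, restricts to that of F, of
    order d. *)
Lemma embedding_degree_dvd (K F L : finFieldType) d m
    (h : {rmorphism F -> L}) : #|F| = (#|K| ^ d)%N -> #|L| = (#|K| ^ m)%N -> (d %| m)%N.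
Proof.
move=> cardF cardL; have d0 := card_ext_pos cardF.
suff /eqP : (m %% d = 0)%N by [].
apply: (frobenius_over_trivial cardF) => [|x]; first by rewrite ltn_mod.
apply: (fmorph_inj h); rewrite rmorphXn -[RHS]expf_card cardL {2}(divn_eq m d).
by rewrite expnD exprM [(_ %/ d * d)%N]mulnC expnM -cardF -[in RHS]rmorphXn expf_card_exp.
Qed.

(** Both fields contain the prime field, over which embeddings are known. *)
Lemma finField_morphism (K L : finFieldType) k : #|L| = (#|K| ^ k)%N ->
  inhabited {rmorphism K -> L}.
Proof.
move=> cardL; have [p [e [p_pr pK e0 cardK]]] := card_finField_pchar K.
have pL : p \in [pchar L].
  have [p' [e' [p'_pr p'L e'0 cardL']]] := card_finField_pchar L.
  have k0 : (0 < k)%N.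
    by rewrite lt0n; apply/eqP => k0; have := finNzRing_gt1 L; rewrite cardL k0.
  have : (p %| p' ^ e')%N.
    by rewrite -cardL' cardL cardK -expnM -(prednK (n := e * k)) ?muln_gt0 ?e0 // expnS dvdn_mulr.
  by rewrite Euclid_dvdX // dvdn_prime2 // => /andP[/eqP-> _].
have cardFp : #|K| = (#|'F_p| ^ e)%N by rewrite card_Fp.
pose fK : {rmorphism 'F_p -> pPrimeCharType pK} := GRing.in_alg (pPrimeCharType pK).
pose fL : {rmorphism 'F_p -> pPrimeCharType pL} := GRing.in_alg (pPrimeCharType pL).
by have [h _] := finField_embedding_finite (fK : {rmorphism 'F_p -> K})
  (fL : {rmorphism 'F_p -> L}) cardFp cardL.
Qed.

Lemma card_finField_ext (K F : finFieldType) (h : {rmorphism K -> F}) :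
  exists d, #|F| = (#|K| ^ d)%N.
Proof.
have [p [e [p_pr pK e0 cardK]]] := card_finField_pchar K.
have pF : p \in [pchar F] by rewrite (fmorph_pchar h).
have cardF : #|F| = (p ^ logn p #|F|)%N by exact: (card_pprimeChar pF).
have /dvdnP[d ed] : (e %| logn p #|F|)%N.
  by apply: (embedding_degree_dvd (K := 'F_p) h); rewrite card_Fp.
by exists d; rewrite cardF ed mulnC expnM -cardK.
Qed.

(** * The category of locally free representations *)

(** Ranks are plain functions here, so that the rank of a direct sum at a vertex
    is convertible to a sum and block matrices need no casts. *)
Record rep (Q : quiver) (R : Type) := Rep {
  rk : vertex Q -> nat;
  act : forall a : arrow Q, 'M[R]_(rk (tgt a), rk (src a)) }.

Definition fam (I : finType) (R : Type) (m n : I -> nat) :=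
  {dffun forall i, 'M[R]_(m i, n i)}.

Identity Coercion dffun_of_fam : fam >-> dfinfun_of.

HB.instance Definition _ (I : finType) (R : choiceType) (m n : I -> nat) :=
  Choice.on (fam R m n).
HB.instance Definition _ (I : finType) (R : finType) (m n : I -> nat) :=
  Finite.on (fam R m n).

Lemma famP (I : finType) (R : Type) (m n : I -> nat) (f g : fam R m n) :
  (forall i, f i = g i) -> f = g.
Proof. by move=> h; apply/ffunP. Qed.

Section FamLmodule.
Context (I : finType) (R : pzRingType) (m n : I -> nat).
Implicit Types f g h : fam R m n.

Definition fam0 : fam R m n := [ffun i => 0].
Definition famD f g : fam R m n := [ffun i => f i + g i].
Definition famN f : fam R m n := [ffun i => - f i].
Definition famZ (c : R) f : fam R m n := [ffun i => c *: f i].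

Lemma famDA : associative famD.
Proof. by move=> f g h; apply/famP => i; rewrite !ffunE addrA. Qed.
Lemma famDC : commutative famD.
Proof. by move=> f g; apply/famP => i; rewrite !ffunE addrC. Qed.
Lemma fam0D : left_id fam0 famD.
Proof. by move=> f; apply/famP => i; rewrite !ffunE add0r. Qed.
Lemma famND : left_inverse fam0 famN famD.
Proof. by move=> f; apply/famP => i; rewrite !ffunE addNr. Qed.
HB.instance Definition _ := GRing.isZmodule.Build (fam R m n) famDA famDC fam0D famND.

Lemma famZA c d f : famZ c (famZ d f) = famZ (c * d) f.
Proof. by apply/famP => i; rewrite !ffunE scalerA. Qed.
Lemma famZ1 : left_id 1 famZ.
Proof. by move=> f; apply/famP => i; rewrite !ffunE scale1r. Qed.
Lemma famZDr : right_distributive famZ +%R.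
Proof. by move=> c f g; apply/famP => i; rewrite !ffunE scalerDr. Qed.
Lemma famZDl f : {morph famZ^~ f : c d / c + d}.
Proof. by move=> c d; apply/famP => i; rewrite !ffunE scalerDl. Qed.
HB.instance Definition _ := GRing.Zmodule_isLmodule.Build R (fam R m n)
  famZA famZ1 famZDr famZDl.

Lemma fam0E i : (0 : fam R m n) i = 0. Proof. by rewrite ffunE. Qed.
Lemma famDE f g i : (f + g) i = f i + g i. Proof. by rewrite ffunE. Qed.
Lemma famNE f i : (- f) i = - f i. Proof. by rewrite ffunE. Qed.
Lemma famZE c f i : (c *: f) i = c *: f i. Proof. by rewrite ffunE. Qed.
Definition famE := (fam0E, famDE, famNE, famZE).
End FamLmodule.

Section Hom.
Context (Q : quiver) (R : comNzRingType).
Implicit Types X Y Z W : rep Q R.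

Definition is_hom_pred X Y (f : fam R (rk Y) (rk X)) :=
  [forall a, f (tgt a) *m act X a == act Y a *m f (src a)].
Arguments is_hom_pred X Y f /.
Definition is_hom X Y := [qualify a f | is_hom_pred (X := X) (Y := Y) f].

Lemma is_homP X Y (f : fam R (rk Y) (rk X)) :
  reflect (forall a, f (tgt a) *m act X a = act Y a *m f (src a)) (f \is a is_hom X Y).
Proof.
rewrite qualifE /is_hom_pred.
by apply: (iffP forallP) => h a; apply/eqP; apply: h.
Qed.

Fact is_hom_submod_closed X Y : submod_closed (is_hom X Y).
Proof.
split=> [|c f g /is_homP fP /is_homP gP]; apply/is_homP => a.
  by rewrite !famE mul0mx mulmx0.
by rewrite !famE mulmxDl mulmxDr -scalemxAl -scalemxAr fP gP.
Qed.
HB.instance Definition _ X Y := GRing.isSubmodClosed.Build R (fam R (rk Y) (rk X))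
  (@is_hom_pred X Y) (@is_hom_submod_closed X Y).

Record hom X Y : predArgType := Hom {
  hom_fam :> fam R (rk Y) (rk X);
  _ : hom_fam \is a is_hom X Y }.

HB.instance Definition _ X Y := [isSub for @hom_fam X Y].
HB.instance Definition _ X Y := [Choice of hom X Y by <:].
HB.instance Definition _ X Y := [SubChoice_isSubLmodule of hom X Y by <:].

Lemma homP X Y (f g : hom X Y) : (forall i, f i = g i) -> f = g.
Proof. by move=> h; apply/val_inj/famP. Qed.

Lemma hom_act X Y (f : hom X Y) a : f (tgt a) *m act X a = act Y a *m f (src a).
Proof. by case: f => f fP; apply/is_homP. Qed.

Lemma hom0E X Y i : (0 : hom X Y) i = 0. Proof. by rewrite famE. Qed.
Lemma homDE X Y (f g : hom X Y) i : (f + g) i = f i + g i. Proof. by rewrite famE. Qed.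
Lemma homNE X Y (f : hom X Y) i : (- f) i = - f i. Proof. by rewrite famE. Qed.
Lemma homZE X Y c (f : hom X Y) i : (c *: f) i = c *: f i. Proof. by rewrite famE. Qed.

Definition mkhom X Y (f : forall i, 'M[R]_(rk Y i, rk X i))
    (fP : forall a, f (tgt a) *m act X a = act Y a *m f (src a)) : hom X Y.
Proof. by exists [ffun i => f i]; apply/is_homP => a; rewrite !ffunE. Defined.
Arguments mkhom {X Y} f fP.

Lemma mkhomE X Y f fP i : @mkhom X Y f fP i = f i. Proof. by rewrite ffunE. Qed.

Lemma comp_subproof X Y Z (g : hom Y Z) (f : hom X Y) a :
  (g (tgt a) *m f (tgt a)) *m act X a = act Z a *m (g (src a) *m f (src a)).
Proof. by rewrite -mulmxA hom_act mulmxA hom_act -mulmxA. Qed.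
Definition comp X Y Z (g : hom Y Z) (f : hom X Y) : hom X Z :=
  mkhom (fun i => g i *m f i) (comp_subproof g f).

Lemma idh_subproof X a : 1%:M *m act X a = act X a *m 1%:M.
Proof. by rewrite mul1mx mulmx1. Qed.
Definition idh X : hom X X := mkhom (fun i => 1%:M) (idh_subproof X).

Lemma compE X Y Z (g : hom Y Z) (f : hom X Y) i : comp g f i = g i *m f i.
Proof. exact: mkhomE. Qed.
Lemma idhE X i : idh X i = 1%:M. Proof. exact: mkhomE. Qed.
Definition homE := (hom0E, homDE, homNE, homZE, compE, idhE, mkhomE).

Lemma compA X Y Z W (h : hom Z W) (g : hom Y Z) (f : hom X Y) :
  comp h (comp g f) = comp (comp h g) f.
Proof. by apply: homP => i; rewrite !homE mulmxA. Qed.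
Lemma compDl X Y Z (g h : hom Y Z) (f : hom X Y) :
  comp (g + h) f = comp g f + comp h f.
Proof. by apply: homP => i; rewrite !homE mulmxDl. Qed.
Lemma compDr X Y Z (h : hom Y Z) (f g : hom X Y) :
  comp h (f + g) = comp h f + comp h g.
Proof. by apply: homP => i; rewrite !homE mulmxDr. Qed.
Lemma compNl X Y Z (g : hom Y Z) (f : hom X Y) : comp (- g) f = - comp g f.
Proof. by apply: homP => i; rewrite !homE mulNmx. Qed.
Lemma compNr X Y Z (g : hom Y Z) (f : hom X Y) : comp g (- f) = - comp g f.
Proof. by apply: homP => i; rewrite !homE mulmxN. Qed.
Lemma compZl X Y Z c (g : hom Y Z) (f : hom X Y) : comp (c *: g) f = c *: comp g f.
Proof. by apply: homP => i; rewrite !homE scalemxAl. Qed.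
Lemma compZr X Y Z c (g : hom Y Z) (f : hom X Y) : comp g (c *: f) = c *: comp g f.
Proof. by apply: homP => i; rewrite !homE scalemxAr. Qed.
Lemma comp0l X Y Z (f : hom X Y) : comp (0 : hom Y Z) f = 0.
Proof. by apply: homP => i; rewrite !homE mul0mx. Qed.
Lemma comp0r X Y Z (g : hom Y Z) : comp g (0 : hom X Y) = 0.
Proof. by apply: homP => i; rewrite !homE mulmx0. Qed.
Lemma comp1l X Y (f : hom X Y) : comp (idh Y) f = f.
Proof. by apply: homP => i; rewrite !homE mul1mx. Qed.
Lemma comp1r X Y (f : hom X Y) : comp f (idh X) = f.
Proof. by apply: homP => i; rewrite !homE mulmx1. Qed.

HB.instance Definition _ X := GRing.Zmodule_isPzRing.Build (hom X X)
  (@compA X X X X) (@comp1l X X) (@comp1r X X)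
  (fun f g h => compDl f g h) (fun f g h => compDr f g h).

Lemma endME X (f g : hom X X) : f * g = comp f g. Proof. by []. Qed.
Lemma end1E X : 1 = idh X. Proof. by []. Qed.

Lemma comp_suml X Y Z (J : Type) (s : seq J) (P : pred J) (g : J -> hom Y Z) (f : hom X Y) :
  comp (\sum_(j <- s | P j) g j) f = \sum_(j <- s | P j) comp (g j) f.
Proof.
apply: (big_morph (fun h => comp h f)) => [g1 g2|]; [exact: compDl|exact: comp0l].
Qed.
Lemma comp_sumr X Y Z (J : Type) (s : seq J) (P : pred J) (g : hom Y Z) (f : J -> hom X Y) :
  comp g (\sum_(j <- s | P j) f j) = \sum_(j <- s | P j) comp g (f j).
Proof.
apply: (big_morph (fun h => comp g h)) => [f1 f2|]; [exact: compDr|exact: comp0r].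
Qed.

Lemma comp_cycle_nilp X Y (f : hom X Y) (g : hom Y X) :
  nilp (comp g f) -> nilp (comp f g).
Proof.
have sw n : (comp f g) ^+ n.+1 = comp f (comp ((comp g f) ^+ n) g).
  elim: n => [|n IH]; first by rewrite expr1 expr0 comp1l.
  by rewrite exprS IH endME [in RHS]exprS endME !compA.
by case=> n gfn; exists n.+1; rewrite sw gfn comp0l comp0r.
Qed.

(** ** Isomorphisms and direct sums *)

Definition iso X Y : Prop :=
  exists (f : hom X Y) (g : hom Y X), comp g f = idh X /\ comp f g = idh Y.

Lemma iso_refl X : iso X X.
Proof. by exists (idh X), (idh X); rewrite comp1l. Qed.
Lemma iso_sym X Y : iso X Y -> iso Y X.
Proof. by case=> f [g [gf fg]]; exists g, f. Qed.
Lemma iso_trans Y X Z : iso X Y -> iso Y Z -> iso X Z.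
Proof.
case=> f [g [gf fg]] [f' [g' [gf' fg']]]; exists (comp f' f), (comp g g'); split.
  by rewrite -compA [comp g' _]compA gf' comp1l.
by rewrite -compA [comp f _]compA fg comp1l.
Qed.

Definition dsum_act X Y a : 'M[R]_(rk X (tgt a) + rk Y (tgt a), rk X (src a) + rk Y (src a)) :=
  block_mx (act X a) 0 0 (act Y a).
Definition dsum X Y : rep Q R := @Rep Q R (fun i => (rk X i + rk Y i)%N) (dsum_act X Y).

Definition inl_fam X Y i : 'M[R]_(rk X i + rk Y i, rk X i) := col_mx 1%:M 0.
Lemma inl_subproof X Y a :
  inl_fam X Y (tgt a) *m act X a = act (dsum X Y) a *m inl_fam X Y (src a).
Proof.
by rewrite /inl_fam /= /dsum_act mul_col_mx mul_block_col mul1mx !mulmx1 !mulmx0 ?mul0mx !addr0.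
Qed.
Definition inl X Y : hom X (dsum X Y) := @mkhom X (dsum X Y) (@inl_fam X Y) (@inl_subproof X Y).
Definition inr_fam X Y i : 'M[R]_(rk X i + rk Y i, rk Y i) := col_mx 0 1%:M.
Lemma inr_subproof X Y a :
  inr_fam X Y (tgt a) *m act Y a = act (dsum X Y) a *m inr_fam X Y (src a).
Proof.
by rewrite /inr_fam /= /dsum_act mul_col_mx mul_block_col mul1mx !mulmx1 !mulmx0 ?mul0mx !add0r.
Qed.
Definition inr X Y : hom Y (dsum X Y) := @mkhom Y (dsum X Y) (@inr_fam X Y) (@inr_subproof X Y).
Definition prl_fam X Y i : 'M[R]_(rk X i, rk X i + rk Y i) := row_mx 1%:M 0.
Lemma prl_subproof X Y a :
  prl_fam X Y (tgt a) *m act (dsum X Y) a = act X a *m prl_fam X Y (src a).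
Proof.
by rewrite /prl_fam /= /dsum_act mul_mx_row mul_row_block !mul1mx !mul0mx mulmx1 !mulmx0 !addr0.
Qed.
Definition prl X Y : hom (dsum X Y) X := @mkhom (dsum X Y) X (@prl_fam X Y) (@prl_subproof X Y).
Definition prr_fam X Y i : 'M[R]_(rk Y i, rk X i + rk Y i) := row_mx 0 1%:M.
Lemma prr_subproof X Y a :
  prr_fam X Y (tgt a) *m act (dsum X Y) a = act Y a *m prr_fam X Y (src a).
Proof.
by rewrite /prr_fam /= /dsum_act mul_mx_row mul_row_block !mul1mx !mul0mx mulmx1 !mulmx0 !add0r.
Qed.
Definition prr X Y : hom (dsum X Y) Y := @mkhom (dsum X Y) Y (@prr_fam X Y) (@prr_subproof X Y).

Lemma prl_inl X Y : comp (prl X Y) (inl X Y) = idh X.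
Proof. by apply: homP => i; rewrite !homE /inl_fam /inr_fam /prl_fam /prr_fam mul_row_col mulmx1 mul0mx addr0. Qed.
Lemma prr_inr X Y : comp (prr X Y) (inr X Y) = idh Y.
Proof. by apply: homP => i; rewrite !homE /inl_fam /inr_fam /prl_fam /prr_fam mul_row_col mulmx1 mul0mx add0r. Qed.
Lemma prl_inr X Y : comp (prl X Y) (inr X Y) = 0.
Proof. by apply: homP => i; rewrite !homE /inl_fam /inr_fam /prl_fam /prr_fam mul_row_col mulmx0 mul0mx addr0. Qed.
Lemma prr_inl X Y : comp (prr X Y) (inl X Y) = 0.
Proof. by apply: homP => i; rewrite !homE /inl_fam /inr_fam /prl_fam /prr_fam mul_row_col mulmx0 mul0mx add0r. Qed.
Lemma dsum_id X Y :
  comp (inl X Y) (prl X Y) + comp (inr X Y) (prr X Y) = idh (dsum X Y).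
Proof.
apply: homP => i; rewrite !homE /inl_fam /inr_fam /prl_fam /prr_fam !mul_col_row !mulmx1 !mulmx0 ?mul0mx add_block_mx.
by rewrite !addr0 !add0r -scalar_mx_block.
Qed.

Lemma iso_dsum X Y X' Y' : iso X X' -> iso Y Y' -> iso (dsum X Y) (dsum X' Y').
Proof.
case=> f [g [gf fg]] [f' [g' [gf' fg']]].
pose bd A B A' B' (u : hom A A') (v : hom B B') : hom (dsum A B) (dsum A' B') :=
  comp (inl A' B') (comp u (prl A B)) + comp (inr A' B') (comp v (prr A B)).
have bdM A B A' B' A'' B'' (u : hom A A') (v : hom B B') (u' : hom A' A'') (v' : hom B' B'') :
    comp (bd _ _ _ _ u' v') (bd _ _ _ _ u v) = bd _ _ _ _ (comp u' u) (comp v' v).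
  rewrite /bd compDl !compDr -!compA; congr (_ + _).
    rewrite [comp (prl _ _) (comp (inl _ _) _)]compA prl_inl comp1l.
    by rewrite [comp (prl _ _) (comp (inr _ _) _)]compA prl_inr comp0l !comp0r addr0.
  rewrite [comp (prr _ _) (comp (inl _ _) _)]compA prr_inl comp0l !comp0r add0r.
  by rewrite [comp (prr _ _) (comp (inr _ _) _)]compA prr_inr comp1l.
exists (bd _ _ _ _ f f'), (bd _ _ _ _ g g'); rewrite !bdM gf gf' fg fg'.
by rewrite /bd !comp1l !dsum_id.
Qed.

Lemma dsum_of_splitting X Y Z (i : hom X Z) (p : hom Z X) (j : hom Y Z) (q : hom Z Y) :
  comp p i = idh X -> comp q j = idh Y -> comp i p + comp j q = idh Z ->
  iso Z (dsum X Y).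
Proof.
move=> pi qj ipjq.
have qi : comp q i = 0.
  have := congr1 (fun h => comp q (comp h i)) ipjq.
  rewrite compDl compDr -!compA pi comp1r comp1l [comp q (comp j _)]compA qj comp1l.
  by move=> h; apply: (addrI (comp q i)); rewrite addr0.
have pj : comp p j = 0.
  have := congr1 (fun h => comp p (comp h j)) ipjq.
  rewrite compDl compDr -!compA qj comp1r comp1l [comp p (comp i _)]compA pi comp1l.
  by move=> h; apply: (addrI (comp p j)); rewrite addr0.
exists (comp (inl X Y) p + comp (inr X Y) q), (comp i (prl X Y) + comp j (prr X Y)).
rewrite !compDl !compDr; split.
  rewrite -!compA [comp (prl _ _) (comp _ _)]compA prl_inl comp1l.
  rewrite [comp (prl _ _) (comp _ _)]compA prl_inr comp0l comp0r addr0.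
  rewrite [comp (prr _ _) (comp _ _)]compA prr_inl comp0l comp0r add0r.
  by rewrite [comp (prr _ _) (comp _ _)]compA prr_inr comp1l.
rewrite -!compA ![comp p (comp _ _)]compA ![comp q (comp _ _)]compA pi pj qi qj.
by rewrite !comp0l !comp0r !comp1l addr0 add0r dsum_id.
Qed.

End Hom.

HB.instance Definition _ (Q : quiver) (R : finComNzRingType) (X Y : rep Q R) :=
  [Finite of hom X Y by <:].
HB.instance Definition _ (Q : quiver) (R : finComNzRingType) (X : rep Q R) :=
  GRing.PzRing.on (hom X X).

(** * Splitting of idempotents over a local coefficient ring *)

(** All that is used of truncated polynomials in the Krull-Schmidt theory. *)
Definition coefficient_ring (k : fieldType) (O : comUnitRingType)
    (res : {rmorphism O -> k}) (lft : {rmorphism k -> O}) : Prop :=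
  (forall c, res (lft c) = c) /\ (forall x, (x \is a GRing.unit) = (res x != 0)).

Section Splitting.
Context (k : fieldType) (O : comUnitRingType).
Context (res : {rmorphism O -> k}) (lft : {rmorphism k -> O}).
Hypothesis cO : coefficient_ring res lft.

Lemma unitmx_res n (A : 'M[O]_n) : (A \in unitmx) = (map_mx res A \in unitmx).
Proof. by rewrite !unitmxE cO.2 det_map_mx unitfE. Qed.

Lemma map_mx_lft m n (A : 'M[k]_(m, n)) : map_mx res (map_mx lft A) = A.
Proof. by apply/matrixP => i j; rewrite !mxE cO.1. Qed.

(** 1 - D is then invertible, and is annihilated by D. *)
Lemma idempotent_res0 n (D : 'M[O]_n) : D *m D = D -> map_mx res D = 0 -> D = 0.
Proof.
move=> DD D0; have U : 1%:M - D \in unitmx.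
  by rewrite unitmx_res map_mxB map_mx1 D0 subr0 unitmx1.
by rewrite -[D]mul1mx -(mulVmx U) -mulmxA mulmxBl mul1mx DD subrr mulmx0.
Qed.

Lemma idempotent_field_split n (A : 'M[k]_n) : A *m A = A ->
  row_base A *m col_base A = 1%:M.
Proof.
move=> AA; apply: (row_free_inj (row_base_free A)); rewrite mul1mx.
apply: (row_full_inj (col_base_full A)); rewrite -mulmxA mulmx_base mulmxA mulmx_base.
exact: AA.
Qed.

(** Reduce to the residue field, lift a splitting arbitrarily and correct it by
    the invertible Gram matrix of the lift. *)
Lemma idempotent_mx_split n (A : 'M[O]_n) : A *m A = A ->
  exists r (B : 'M[O]_(n, r)) (C : 'M[O]_(r, n)), C *m B = 1%:M /\ B *m C = A.
Proof.
move=> AA; pose a := map_mx res A; have aa : a *m a = a by rewrite -map_mxM AA.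
have RC := idempotent_field_split aa.
have aB : a *m col_base a = col_base a.
  transitivity ((col_base a *m row_base a) *m col_base a); first by rewrite mulmx_base.
  by rewrite -mulmxA RC mulmx1.
have Ra : row_base a *m a = row_base a.
  transitivity (row_base a *m (col_base a *m row_base a)); first by rewrite mulmx_base.
  by rewrite mulmxA RC mul1mx.
pose B0 := A *m map_mx lft (col_base a); pose C0 := map_mx lft (row_base a).
have redB : map_mx res B0 = col_base a.
  by rewrite map_mxM map_mx_lft -/a aB.
have redC : map_mx res C0 = row_base a by rewrite map_mx_lft.
pose G := C0 *m B0; have GU : G \in unitmx.
  by rewrite unitmx_res map_mxM redB redC RC unitmx1.
exists (\rank a), B0, (invmx G *m C0 *m A).
have AB : A *m B0 = B0 by rewrite /B0 mulmxA AA.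
have CB : invmx G *m C0 *m A *m B0 = 1%:M.
  by rewrite -mulmxA AB -mulmxA -/G mulVmx.
split=> //; set C := invmx G *m C0 *m A in CB *.
have CA : C *m A = C by rewrite /C -!mulmxA AA.
have ABC : A *m (B0 *m C) = B0 *m C by rewrite mulmxA AB.
have BCA : (B0 *m C) *m A = B0 *m C by rewrite -mulmxA CA.
have BCBC : (B0 *m C) *m (B0 *m C) = B0 *m C by rewrite mulmxA -[B0 *m C *m B0]mulmxA CB mulmx1.
apply/esym/eqP; rewrite -subr_eq0; apply/eqP/idempotent_res0.
  by rewrite mulmxBr !mulmxBl AA ABC BCA BCBC subrr subr0.
rewrite map_mxB (map_mxM _ B0 C) redB (map_mxM _ _ A) (map_mxM _ _ C0) redC -/a.
have -> : map_mx res (invmx G) = 1%:M.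
  have := congr1 (map_mx res) (mulVmx GU).
  by rewrite map_mxM map_mx1 [map_mx res G]map_mxM redB redC RC mulmx1.
by rewrite mul1mx Ra mulmx_base subrr.
Qed.

(** Because projective O-modules are free, an idempotent endomorphism has a locally
    free image; this is where the local coefficient ring enters. *)
Lemma idempotent_split (Q : quiver) (X : rep Q O) (e : hom X X) : e * e = e ->
  exists Y (i : hom Y X) (p : hom X Y), comp p i = idh Y /\ comp i p = e.
Proof.
move=> ee; pose T i := {r : nat & ('M[O]_(rk X i, r) * 'M[O]_(r, rk X i))%type}.
have ex i : exists s : T i, (tagged s).2 *m (tagged s).1 = 1%:M /\
    (tagged s).1 *m (tagged s).2 = e i.
  have [r [B [C [CB BC]]]] := @idempotent_mx_split _ (e i) (etrans (esym (compE e e i)) (congr1 (fun h : hom X X => h i) ee)).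
  by exists (Tagged (fun r => ('M[O]_(rk X i, r) * 'M[O]_(r, rk X i))%type) (B, C)).
pose s i := sval (cid (ex i)); have sP i := svalP (cid (ex i)).
pose B i := (tagged (s i)).1; pose C i := (tagged (s i)).2.
have CB i : C i *m B i = 1%:M by have [] := sP i.
have BC i : B i *m C i = e i by have [] := sP i.
pose Y : rep Q O := @Rep Q O (fun i => tag (s i)) (fun a => C (tgt a) *m act X a *m B (src a)).
have Bhom a : B (tgt a) *m act Y a = act X a *m B (src a).
  by rewrite /= !mulmxA BC hom_act -BC -!mulmxA CB mulmx1.
have Chom a : C (tgt a) *m act X a = act Y a *m C (src a).
  by rewrite /= -!mulmxA BC -hom_act -BC !mulmxA CB mul1mx.
exists Y, (@mkhom _ _ Y X B Bhom), (@mkhom _ _ X Y C Chom).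
by split; apply: homP => i; rewrite !homE ?CB ?BC.
Qed.

Lemma idempotent_dsum (Q : quiver) (X : rep Q O) (e : hom X X) : e * e = e ->
  e != 0 -> e != 1 ->
  exists Y Z, [/\ iso X (dsum Y Z), idh Y <> 0 & idh Z <> 0].
Proof.
move=> ee e0 e1; have [Y [i [p [pi ip]]]] := idempotent_split ee.
have e'e' : (1 - e) * (1 - e) = 1 - e.
  by rewrite mulrBr !mulrBl !mulr1 !mul1r ee subrr subr0.
have [Z [j [q [qj jq]]]] := idempotent_split e'e'.
exists Y, Z; split.
- by apply: (dsum_of_splitting pi qj); rewrite ip jq addrC subrK.
- move=> Y0; move/eqP: e0; apply.
  by rewrite -ip -[p]comp1l Y0 comp0l comp0r.
- move=> Z0; move/eqP: e1; apply; apply/esym/eqP; rewrite -subr_eq0; apply/eqP.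
  by rewrite -jq -[q]comp1l Z0 comp0l comp0r.
Qed.

End Splitting.

Definition rank_total (Q : quiver) (R : Type) (X : rep Q R) : nat := (\sum_i rk X i)%N.

Section RankFacts.
Context (Q : quiver) (R : comUnitRingType).
Implicit Types X Y : rep Q R.

Lemma rank_total_dsum X Y : rank_total (dsum X Y) = (rank_total X + rank_total Y)%N.
Proof. by rewrite /rank_total -big_split. Qed.

Lemma rank_total0 X : (rank_total X == 0)%N = `[< idh X = 0 >].
Proof.
apply/idP/asboolP => [/eqP X0|id0].
  apply: homP => i; apply/matrixP => -[a la]; exfalso; move: la.
  suff -> : rk X i = 0%N by [].
  by apply/eqP; rewrite -leqn0 -X0 /rank_total (bigD1 i) //= leq_addr.
rewrite /rank_total sum_nat_eq0; apply/forallP => i; apply/implyP => _.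
have := congr1 (fun h : hom X X => h i) id0; rewrite !homE.
case: (rk X i) => // n /matrixP/(_ 0 0); rewrite !mxE eqxx => /eqP.
by rewrite (negbTE (oner_neq0 _)).
Qed.

Lemma rank_total_gt0 X : idh X <> 0 <-> (0 < rank_total X)%N.
Proof.
by rewrite lt0n rank_total0; split=> ?; apply/asboolPn.
Qed.

Lemma iso_rk X Y : iso X Y -> rk X = rk Y.
Proof.
case=> f [g [gf fg]]; apply/funext => i.
have := congr1 (fun h : hom X X => h i) gf; have := congr1 (fun h : hom Y Y => h i) fg.
rewrite !homE => {}fg {}gf.
by apply/eqP; rewrite eqn_leq (mulmx1_min gf) (mulmx1_min fg).
Qed.

End RankFacts.

(** * Krull-Schmidt theory, by counting *)

Definition indec (Q : quiver) (R : comNzRingType) (X : rep Q R) : Prop :=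
  idh X <> 0 /\ forall e : hom X X, e * e = e -> e = 0 \/ e = 1.

Definition countp (T : finType) (P : T -> Prop) : nat := #|[set x | `[< P x >]]|.

Lemma countp_bij (T T' : finType) (P : T -> Prop) (P' : T' -> Prop) (f : T -> T') (g : T' -> T) :
  (forall x, P x -> P' (f x)) -> (forall y, P' y -> P (g y)) ->
  (forall x, P x -> g (f x) = x) -> (forall y, P' y -> f (g y) = y) ->
  countp P = countp P'.
Proof.
move=> fP gP fK gK; rewrite /countp -(@card_in_imset _ _ f); last first.
  move=> x y; rewrite !inE => /asboolP Px /asboolP Py /(congr1 g).
  by rewrite !fK.
apply: eq_card => y; rewrite [RHS]inE; apply/imsetP/asboolP => [[x]|Py].
  by rewrite inE => /asboolP Px ->; exact: fP.
by exists (g y); rewrite ?gK // inE; apply/asboolP/gP.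
Qed.

Lemma countpT (T : finType) : countp (fun _ : T => True) = #|T|.
Proof. by rewrite /countp -cardsT; apply: eq_card => x; rewrite !inE; apply/asboolP. Qed.

Lemma countp_prod (T T' : finType) (P : T -> Prop) (P' : T' -> Prop) :
  countp (fun z : T * T' => P z.1 /\ P' z.2) = (countp P * countp P')%N.
Proof.
rewrite /countp -cardsX; apply: eq_card => -[x y]; rewrite !inE /=.
by rewrite asbool_and.
Qed.

Lemma countpC (T : finType) (P : T -> Prop) :
  (countp P + countp (fun x => ~ P x) = #|T|)%N.
Proof.
rewrite /countp -(cardsC [set x | `[< P x >]]); congr addn.
by apply: eq_card => x; rewrite !inE asbool_neg.
Qed.

Lemma countp_gt0 (T : finType) (P : T -> Prop) x : P x -> (0 < countp P)%N.
Proof. by move=> Px; apply/card_gt0P; exists x; rewrite inE; apply/asboolP. Qed.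

Lemma countp_bijT (T T' : finType) (f : T -> T') (g : T' -> T) :
  cancel f g -> cancel g f -> #|T| = #|T'|.
Proof. by move=> fK gK; apply: bij_eq_card; exists g. Qed.

Definition split_mono (Q : quiver) (R : comNzRingType) (I X : rep Q R) (u : hom I X) : Prop :=
  exists p, comp p u = idh I.

(** Morphisms that no morphism back makes invertible; for I indecomposable they
    form the radical of hom I X. *)
Definition radical (Q : quiver) (R : comNzRingType) (I X : rep Q R) (u : hom I X) : Prop :=
  forall g : hom X I, nilp (comp g u).

Section Cardinals.
Context (Q : quiver) (R : finComNzRingType).
Implicit Types X Y Z I M : rep Q R.

Lemma dsum_in_eta Z X Y (f : hom Z (dsum X Y)) :
  comp (inl X Y) (comp (prl X Y) f) + comp (inr X Y) (comp (prr X Y) f) = f.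
Proof. by rewrite !compA -compDl dsum_id comp1l. Qed.

Lemma dsum_out_eta Z X Y (f : hom (dsum X Y) Z) :
  comp (comp f (inl X Y)) (prl X Y) + comp (comp f (inr X Y)) (prr X Y) = f.
Proof. by rewrite -!compA -compDr dsum_id comp1r. Qed.

Lemma prl_pair Z X Y (u : hom Z X) (v : hom Z Y) :
  comp (prl X Y) (comp (inl X Y) u + comp (inr X Y) v) = u.
Proof. by rewrite compDr !compA prl_inl prl_inr comp1l comp0l addr0. Qed.

Lemma prr_pair Z X Y (u : hom Z X) (v : hom Z Y) :
  comp (prr X Y) (comp (inl X Y) u + comp (inr X Y) v) = v.
Proof. by rewrite compDr !compA prr_inl prr_inr comp1l comp0l add0r. Qed.

Lemma copair_inl Z X Y (u : hom X Z) (v : hom Y Z) :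
  comp (comp u (prl X Y) + comp v (prr X Y)) (inl X Y) = u.
Proof. by rewrite compDl -!compA prl_inl prr_inl comp1r comp0r addr0. Qed.

Lemma copair_inr Z X Y (u : hom X Z) (v : hom Y Z) :
  comp (comp u (prl X Y) + comp v (prr X Y)) (inr X Y) = v.
Proof. by rewrite compDl -!compA prl_inr prr_inr comp1r comp0r add0r. Qed.

Lemma card_hom_dsumr Z X Y : #|hom Z (dsum X Y)| = (#|hom Z X| * #|hom Z Y|)%N.
Proof.
rewrite -card_prod.
apply: (countp_bijT (f := fun f => (comp (prl X Y) f, comp (prr X Y) f))
  (g := fun uv => comp (inl X Y) uv.1 + comp (inr X Y) uv.2)).
  exact: dsum_in_eta.
by case=> u v /=; rewrite prl_pair prr_pair.
Qed.

Lemma card_hom_dsuml Z X Y : #|hom (dsum X Y) Z| = (#|hom X Z| * #|hom Y Z|)%N.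
Proof.
rewrite -card_prod.
apply: (countp_bijT (f := fun f => (comp f (inl X Y), comp f (inr X Y)))
  (g := fun uv => comp uv.1 (prl X Y) + comp uv.2 (prr X Y))).
  exact: dsum_out_eta.
by case=> u v /=; rewrite copair_inl copair_inr.
Qed.

Lemma card_hom_isor Z X Y : iso X Y -> #|hom Z X| = #|hom Z Y|.
Proof.
case=> f [g [gf fg]].
apply: (countp_bijT (f := fun h => comp f h) (g := fun h => comp g h)) => h.
  by rewrite compA gf comp1l.
by rewrite compA fg comp1l.
Qed.

Lemma card_hom_isol Z X Y : iso X Y -> #|hom X Z| = #|hom Y Z|.
Proof.
case=> f [g [gf fg]].
apply: (countp_bijT (f := fun h => comp h g) (g := fun h => comp h f)) => h.
  by rewrite -compA gf comp1r.
by rewrite -compA fg comp1r.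
Qed.

Lemma card_end_iso X Y : iso X Y -> #|hom X X| = #|hom Y Y|.
Proof. by move=> h; rewrite (card_hom_isol _ h) (card_hom_isor _ h). Qed.

Definition nb_aut X : nat := countp (@invertible (hom X X)).

Lemma nb_aut_iso X Y : iso X Y -> nb_aut X = nb_aut Y.
Proof.
case=> f [g [gf fg]].
have conj A B (a : hom A B) (b : hom B A) (h : hom A A) : comp b a = idh A -> comp a b = idh B ->
    invertible h -> invertible (comp a (comp h b) : hom B B).
  move=> ba ab [h' [h'h hh']]; exists (comp a (comp h' b)); rewrite !endME !end1E in h'h hh' *.
  rewrite -!compA ![comp b (comp a _)]compA ba !comp1l.
  by rewrite [comp h' (comp h b)]compA [comp h (comp h' b)]compA h'h hh' !comp1l ab.
apply: (countp_bij (f := fun h => comp f (comp h g)) (g := fun h => comp g (comp h f))).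
- by move=> h; apply: conj.
- by move=> h; apply: conj.
- by move=> h _; rewrite !compA gf comp1l -compA gf comp1r.
- by move=> h _; rewrite !compA fg comp1l -compA fg comp1r.
Qed.

Lemma nb_aut_gt0 X : (0 < nb_aut X)%N.
Proof. by apply: (countp_gt0 (x := 1)); exists 1; rewrite mulr1. Qed.

(** The weight of an isomorphism class in the stacky count of pairs of a
    representation and an endomorphism. *)
Definition weight X : rat := #|hom X X|%:R / (nb_aut X)%:R.

Lemma weight_iso X Y : iso X Y -> weight X = weight Y.
Proof. by move=> h; rewrite /weight (card_end_iso h) (nb_aut_iso h). Qed.

Lemma radical_comp I X Y (u : hom I X) (f : hom X Y) : radical u -> radical (comp f u).
Proof. by move=> ru g; rewrite compA; apply: ru. Qed.

Lemma radical_iso I X Y : iso X Y ->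
  countp (@radical Q R I X) = countp (@radical Q R I Y).
Proof.
case=> f [g [gf fg]].
apply: (countp_bij (f := fun h => comp f h) (g := fun h => comp g h)) => h.
- exact: radical_comp.
- exact: radical_comp.
- by rewrite compA gf comp1l.
- by rewrite compA fg comp1l.
Qed.

Lemma radical_gt0 I X : (0 < countp (@radical Q R I X))%N.
Proof. by apply: (countp_gt0 (x := 0)) => g; rewrite comp0r; exact: nilp0. Qed.

(** Block matrices with columns (1, 0) and (b, g), acting on I + M. *)
Definition upper_tri I M M' (b : hom M I) (g : hom M M') : hom (dsum I M) (dsum I M') :=
  comp (inl I M') (prl I M + comp b (prr I M)) + comp (inr I M') (comp g (prr I M)).

Lemma upper_triM I M M' M'' (b : hom M I) (g : hom M M') (b' : hom M' I) (g' : hom M' M'') :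
  comp (upper_tri b' g') (upper_tri b g) = upper_tri (b + comp b' g) (comp g' g).
Proof.
rewrite {1}/upper_tri compDl -![comp (comp _ _) (upper_tri b g)]compA !compDl.
rewrite -![comp (comp _ _) (upper_tri b g)]compA /upper_tri prl_pair prr_pair.
by rewrite !compDl !compA addrA.
Qed.

Lemma upper_tri1 I M : upper_tri 0 (idh M) = idh (dsum I M).
Proof. by rewrite /upper_tri comp0l addr0 comp1l dsum_id. Qed.

Lemma upper_tri_inl I M M' (b : hom M I) (g : hom M M') :
  comp (upper_tri b g) (inl I M) = inl I M'.
Proof.
rewrite /upper_tri compDl -!compA compDl -!compA prl_inl prr_inl !comp0r.
by rewrite !addr0 comp1r.
Qed.

Lemma upper_tri_inr I M M' (b : hom M I) (g : hom M M') :
  comp (upper_tri b g) (inr I M) = comp (inl I M') b + comp (inr I M') g.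
Proof.
rewrite /upper_tri compDl -!compA compDl -!compA prl_inr prr_inr.
by rewrite add0r !comp1r.
Qed.

Lemma upper_tri_invertible I M (b : hom M I) (g : hom M M) :
  invertible g -> invertible (upper_tri b g).
Proof.
case=> g' [g'g gg']; exists (upper_tri (- comp b g') g'); rewrite !endME !upper_triM.
rewrite !endME !end1E in g'g gg' *; rewrite compNl -compA g'g gg' comp1r addrN addNr.
by rewrite upper_tri1.
Qed.

Lemma upper_tri_of_inl I M M' (f : hom (dsum I M) (dsum I M')) :
  comp f (inl I M) = inl I M' ->
  upper_tri (comp (prl I M') (comp f (inr I M))) (comp (prr I M') (comp f (inr I M))) = f.
Proof.
move=> fi; rewrite /upper_tri -[RHS]dsum_out_eta fi.
rewrite compDr -addrA; congr (_ + _).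
by rewrite -[in RHS](dsum_in_eta (comp f (inr I M))) compDl !compA.
Qed.

Lemma upper_tri_quotient I M M' (f : hom (dsum I M) (dsum I M')) (f' : hom (dsum I M') (dsum I M)) :
  comp f' f = idh _ -> comp f (inl I M) = inl I M' ->
  comp (comp (prr I M) (comp f' (inr I M'))) (comp (prr I M') (comp f (inr I M))) = idh M.
Proof.
move=> f'f fi; have f'i : comp f' (inl I M') = inl I M by rewrite -fi compA f'f comp1l.
have := f'f; rewrite -{1}(upper_tri_of_inl fi) -{1}(upper_tri_of_inl f'i) upper_triM.
move/(congr1 (fun h => comp (prr I M) (comp h (inr I M)))).
by rewrite comp1l prr_inr upper_tri_inr prr_pair.
Qed.

Section Local.
Context (I : rep Q R).
Hypothesis locI : local_ring (hom I I).

Lemma radicalPn X (u : hom I X) : ~ radical u <-> split_mono u.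
Proof.
split=> [nr|[p pu] ru]; last by apply: (local_not_nilp1 locI); rewrite end1E -pu; apply: ru.
apply: contrapT => ns; apply: nr => g; case: (local_nilp_or locI (comp g u)) => // -[h [hgu _]].
by case: ns; exists (comp h g); rewrite -compA.
Qed.

Lemma countp_split_mono X :
  (countp (@radical Q R I X) + countp (@split_mono Q R I X) = #|hom I X|)%N.
Proof.
rewrite -(countpC (@radical Q R I X)); congr addn; apply: eq_card => u; rewrite !inE.
by apply: asbool_equiv_eq; rewrite radicalPn.
Qed.

Lemma countp_radical_dsum X Y : countp (@radical Q R I (dsum X Y)) =
  (countp (@radical Q R I X) * countp (@radical Q R I Y))%N.
Proof.
rewrite -countp_prod.
apply: (countp_bij (f := fun f => (comp (prl X Y) f, comp (prr X Y) f))
  (g := fun uv => comp (inl X Y) uv.1 + comp (inr X Y) uv.2)).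
- by move=> u ru; split; apply: radical_comp.
- case=> u v /= [ru rv] g; rewrite compDr; apply: (local_nilpD locI).
    exact: (radical_comp _ ru).
  exact: (radical_comp _ rv).
- by move=> u _; exact: dsum_in_eta.
- by case=> u v _ /=; rewrite prl_pair prr_pair.
Qed.

(** If the component of u on I is invertible, it serves as a pivot for elementary
    matrices. Otherwise it is nilpotent, so for a left inverse p of u the part of p u
    that passes through M is invertible, and adding a suitable image of the
    component of u in M to that on I makes the latter equal to 1. *)
Lemma split_mono_transitive M (u : hom I (dsum I M)) : split_mono u ->
  exists f f' : hom (dsum I M) (dsum I M), [/\ f' * f = 1, f * f' = 1 & comp f (inl I M) = u].
Proof.
have unit_case (v : hom I (dsum I M)) : invertible (comp (prl I M) v) ->
    exists f f' : hom (dsum I M) (dsum I M), [/\ f' * f = 1, f * f' = 1 & comp f (inl I M) = v].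
  case=> x'; set x := comp (prl I M) v; set y := comp (prr I M) v; rewrite !endME !end1E => -[x'x xx'].
  pose L (x : hom I I) (y : hom I M) : hom (dsum I M) (dsum I M) :=
    comp (comp (inl I M) x + comp (inr I M) y) (prl I M) + comp (inr I M) (prr I M).
  have LM a b a' b' : L a b * L a' b' = L (comp a a') (comp b a' + b').
    rewrite endME {1}/L compDl -![comp (comp _ _) (L a' b')]compA.
    have -> : comp (prl I M) (L a' b') = comp a' (prl I M).
      by rewrite compDr !compA compDr !compA prl_inl prl_inr !comp0l comp1l !addr0.
    have -> : comp (prr I M) (L a' b') = comp b' (prl I M) + prr I M.
      by rewrite compDr !compA compDr !compA prr_inl prr_inr !comp0l !comp1l !add0r.
    by rewrite /L compDr !compA addrA !compDl !compDr !compDl !compA addrA.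
  have L1 : L 1 0 = 1 by rewrite /L comp0r comp1r addr0 dsum_id.
  exists (L x y), (L x' (- comp y x')); rewrite !LM x'x xx' compNl -compA x'x comp1r addNr addrN.
  split; rewrite ?L1 //; rewrite /L compDl -!compA prl_inl prr_inl !comp0r addr0 comp1r.
  exact: dsum_in_eta.
case=> p pu; have [nx|] := local_nilp_or locI (comp (prl I M) u); last exact: unit_case.
set x := comp (prl I M) u in nx; set y := comp (prr I M) u.
have pxy : comp (comp p (inl I M)) x + comp (comp p (inr I M)) y = idh I.
  by rewrite -!compA -compDr dsum_in_eta pu.
have [w [wpy _]] : invertible (comp (comp p (inr I M)) y).
  have -> : comp (comp p (inr I M)) y = 1 - comp (comp p (inl I M)) x.
    by rewrite end1E -pxy addrC addKr.
  by apply/nilp_sub1_inv; apply: (local_nilpMl locI (comp p (inl I M))).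
pose q := comp (idh I - x) (comp w (comp p (inr I M))).
pose T := upper_tri q (idh M).
have Tu : comp (prl I M) (comp T u) = 1.
  rewrite -(dsum_in_eta u) -/x -/y compDr.
  have -> : comp T (comp (inl I M) x) = comp (inl I M) x by rewrite compA upper_tri_inl.
  have -> : comp T (comp (inr I M) y) = comp (inl I M) (comp q y) + comp (inr I M) y.
    by rewrite compA upper_tri_inr comp1r compDl !compA.
  rewrite addrA -compDr prl_pair /q -!compA; rewrite endME end1E -!compA in wpy.
  by rewrite wpy comp1r addrC subrK.
have [T' [T'T TT']] : invertible T by apply: upper_tri_invertible; exists 1; rewrite mulr1.
have [|f [f' [f'f ff' fi]]] := unit_case (comp T u); first by rewrite Tu; exists 1; rewrite mulr1.
exists (T' * f), (f' * T); split.
- by rewrite mulrA -[f' * T * T']mulrA TT' mulr1.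
- by rewrite mulrA -[T' * f * f']mulrA ff' mulr1.
- by rewrite endME -compA fi compA -endME T'T end1E comp1l.
Qed.

(** By transitivity the isomorphism may be assumed to commute with the inclusions
    of I; it is then upper triangular, with an isomorphism M -> M' on the diagonal. *)
Lemma dsum_cancel M M' : iso (dsum I M) (dsum I M') -> iso M M'.
Proof.
case=> f [f' [f'f ff']].
have [|s [s' [s's ss' si]]] := @split_mono_transitive M' (comp f (inl I M)).
  by exists (comp (prl I M) f'); rewrite -compA [comp f' _]compA f'f comp1l prl_inl.
rewrite !endME !end1E in s's ss'.
pose g := comp s' f; pose g' := comp f' s.
have g'g : comp g' g = idh _ by rewrite /g /g' -compA [comp s _]compA ss' comp1l.
have gg' : comp g g' = idh _ by rewrite /g /g' -compA [comp f _]compA ff' comp1l.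
have gi : comp g (inl I M) = inl I M' by rewrite /g -compA -si compA s's comp1l.
have g'i : comp g' (inl I M') = inl I M by rewrite -gi compA g'g comp1l.
exists (comp (prr I M') (comp g (inr I M))), (comp (prr I M) (comp g' (inr I M'))).
by split; apply: upper_tri_quotient.
Qed.

(** An automorphism is determined by the image of I, any split monomorphism, and an
    automorphism that fixes I, which is upper triangular. *)
Lemma nb_aut_dsum M : nb_aut (dsum I M) =
  (countp (@split_mono Q R I (dsum I M)) * (#|hom M I| * nb_aut M))%N.
Proof.
have ex (u : hom I (dsum I M)) : exists ff : hom (dsum I M) (dsum I M) * hom (dsum I M) (dsum I M),
    split_mono u -> [/\ ff.2 * ff.1 = 1, ff.1 * ff.2 = 1 & comp ff.1 (inl I M) = u].
  have [/split_mono_transitive[f [f' h]]|nu] := EM (split_mono u); last by exists (1, 1).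
  by exists (f, f').
have [s sP] := choice ex.
rewrite -[#|hom M I|]countpT -!countp_prod /nb_aut.
pose tri (f : hom (dsum I M) (dsum I M)) := comp (s (comp f (inl I M))).2 f.
have split_inl (f : hom (dsum I M) (dsum I M)) : invertible f -> split_mono (comp f (inl I M)).
  by case=> f' [f'f _]; exists (comp (prl I M) f'); rewrite -compA [comp f' _]compA -endME f'f
    end1E comp1l prl_inl.
have triP f : invertible f -> invertible (tri f) /\ comp (tri f) (inl I M) = inl I M.
  move=> inv_f; have [s's ss' si] := sP _ (split_inl _ inv_f); case: inv_f => f' [f'f ff']; split.
    exists (f' * (s (comp f (inl I M))).1); rewrite /tri -endME.
    by split; rewrite mulrA; [rewrite -[f' * _ * _]mulrA ss'|rewrite -[_ * f * f']mulrA ff']; rewrite mulr1.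
  by rewrite /tri -compA -{2}si compA -endME s's end1E comp1l.
apply: (countp_bij (f := fun f => (comp f (inl I M),
     (comp (prl I M) (comp (tri f) (inr I M)), comp (prr I M) (comp (tri f) (inr I M)))))
   (g := fun z => comp (s z.1).1 (upper_tri z.2.1 z.2.2))).
- move=> f inv_f; split; first exact: split_inl.
  split=> //; have [[t [tt' t't]] ti] := triP f inv_f; rewrite !endME !end1E in tt' t't.
  have ti' : comp t (inl I M) = inl I M by rewrite -{1}ti compA tt' comp1l.
  by exists (comp (prr I M) (comp t (inr I M))); split; apply: upper_tri_quotient.
- case=> u [b g] /= [su [_ inv_g]]; have [s's ss' _] := sP u su.
  have [t [tt' t't]] := upper_tri_invertible b inv_g.
  exists (t * (s u).2); rewrite -endME; split.
    by rewrite mulrA -[t * _ * _]mulrA s's mulr1.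
  by rewrite mulrA -[(s u).1 * _ * t]mulrA t't mulr1.
- move=> f inv_f /=; have [_ ti] := triP f inv_f; rewrite upper_tri_of_inl // /tri.
  by have [_ ss' _] := sP _ (split_inl _ inv_f); rewrite endME in ss'; rewrite compA ss' comp1l.
- case=> u [b g] /= [su [_ inv_g]]; have [s's ss' si] := sP u su.
  have fi : comp (comp (s u).1 (upper_tri b g)) (inl I M) = u.
    by rewrite -compA upper_tri_inl si.
  have -> : tri (comp (s u).1 (upper_tri b g)) = upper_tri b g.
    by rewrite /tri fi compA; rewrite endME in s's; rewrite s's comp1l.
  by rewrite fi upper_tri_inr prl_pair prr_pair.
Qed.

Lemma weight_dsum M :
  weight (dsum I M) * (1 - (countp (@radical Q R I (dsum I M)))%:R / #|hom I (dsum I M)|%:R) = weight M.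
Proof.
have h0 X Y : #|hom X Y|%:R != 0 :> rat.
  by rewrite pnatr_eq0 -lt0n; apply/card_gt0P; exists 0.
have s0 : (countp (@split_mono Q R I (dsum I M)))%:R != 0 :> rat.
  by rewrite pnatr_eq0 -lt0n; apply: (countp_gt0 (x := inl I M)); exists (prl I M); exact: prl_inl.
have a0 : (nb_aut M)%:R != 0 :> rat by rewrite pnatr_eq0 -lt0n nb_aut_gt0.
rewrite /weight nb_aut_dsum card_hom_dsuml [#|hom M (dsum I M)|]card_hom_dsumr !natrM.
have := congr1 (fun n : nat => n%:R : rat) (countp_split_mono (dsum I M)); rewrite natrD /= => e.
rewrite -e; have := h0 I (dsum I M); rewrite -e => e0.
by have hMI := h0 M I; field; rewrite s0 a0 e0 hMI.
Qed.

End Local.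
End Cardinals.

Lemma indec_iso (Q : quiver) (R : comNzRingType) (X Y : rep Q R) : iso X Y -> indec X -> indec Y.
Proof.
case=> f [g [gf fg]] [X0 idem]; split=> [Y0|e ee].
  by apply: X0; rewrite -gf -[f]comp1l Y0 comp0l comp0r.
have eK : comp f (comp (comp g (comp e f)) g) = e.
  by rewrite !compA fg comp1l -compA fg comp1r.
have [|e0|e1] := idem (comp g (comp e f)).
- by rewrite endME -!compA [comp f (comp g _)]compA fg comp1l [comp e (comp e f)]compA -[in RHS]ee.
- by left; rewrite -eK e0 comp0l comp0r.
- by right; rewrite -eK e1 end1E comp1l fg.
Qed.

Section Indecomposables.
Context (Q : quiver) (k : finFieldType) (O : finComUnitRingType).
Context (res : {rmorphism O -> k}) (lft : {rmorphism k -> O}).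
Hypothesis cO : coefficient_ring res lft.
Implicit Types I J X Y M : rep Q O.

Lemma indec_local I : indec I -> local_ring (hom I I).
Proof. by case=> I0 idem; apply: finite_local_ring. Qed.

Lemma end_pchar I p : p \in [pchar k] -> p%:R = 0 :> hom I I.
Proof.
move=> pk; have pO : p%:R = 0 :> O.
  by rewrite -(rmorph_nat lft) (pcharf0 pk) rmorph0.
by rewrite -scaler_nat pO scale0r.
Qed.

Lemma indec_residue I : indec I ->
  exists (F : finFieldType) (f : {rmorphism hom I I -> F}) (h : {rmorphism F -> hom I I}),
    (forall u, f (h u) = u) /\ (forall x, f x = 0 <-> nilp x).
Proof.
move=> indI; have loc := indec_local indI.
have [p p_pr pk] := finPcharP k.
have one_neq0 : (1 : hom I I) != 0 by apply/eqP; exact: loc.1.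
pose nzm := GRing.PzSemiRing_isNonZero.Build (hom I I) one_neq0.
pose E : finNzRingType := HB.pack (hom I I) nzm.
exact: (local_ring_residue_lift (E := E) p_pr (end_pchar I pk) loc).
Qed.

Lemma radical_nilp I (u : hom I I) : local_ring (hom I I) -> radical u <-> nilp u.
Proof.
move=> loc; split=> [/(_ (idh I))|nu g]; first by rewrite comp1l.
exact: (local_nilpMl loc).
Qed.

Lemma card_end_residue I (F : finFieldType) (f : {rmorphism hom I I -> F})
    (h : {rmorphism F -> hom I I}) : indec I ->
  (forall u, f (h u) = u) -> (forall x, f x = 0 <-> nilp x) ->
  #|hom I I| = (#|F| * countp (@radical Q O I I))%N.
Proof.
move=> /indec_local loc hK fker.
rewrite -(countpT (hom I I)) -(countpT F) -countp_prod.
apply: (countp_bij (f := fun x => (f x, x - h (f x))) (g := fun z => h z.1 + z.2)).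
- move=> x _; split=> //=; apply/(radical_nilp _ loc)/fker.
  by rewrite rmorphB hK subrr.
- by [].
- by move=> x _; rewrite addrC subrK.
- case=> u x /= [_ /(radical_nilp _ loc)/fker fx].
  by rewrite rmorphD hK fx addr0 [h u + x]addrC addrK.
Qed.

(** The number of elements of the residue field of the endomorphism ring, see
    kappa_residue. *)
Definition kappa I : nat := (#|hom I I| %/ countp (@radical Q O I I))%N.

Lemma kappa_residue I (F : finFieldType) (f : {rmorphism hom I I -> F})
    (h : {rmorphism F -> hom I I}) : indec I ->
  (forall u, f (h u) = u) -> (forall x, f x = 0 <-> nilp x) -> kappa I = #|F|.
Proof.
by move=> iI hK fk; rewrite /kappa (card_end_residue iI hK fk) mulnK ?radical_gt0.
Qed.

Lemma card_end_kappa I : indec I ->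
  #|hom I I| = (kappa I * countp (@radical Q O I I))%N /\ (1 < kappa I)%N.
Proof.
move=> iI; have [F [f [h [hK fk]]]] := indec_residue iI.
by rewrite (kappa_residue iI hK fk) (card_end_residue iI hK fk) finNzRing_gt1.
Qed.

Lemma indec_split_mono_iso (R : comNzRingType) (I J : rep Q R) (u : hom I J) :
  indec J -> idh I <> 0 -> split_mono u -> iso I J.
Proof.
case=> J0 idem I0 [p pu]; exists u, p; split=> //.
case: (idem (comp u p)) => // [|up0]; first by rewrite endME -compA [comp p _]compA pu comp1l.
case: I0; have := congr1 (fun h => comp p (comp h u)) up0.
by rewrite -compA compA pu comp1l comp0l comp0r.
Qed.

Lemma split_mono_dsum I X (u : hom I X) : split_mono u -> exists M, iso X (dsum I M).
Proof.
case=> p pu; pose e : hom X X := comp u p.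
have ee : e * e = e by rewrite endME -compA [comp p _]compA pu comp1l.
have e'e' : (1 - e) * (1 - e) = 1 - e.
  by rewrite mulrBr !mulrBl !mulr1 !mul1r ee subrr subr0.
have [M [j [q [qj jq]]]] := idempotent_split cO e'e'.
exists M; apply: (dsum_of_splitting pu qj).
by rewrite jq addrC subrK.
Qed.

Lemma rep_ind_dsum (P : rep Q O -> Prop) :
  (forall X, idh X = 0 -> P X) -> (forall X, indec X -> P X) ->
  (forall X Y, P X -> P Y -> P (dsum X Y)) -> (forall X Y, iso X Y -> P X -> P Y) ->
  forall X, P X.
Proof.
move=> P0 Pi Pd Piso X; have [n] := ubnP (rank_total X); elim: n X => // n IH X.
rewrite ltnS => Xn; have [X0|X0] := EM (idh X = 0); first exact: P0.
have [iX|nX] := EM (indec X); first exact: Pi.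
have [e [ee e0 e1]] : exists e : hom X X, [/\ e * e = e, e != 0 & e != 1].
  apply: contrapT => ne; apply: nX; split=> // e ee.
  have [->|e0] := eqVneq e 0; first by left.
  have [->|e1] := eqVneq e 1; first by right.
  by case: ne; exists e.
have [Y [Z [XYZ Y0 Z0]]] := idempotent_dsum cO ee e0 e1.
have rX : rank_total X = (rank_total Y + rank_total Z)%N.
  by rewrite -rank_total_dsum /rank_total (iso_rk XYZ).
move/rank_total_gt0: Y0 => Y0; move/rank_total_gt0: Z0 => Z0.
apply: (Piso _ _ (iso_sym XYZ)); apply: Pd; apply: IH; apply: leq_trans Xn; rewrite rX.
  by rewrite -[X in (X < _)%N]addn0 ltn_add2l.
by rewrite -[X in (X < _)%N]add0n ltn_add2r.
Qed.

(** The multiplicity of I as a direct summand of X: each summand isomorphic to I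
    contributes a factor kappa I to the index of the radical in hom I X, and every
    other indecomposable summand contributes 1. *)
Definition mult I X : nat :=
  trunc_log (kappa I) (#|hom I X| %/ countp (@radical Q O I X)).

Section Multiplicity.
Context (I : rep Q O).
Hypothesis iI : indec I.
Let locI := indec_local iI.

Lemma mult_uniq X j : #|hom I X| = (kappa I ^ j * countp (@radical Q O I X))%N ->
  mult I X = j.
Proof.
by rewrite /mult => ->; rewrite mulnK ?radical_gt0 // trunc_expnK // (card_end_kappa iI).2.
Qed.

Lemma card_hom_indec_other J : indec J -> ~ iso I J ->
  #|hom I J| = countp (@radical Q O I J).
Proof.
move=> iJ nIJ; rewrite -(countpC (@radical Q O I J)).
have -> : countp (fun u : hom I J => ~ radical u) = 0%N.
  apply/eqP; rewrite cards_eq0 -subset0; apply/subsetP => u; rewrite inE.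
  move/asboolP/(radicalPn locI) => su; case: nIJ.
  exact: (indec_split_mono_iso iJ iI.1 su).
by rewrite addn0.
Qed.

Lemma card_hom_zero X : idh X = 0 -> #|hom I X| = countp (@radical Q O I X).
Proof.
move=> X0; rewrite -countpT; apply: eq_card => u; rewrite !inE.
by apply: asbool_equiv_eq; split=> // _ g; rewrite -[u]comp1l X0 comp0l comp0r; exact: nilp0.
Qed.

Lemma card_hom_mult X :
  #|hom I X| = (kappa I ^ mult I X * countp (@radical Q O I X))%N.
Proof.
suff [j Xj] : exists j, #|hom I X| = (kappa I ^ j * countp (@radical Q O I X))%N.
  by rewrite (mult_uniq Xj).
elim/rep_ind_dsum: X => [X X0|X iX|X Y [m Xm] [n Yn]|X Y XY [m Xm]].
- by exists 0%N; rewrite card_hom_zero // mul1n.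
- have [IX|nIX] := EM (iso I X); last by exists 0%N; rewrite card_hom_indec_other // mul1n.
  exists 1%N; rewrite -(card_hom_isor I IX) -(radical_iso I IX) expn1.
  exact: (card_end_kappa iI).1.
- by exists (m + n)%N; rewrite card_hom_dsumr countp_radical_dsum // Xm Yn expnD mulnACA.
- by exists m; rewrite -(card_hom_isor I XY) -(radical_iso I XY).
Qed.

Lemma mult_dsum X Y : mult I (dsum X Y) = (mult I X + mult I Y)%N.
Proof.
apply: mult_uniq; rewrite card_hom_dsumr countp_radical_dsum // expnD mulnACA.
by rewrite -!card_hom_mult.
Qed.

Lemma mult_iso X Y : iso X Y -> mult I X = mult I Y.
Proof.
move=> XY; apply: mult_uniq.
by rewrite (card_hom_isor I XY) (radical_iso I XY) card_hom_mult.
Qed.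

Lemma mult_zero X : idh X = 0 -> mult I X = 0%N.
Proof. by move=> X0; apply: mult_uniq; rewrite mul1n card_hom_zero. Qed.

Lemma mult_self J : iso I J -> mult I J = 1%N.
Proof.
move=> IJ; rewrite -(mult_iso IJ).
by apply: mult_uniq; rewrite expn1; exact: (card_end_kappa iI).1.
Qed.

Lemma mult_other J : indec J -> ~ iso I J -> mult I J = 0%N.
Proof. by move=> iJ nIJ; apply: mult_uniq; rewrite mul1n card_hom_indec_other. Qed.

Lemma mult_gt0 X : (0 < mult I X)%N -> exists M, iso X (dsum I M).
Proof.
move=> m0; have [|/set0Pn[u]] := eqVneq [set u : hom I X | `[< split_mono u >]] set0.
  move/eqP; rewrite -cards_eq0 => /eqP c0; exfalso.
  have := countp_split_mono locI X; rewrite {2}/countp c0 addn0 card_hom_mult.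
  have := radical_gt0 I X; move: (countp _) => c c0' /eqP.
  rewrite -{1}[c]mul1n eqn_pmul2r // => /eqP e.
  have := ltn_expl (mult I X) (card_end_kappa iI).2; rewrite -e ltnS leqn0.
  by move/eqP => e0; rewrite e0 in m0.
by rewrite inE => /asboolP /split_mono_dsum.
Qed.

Definition kinv : rat := (kappa I)%:R^-1.

(** A morphism I -> I + M fails to be a split monomorphism with probability
    kappa^-(mult I (I + M)). *)
Lemma weight_dsum_mult M :
  weight (dsum I M) * (1 - kinv ^+ (mult I M).+1) = weight M.
Proof.
rewrite -(weight_dsum locI M) card_hom_mult mult_dsum (mult_self (iso_refl I)) add1n.
congr (_ * (1 - _)); rewrite natrM natrX /kinv exprVn invfM mulrCA divff ?mulr1 //.
by rewrite pnatr_eq0 -lt0n radical_gt0.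
Qed.

End Multiplicity.
End Indecomposables.

(** * Isomorphism classes of given rank *)

Definition to_rep (Q : quiver) (R : Type) (r : {ffun vertex Q -> nat}) (x : lfrep r R) :
  rep Q R := @Rep Q R r (fun a => x a).

Lemma rep_to_rep (Q : quiver) (R : Type) (r : {ffun vertex Q -> nat}) (X : rep Q R) :
  (forall i, rk X i = r i) -> exists x : lfrep r R, to_rep x = X.
Proof.
case: X => m A /= mr; have {mr}mr : m = r by apply/funext.
subst m; exists [ffun a => A a]; congr Rep.
by apply: functional_extensionality_dep => a; rewrite ffunE.
Qed.

Lemma rank_total_to_rep (Q : quiver) (R : Type) (r : {ffun vertex Q -> nat}) (x : lfrep r R) :
  rank_total (to_rep x) = mdegree r.
Proof. by []. Qed.

Section Classes.
Context (Q : quiver) (O : finComNzRingType).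

Section FixedRank.
Context (r : {ffun vertex Q -> nat}).
Implicit Types x y : lfrep r O.

(** The choice depends only on the isomorphism class, so that the fixed points of
    canon enumerate the classes. *)
Definition canon x : lfrep r O := odflt x [pick y | `[< iso (to_rep x) (to_rep y) >]].

Lemma canon_iso x : iso (to_rep x) (to_rep (canon x)).
Proof.
rewrite /canon; case: pickP => [y /asboolP //|/(_ x) /asboolP[]]; exact: iso_refl.
Qed.

Lemma canon_eq x y : iso (to_rep x) (to_rep y) -> canon x = canon y.
Proof.
move=> xy; rewrite /canon (@eq_pick _ _ (fun z => `[< iso (to_rep y) (to_rep z) >])) => [|z].
  by case: pickP => // /(_ y) /asboolP[]; exact: iso_refl.
by apply: asbool_equiv_eq; split; [apply/iso_trans/iso_sym|apply: iso_trans].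
Qed.

Lemma canonK x : canon (canon x) = canon x.
Proof. by apply/esym/canon_eq/canon_iso. Qed.

Definition is_class x := canon x == x.

Lemma canon_class x : is_class (canon x). Proof. by rewrite /is_class canonK. Qed.

Lemma class_inj x y : is_class x -> is_class y -> iso (to_rep x) (to_rep y) -> x = y.
Proof. by move=> /eqP xx /eqP yy /canon_eq; rewrite xx yy. Qed.

Definition indec_class x := is_class x && `[< indec (to_rep x) >].

End FixedRank.

Lemma class_of_rep (r : {ffun vertex Q -> nat}) (X : rep Q O) : (forall i, rk X i = r i) ->
  exists2 x : lfrep r O, is_class x & iso X (to_rep x).
Proof.
case/rep_to_rep => x <-; exists (canon x); [exact: canon_class|exact: canon_iso].
Qed.

End Classes.

(** * The recursion for the weighted count of isomorphism classes *)

Section QIdentity.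
Context (q : rat).
Hypothesis q1 : forall k, (0 < k)%N -> 1 - q ^+ k != 0.

(** The factor with exponent j - i vanishes for i >= j, because of the
    truncated subtraction. *)
Definition qfall (j k : nat) : rat := \prod_(i < k) (1 - q ^+ (j - i)).

Lemma qfallS j k : qfall j k.+1 = (1 - q ^+ j) * qfall j.-1 k.
Proof.
rewrite /qfall big_ord_recl subn0; congr (_ * _); apply: eq_bigr => i _.
by congr (1 - q ^+ _); rewrite lift0; lia.
Qed.

Lemma qfallSr j k : qfall j k.+1 = qfall j k * (1 - q ^+ (j - k)).
Proof. by rewrite /qfall big_ord_recr. Qed.

Lemma qfall_gt j k : (j < k)%N -> qfall j k = 0.
Proof.
move=> jk; rewrite /qfall (bigD1 (Ordinal jk)) //= subnn expr0 subrr mul0r //.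
Qed.

Lemma qfall_telescope j : \sum_(0 <= k < j.+1) q ^+ (j - k) * qfall j k = 1.
Proof.
have -> : \sum_(0 <= k < j.+1) q ^+ (j - k) * qfall j k =
    - \sum_(0 <= k < j.+1) (qfall j k.+1 - qfall j k).
  by rewrite -sumrN; apply: eq_bigr => k _; rewrite qfallSr; ring.
by rewrite telescope_sumr // opprB [qfall j j.+1]qfall_gt // subr0 /qfall big_ord0.
Qed.

(** By induction on j: the j-th sum exceeds the previous one by the telescoping
    sum above. *)
Lemma qfall_sum j N : (j <= N)%N ->
  \sum_(1 <= k < N.+1) qfall j k / (1 - q ^+ k) = j%:R.
Proof.
move=> jN; rewrite (big_cat_nat (n := j.+1)) //= [X in _ + X]big1_seq ?addr0; last first.
  by move=> k; rewrite mem_index_iota => /and3P[_ jk _]; rewrite qfall_gt // mul0r.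
elim: j {jN} => [|j IH]; first by rewrite big_geq.
have -> : \sum_(1 <= k < j.+2) qfall j.+1 k / (1 - q ^+ k) =
    \sum_(1 <= k < j.+2) (qfall j k / (1 - q ^+ k) + q ^+ (j.+1 - k) * qfall j k.-1).
  rewrite !big_nat; apply: eq_bigr => -[//|k] /andP[_ kj].
  rewrite qfallS qfallSr /=; have k1 := q1 (ltn0Sn k).
  have -> : q ^+ j.+1 = q ^+ (j.+1 - k.+1) * q ^+ k.+1 by rewrite -exprD subnK.
  rewrite subSS; field.
  exact: k1.
rewrite big_split /= big_nat_recr //= qfall_gt // mul0r addr0 IH.
rewrite big_add1 /=.
by under eq_bigr => k _ do rewrite subSS; rewrite qfall_telescope -natr1.
Qed.

End QIdentity.

Section Recursion.
Context (Q : quiver) (k : finFieldType) (O : finComUnitRingType).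
Context (res : {rmorphism O -> k}) (lft : {rmorphism k -> O}).
Hypothesis cO : coefficient_ring res lft.
Implicit Types r s : {ffun vertex Q -> nat}.

Definition class_weight r : rat :=
  \sum_(x : lfrep r O | is_class x) weight (to_rep x).

Lemma iso_to_rep_rank r s (x : lfrep r O) (y : lfrep s O) : iso (to_rep x) (to_rep y) -> r = s.
Proof. by move/iso_rk => /= e; apply/ffunP => i; rewrite e. Qed.

Section OneIndecomposable.
Context (s : {ffun vertex Q -> nat}) (I : lfrep s O).
Hypothesis iI : indec (to_rep I).
Let q := kinv (to_rep I).
Let m r (x : lfrep r O) := mult (to_rep I) (to_rep x).

Lemma kinv_ne1 n : (0 < n)%N -> 1 - q ^+ n != 0.
Proof.
move=> n0; rewrite subr_eq0 eq_sym; have [_ k1] := card_end_kappa lft iI.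
rewrite /q /kinv exprVn invr_eq1 -natrX pnatr_eq1.
by rewrite -(exp1n n) eqn_exp2r // neq_ltn k1 orbT.
Qed.

(** Adding I identifies the classes of rank r with the classes of rank s + r in
    which I occurs. *)
Lemma class_weight_shift r (f : nat -> rat) :
  \sum_(x : lfrep (s + r) O | is_class x) weight (to_rep x) * ((1 - q ^+ m x) * f (m x).-1) =
  \sum_(y : lfrep r O | is_class y) weight (to_rep y) * f (m y).
Proof.
have ex (y : lfrep r O) : exists x : lfrep (s + r) O, is_class x /\ iso (dsum (to_rep I) (to_rep y)) (to_rep x).
  have [|x cx ix] := @class_of_rep Q O (s + r) (dsum (to_rep I) (to_rep y)).
    by move=> i; rewrite ffunE.
  by exists x.
have [h hP] := choice ex.
have mh y : m (h y) = (m y).+1.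
  by rewrite /m -(mult_iso cO iI (hP y).2) (mult_dsum cO iI) (mult_self cO iI (iso_refl _)).
rewrite (bigID (fun x : lfrep (s + r) O => m x == 0%N)) /= big1 ?add0r => [|x /andP[_ /eqP->]]; last first.
  by rewrite expr0 subrr mul0r mulr0.
rewrite [RHS](partition_big h (fun x => is_class x && (m x != 0%N))) /=; last first.
  by move=> y _; rewrite (hP y).1 mh.
apply: eq_bigr => x /andP[cx mx]; rewrite -lt0n in mx.
have [M xM] := mult_gt0 cO iI mx.
have [|y cy My] := @class_of_rep Q O r M.
  by move=> i; have := congr1 (fun rk => rk i) (iso_rk xM); rewrite /= ffunE => /addnI.
have hyx : h y = x.
  apply: class_inj cx _; first exact: (hP y).1.
  apply: iso_trans (iso_sym (hP y).2) (iso_sym _); apply: iso_trans xM _.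
  by apply: iso_dsum My; exact: iso_refl.
rewrite (big_pred1 y) => [|z].
  rewrite -hyx mh /= mulrA; congr (_ * _).
  by rewrite -(weight_iso (hP y).2) (weight_dsum_mult cO iI).
apply/andP/eqP => [[cz /eqP hz]|->]; last by rewrite hyx eqxx.
apply: class_inj cz cy _; apply: (dsum_cancel (indec_local iI)).
by apply: iso_trans (hP z).2 _; rewrite hz -hyx; exact: iso_sym (hP y).2.
Qed.

Lemma mult_eq0 r (x : lfrep r O) : (forall e, r <> s + e) -> m x = 0%N.
Proof.
move=> nr; apply/eqP; rewrite -leqn0 leqNgt; apply/negP => /(mult_gt0 cO iI)[M xM].
apply: (nr [ffun i => rk M i]); apply/ffunP => i; rewrite !ffunE.
by have := congr1 (fun rk => rk i) (iso_rk xM).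
Qed.

(** Weighting by the falling factor of length n in the multiplicity of I amounts to
    removing n copies of I, one at a time. *)
Lemma class_weight_qfall n e :
  \sum_(x : lfrep (s *+ n + e) O | is_class x) weight (to_rep x) * qfall q (m x) n =
  class_weight e.
Proof.
elim: n => [|n IH].
  by rewrite mulr0n add0r; apply: eq_bigr => x _; rewrite /qfall big_ord0 mulr1.
rewrite mulrS -addrA -IH.
rewrite -(class_weight_shift (s *+ n + e) (fun j => qfall q j n)).
by apply: eq_bigr => x _; rewrite qfallS.
Qed.

Lemma class_weight_qfall0 n r : (forall e, r <> s *+ n + e) ->
  \sum_(x : lfrep r O | is_class x) weight (to_rep x) * qfall q (m x) n = 0.
Proof.
elim: n r => [|n IH] r nr; first by case: (nr r); rewrite add0r.
have [[r' rr']|nr'] := EM (exists r', r = s + r').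
  subst r; rewrite -[RHS](IH r') => [|e re]; last by apply: (nr e); rewrite mulrS -addrA -re.
  by rewrite -(class_weight_shift r' (fun j => qfall q j n)); apply: eq_bigr => x _; rewrite qfallS.
rewrite big1 // => x _; rewrite mult_eq0 => [|e re]; last by apply: nr'; exists e.
by rewrite qfallS expr0 subrr mul0r mulr0.
Qed.

End OneIndecomposable.

(** Krull-Schmidt, in the form of a formula for the rank. *)
Lemma rank_total_mult N X : (rank_total X <= N)%N ->
  rank_total X = (\sum_(c : exp_box (vertex Q) N)
    \sum_(I : lfrep (exp_of_box c) O | indec_class I)
      mult (to_rep I) X * mdegree (exp_of_box c))%N.
Proof.
move: X; apply: (rep_ind_dsum cO) => [X X0 _|X iX XN|X Y IX IY|X Y XY IX].
- have /eqP -> : rank_total X == 0%N by rewrite rank_total0; apply/asboolP.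
  rewrite big1 // => c _; rewrite big1 // => I /andP[_ /asboolP iI].
  by rewrite (mult_zero lft iI X0).
- pose r : {ffun vertex Q -> nat} := [ffun i => rk X i].
  have rX : mdegree r = rank_total X by apply: eq_bigr => i _; rewrite ffunE.
  have rN i : (r i <= N)%N by rewrite (leq_trans (leq_mdegree _ _)) ?rX.
  rewrite (bigD1 (box_of_exp N r)) //= [X in (_ = _ + X)%N]big1 ?addn0; last first.
    move=> c cr; rewrite big1 // => I /andP[_ /asboolP iI]; rewrite (mult_other lft iI iX) //.
    move=> IX; move/eqP: cr; apply; apply: exp_of_box_inj; rewrite box_of_expK //.
    by apply/ffunP => i; have := congr1 (fun rk => rk i) (iso_rk IX); rewrite /= => ->; rewrite ffunE.
  rewrite box_of_expK //; have [|I0 cI0 XI0] := @class_of_rep Q O r X; first by move=> i; rewrite ffunE.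
  have iI0 : indec (to_rep I0) by exact: indec_iso XI0 iX.
  rewrite (bigD1 I0) /=; last by rewrite /indec_class cI0; apply/asboolP.
  rewrite (mult_self cO iI0 (iso_sym XI0)) mul1n rX big1 ?addn0 // => I /andP[/andP[cI /asboolP iI] nI].
  rewrite (mult_other lft iI iX) // => IX; move/eqP: nI; apply.
  by apply: class_inj cI cI0 _; exact: iso_trans IX XI0.
- rewrite rank_total_dsum => XYN; rewrite (IX (leq_trans (leq_addr _ _) XYN)) (IY (leq_trans (leq_addl _ _) XYN)).
  rewrite -big_split; apply: eq_bigr => c _; rewrite -big_split.
  by apply: eq_bigr => I /andP[_ /asboolP iI]; rewrite (mult_dsum cO iI) mulnDl.
- have -> : rank_total Y = rank_total X by rewrite /rank_total (iso_rk XY).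
  move=> /IX ->; apply: eq_bigr => c _; apply: eq_bigr => I /andP[_ /asboolP iI].
  by rewrite (mult_iso cO iI XY).
Qed.

Lemma mult_le_rank N (c : exp_box (vertex Q) N) (I : lfrep (exp_of_box c) O) X :
  indec_class I -> (rank_total X <= N)%N -> (mult (to_rep I) X <= rank_total X)%N.
Proof.
move=> cI XN; rewrite [in leqRHS](rank_total_mult XN) (bigD1 c) //= (bigD1 I) //=.
have [_ /asboolP [/rank_total_gt0]] := andP cI; rewrite rank_total_to_rep => s0 _.
by rewrite -addnA (leq_trans _ (leq_addr _ _)) // leq_pmulr.
Qed.

(** The coefficients of the sum over I and n >= 1 of |s| t^(n s) / (1 - kappa^-n), where s
    is the rank of I. *)
Definition indec_log N d : rat :=
  \sum_(c : exp_box (vertex Q) N) \sum_(I : lfrep (exp_of_box c) O | indec_class I)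
    \sum_(1 <= n < N.+1 | exp_of_box c *+ n == d)
      (mdegree (exp_of_box c))%:R / (1 - kinv (to_rep I) ^+ n).

Lemma class_weight_qfall_sum N r s (I : lfrep s O) n : indec (to_rep I) -> (mdegree r <= N)%N ->
  \sum_(x : lfrep r O | is_class x)
     weight (to_rep x) * qfall (kinv (to_rep I)) (mult (to_rep I) (to_rep x)) n =
  \sum_(p : exp_box (vertex Q) N * exp_box (vertex Q) N
          | (exp_of_box p.1 + exp_of_box p.2 == r) && (s *+ n == exp_of_box p.1))
     class_weight (exp_of_box p.2).
Proof.
move=> iI rN; have [[e re]|nr] := EM (exists e, r = s *+ n + e); last first.
  rewrite class_weight_qfall0 // => [|e re]; last by apply: nr; exists e.
  rewrite big1 // => p /andP[/eqP pr /eqP sp]; case: nr; exists (exp_of_box p.2).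
  by rewrite sp pr.
have sN i : ((s *+ n) i <= N)%N.
  by rewrite (leq_trans (leq_mdegree _ _)) // (leq_trans _ rN) // re mdegreeD leq_addr.
have eN i : (e i <= N)%N.
  by rewrite (leq_trans (leq_mdegree _ _)) // (leq_trans _ rN) // re mdegreeD leq_addl.
rewrite (big_pred1 (box_of_exp N (s *+ n), box_of_exp N e)) /=; last first.
  case=> a b /=; apply/andP/eqP => [[/eqP ab /eqP sa]|[-> ->]]; last first.
    by rewrite !box_of_expK // re !eqxx.
  congr pair; apply: exp_of_box_inj; rewrite box_of_expK //.
  apply/ffunP => i; have := congr1 (fun f : {ffun _ -> nat} => f i) ab.
  by rewrite -sa re !ffunE => /addnI.
by rewrite box_of_expK // re class_weight_qfall.
Qed.

(** The logarithmic derivative of the generating series of class weights: count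
    each class with its rank, split the rank over the indecomposable summands,
    and expand multiplicities by the q-identity. *)
Lemma class_weight_rec N r : (mdegree r <= N)%N ->
  (mdegree r)%:R * class_weight r =
  \sum_(p : exp_box (vertex Q) N * exp_box (vertex Q) N | exp_of_box p.1 + exp_of_box p.2 == r)
    indec_log N (exp_of_box p.1) * class_weight (exp_of_box p.2).
Proof.
move=> rN; rewrite /class_weight mulr_sumr.
transitivity (\sum_(c : exp_box (vertex Q) N) \sum_(I : lfrep (exp_of_box c) O | indec_class I)
    \sum_(1 <= n < N.+1) (mdegree (exp_of_box c))%:R / (1 - kinv (to_rep I) ^+ n) *
     \sum_(x : lfrep r O | is_class x)
       weight (to_rep x) * qfall (kinv (to_rep I)) (mult (to_rep I) (to_rep x)) n).
  under [RHS]eq_bigr => c _ do under eq_bigr => I _ do (under eq_bigr => n _ do rewrite mulr_sumr).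
  under [RHS]eq_bigr => c _ do under eq_bigr => I _ do rewrite exchange_big.
  under [RHS]eq_bigr => c _ do rewrite exchange_big.
  rewrite [RHS]exchange_big; apply: eq_bigr => x _ /=.
  have -> : (mdegree r)%:R = (rank_total (to_rep x))%:R :> rat by [].
  rewrite (@rank_total_mult N (to_rep x)) // natr_sum mulr_suml; apply: eq_bigr => c _.
  rewrite natr_sum mulr_suml; apply: eq_bigr => I cI; have [_ /asboolP iI] := andP cI.
  rewrite natrM -(@qfall_sum (kinv (to_rep I)) (kinv_ne1 iI) _ N); last first.
    by rewrite (leq_trans (mult_le_rank cI _)).
  rewrite mulr_suml mulr_suml; apply: eq_bigr => n _.
  by rewrite mulrAC [RHS]mulrC; ring.
under eq_bigr => c _ do under eq_bigr => I iI do under eq_bigr => n _ do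
  rewrite (class_weight_qfall_sum _ (asboolW (andP iI).2) rN) mulr_sumr big_mkcondr /=.
have -> : \sum_(p : exp_box (vertex Q) N * exp_box (vertex Q) N | exp_of_box p.1 + exp_of_box p.2 == r)
    indec_log N (exp_of_box p.1) * class_weight (exp_of_box p.2) =
  \sum_(p : exp_box (vertex Q) N * exp_box (vertex Q) N | exp_of_box p.1 + exp_of_box p.2 == r)
    \sum_(c : exp_box (vertex Q) N) \sum_(I : lfrep (exp_of_box c) O | indec_class I)
    \sum_(1 <= n < N.+1) (if exp_of_box c *+ n == exp_of_box p.1 then
      (mdegree (exp_of_box c))%:R / (1 - kinv (to_rep I) ^+ n) * class_weight (exp_of_box p.2) else 0).
  apply: eq_bigr => p _; rewrite mulr_suml; apply: eq_bigr => c _.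
  rewrite mulr_suml; apply: eq_bigr => I _; rewrite big_mkcond mulr_suml.
  by apply: eq_bigr => n _; case: ifP => //; rewrite mul0r.
rewrite [RHS]exchange_big; apply: eq_bigr => c _ /=.
rewrite [RHS]exchange_big; apply: eq_bigr => I _ /=.
rewrite [RHS]exchange_big; apply: eq_bigr => n _ /=.
by apply: eq_bigr => p _.
Qed.

End Recursion.

(** * Truncated polynomials *)

Section TruncPoly.
Context (K : fieldType) (n : nat).
Local Notation O := (truncpoly K n.+1).
Implicit Types p q : O.

Lemma size_truncpoly p : (size (p : {poly K}) <= n.+1)%N.
Proof. by rewrite (leq_trans (size_npoly p)) // mk_monic_Xn size_polyXn. Qed.

Lemma truncpoly_inj p q : (forall i, (i <= n)%N -> (p : {poly K})`_i = (q : {poly K})`_i) -> p = q.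
Proof.
move=> h; apply/val_inj/polyP => i; have [/h //|ni] := leqP i n.
by rewrite !nth_default // (leq_trans (size_truncpoly _)).
Qed.

Lemma coef_in_qpoly (P : {poly K}) i : (i <= n)%N ->
  (in_qpoly 'X^(n.+1) P : {poly K})`_i = P`_i.
Proof.
move=> ni; rewrite /= mk_monic_Xn /=.
rewrite [in RHS](Pdiv.RingMonic.rdivp_eq (monicXn K n.+1) P) coefD coefMXn ltnS ni add0r.
by [].
Qed.

Lemma coef_truncpolyD p q i : (p + q : {poly K})`_i = (p : {poly K})`_i + (q : {poly K})`_i.
Proof. by rewrite coefD. Qed.

Lemma coef_truncpolyM p q i : (i <= n)%N ->
  ((p * q : O) : {poly K})`_i = \sum_(j < i.+1) (p : {poly K})`_j * (q : {poly K})`_(i - j).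
Proof.
move=> ni; have <- : in_qpoly 'X^(n.+1) ((p : {poly K}) * q) = p * q.
  by apply: val_inj; rewrite [RHS]poly_of_qpolyM.
by rewrite coef_in_qpoly // coefM.
Qed.

Lemma coef_qpolyC c i : (qpolyC 'X^(n.+1) c : {poly K})`_i = if i == 0%N then c else 0.
Proof. by rewrite qpolyCE coefC. Qed.

Lemma coef_truncpolyZ c p i : (i <= n)%N ->
  ((qpolyC 'X^(n.+1) c * p : O) : {poly K})`_i = c * (p : {poly K})`_i.
Proof.
move=> ni; rewrite coef_truncpolyM // big_ord_recl subn0 coef_qpolyC eqxx big1 ?addr0 // => j _.
by rewrite coef_qpolyC lift0 mul0r.
Qed.

Definition truncpoly_res p : K := (p : {poly K})`_0.

Lemma truncpoly_res_zmod : zmod_morphism truncpoly_res.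
Proof. by move=> p q; rewrite /truncpoly_res -coefB. Qed.
Lemma truncpoly_res_monoid : monoid_morphism truncpoly_res.
Proof.
split=> [|p q]; last by rewrite /truncpoly_res coef_truncpolyM // big_ord_recl big_ord0 addr0.
by rewrite /truncpoly_res coef1.
Qed.
HB.instance Definition _ := GRing.isZmodMorphism.Build O K truncpoly_res truncpoly_res_zmod.
HB.instance Definition _ := GRing.isMonoidMorphism.Build O K truncpoly_res truncpoly_res_monoid.

Lemma truncpoly_unit p : (p \is a GRing.unit) = (truncpoly_res p != 0).
Proof.
have cop (P : {poly K}) : coprimep (mk_monic 'X^(n.+1)) P = (P`_0 != 0).
  by rewrite mk_monic_Xn coprimep_sym coprimep_pexpr // coprimepX rootE horner_coef0.
exact: cop.
Qed.

Lemma truncpoly_coefficient_ring :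
  coefficient_ring (truncpoly_res : {rmorphism O -> K}) (qpolyC 'X^(n.+1) : {rmorphism K -> O}).
Proof.
split=> [c|]; last exact: truncpoly_unit.
by rewrite /= /truncpoly_res coef_qpolyC.
Qed.

End TruncPoly.

Section TruncPolyMap.
Context (K L : fieldType) (n : nat) (f : {rmorphism K -> L}).
Local Notation phi := (@truncpoly_map n.+1 K L f).

Lemma coef_truncpoly_map (p : truncpoly K n.+1) i :
  (phi p : {poly L})`_i = f ((p : {poly K})`_i).
Proof.
rewrite /truncpoly_map in_qpoly_small ?coef_map //.
have -> : size (mk_monic 'X^(n.+1) : {poly L}) = n.+2 by rewrite mk_monic_Xn size_polyXn.
by rewrite ltnS size_map_poly size_truncpoly.
Qed.

Lemma truncpoly_map_zmod : zmod_morphism phi.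
Proof.
by move=> p q; apply/truncpoly_inj => i _; rewrite coef_truncpoly_map !coefB !coef_truncpoly_map rmorphB.
Qed.
Lemma truncpoly_map_monoid : monoid_morphism phi.
Proof.
split=> [|p q]; apply/truncpoly_inj => i ni; rewrite coef_truncpoly_map.
  by rewrite !coef1 rmorph_nat.
rewrite !coef_truncpolyM // rmorph_sum; apply: eq_bigr => j _.
by rewrite rmorphM !coef_truncpoly_map.
Qed.
HB.instance Definition _ := GRing.isZmodMorphism.Build (truncpoly K n.+1) (truncpoly L n.+1)
  phi truncpoly_map_zmod.
HB.instance Definition _ := GRing.isMonoidMorphism.Build (truncpoly K n.+1) (truncpoly L n.+1)
  phi truncpoly_map_monoid.

Lemma truncpoly_mapC c : phi (qpolyC 'X^(n.+1) c) = qpolyC 'X^(n.+1) (f c).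
Proof.
apply/truncpoly_inj => i _; rewrite coef_truncpoly_map !coef_qpolyC.
by case: ifP; rewrite ?rmorph0.
Qed.

End TruncPolyMap.

(** * Extension of scalars *)

Section Ext.
Context (Q : quiver) (R R' : comNzRingType) (phi : {rmorphism R -> R'}).
Implicit Types X Y Z : rep Q R.

Definition ext X : rep Q R' := @Rep Q R' (rk X) (fun a => map_mx phi (act X a)).

Lemma exth_subproof X Y (f : hom X Y) a :
  map_mx phi (f (tgt a)) *m act (ext X) a = act (ext Y) a *m map_mx phi (f (src a)).
Proof. by rewrite /= -!map_mxM hom_act. Qed.
Definition exth X Y (f : hom X Y) : hom (ext X) (ext Y) :=
  @mkhom Q R' (ext X) (ext Y) (fun i => map_mx phi (f i)) (exth_subproof f).

Lemma exthE X Y (f : hom X Y) i : exth f i = map_mx phi (f i).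
Proof. exact: mkhomE. Qed.

Lemma exthD X Y (f g : hom X Y) : exth (f + g) = exth f + exth g.
Proof. by apply: homP => i; rewrite !(homE, exthE) map_mxD. Qed.
Lemma exth0 X Y : exth (0 : hom X Y) = 0.
Proof. by apply: homP => i; rewrite !(homE, exthE) map_mx0. Qed.
Lemma exthN X Y (f : hom X Y) : exth (- f) = - exth f.
Proof. by apply: homP => i; rewrite !(homE, exthE) map_mxN. Qed.
Lemma exthZ X Y c (f : hom X Y) : exth (c *: f) = phi c *: exth f.
Proof. by apply: homP => i; rewrite !(homE, exthE) map_mxZ. Qed.
Lemma exth_comp X Y Z (g : hom Y Z) (f : hom X Y) :
  exth (comp g f) = comp (exth g) (exth f).
Proof. by apply: homP => i; rewrite !(homE, exthE) map_mxM. Qed.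
Lemma exth1 X : exth (idh X) = idh (ext X).
Proof. by apply: homP => i; rewrite !(homE, exthE) map_mx1. Qed.
Lemma exth_sum X Y (J : Type) (s : seq J) (P : pred J) (f : J -> hom X Y) :
  exth (\sum_(j <- s | P j) f j) = \sum_(j <- s | P j) exth (f j).
Proof. by apply: (big_morph (@exth X Y)); [exact: exthD|exact: exth0]. Qed.

Lemma ext_iso X Y : iso X Y -> iso (ext X) (ext Y).
Proof.
by case=> f [g [gf fg]]; exists (exth f), (exth g); rewrite -!exth_comp gf fg !exth1.
Qed.

Lemma ext_dsum X Y : ext (dsum X Y) = dsum (ext X) (ext Y).
Proof.
congr Rep; apply: functional_extensionality_dep => a.
by rewrite /= /dsum_act map_block_mx !map_mx0.
Qed.

End Ext.

(** Discard each vector that depends on those kept so far. *)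
Lemma independent_span (K E : fieldType) (f : {rmorphism K -> E}) (s : seq E) :
  exists m (b : 'I_m -> E),
    (forall c : 'I_m -> K, \sum_j f (c j) * b j = 0 -> forall j, c j = 0) /\
    (forall v, v \in s -> exists c : 'I_m -> K, v = \sum_j f (c j) * b j).
Proof.
elim: s => [|v s [m [b [ind sp]]]].
  by exists 0%N, (fun=> 0); split=> [c _ []|].
have [vsp|nv] := EM (exists c : 'I_m -> K, v = \sum_j f (c j) * b j).
  by exists m, b; split=> // w; rewrite inE => /orP[/eqP->|/sp].
exists m.+1, (fun j => if unlift ord0 j is Some i then b i else v); split=> [c|w].
  rewrite big_ord_recl unlift_none; under eq_bigr => j _ do rewrite liftK.
  have [c0|c0] := eqVneq (c ord0) 0.
    rewrite c0 rmorph0 mul0r add0r => /ind h j.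
    by case: (unliftP ord0 j) => [i ->|->].
  move=> e; case: nv; exists (fun j => - (c (lift ord0 j) / c ord0)).
  have f0 : f (c ord0) != 0 by rewrite fmorph_eq0.
  apply: (mulfI f0); rewrite mulr_sumr; apply/eqP; rewrite -subr_eq0; apply/eqP.
  rewrite -[RHS]e; congr (_ + _); rewrite -sumrN; apply: eq_bigr => j _.
  by rewrite rmorphN rmorphM fmorphV; field.
rewrite inE => /orP[/eqP->|/sp[c ->]].
  exists (fun j => if unlift ord0 j is Some i then 0 else 1).
  rewrite big_ord_recl unlift_none rmorph1 mul1r big1 ?addr0 // => j _.
  by rewrite liftK rmorph0 mul0r.
exists (fun j => if unlift ord0 j is Some i then c i else 0).
rewrite big_ord_recl unlift_none rmorph0 mul0r add0r.
by apply: eq_bigr => j _; rewrite liftK.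
Qed.

Section Span.
Context (Q : quiver) (K E : fieldType) (f : {rmorphism K -> E}) (n : nat).
Local Notation R := (truncpoly K n.+1).
Local Notation R' := (truncpoly E n.+1).
Local Notation phi := (@truncpoly_map n.+1 K E f : {rmorphism R -> R'}).
Local Notation cst := (qpolyC ('X^(n.+1) : {poly E})).
Implicit Types X Y Z : rep Q R.

Definition in_span X Y (P : hom X Y -> Prop) (F : hom (ext phi X) (ext phi Y)) : Prop :=
  exists (J : finType) (b : J -> E) (g : J -> hom X Y),
    (forall j, P (g j)) /\ F = \sum_j cst (b j) *: exth phi (g j).

Lemma in_span_ext X Y (P : hom X Y -> Prop) g : P g -> in_span P (exth phi g).
Proof.
move=> Pg; exists unit, (fun=> 1), (fun=> g); split=> //.
by rewrite big_const card_unit /= addr0 rmorph1 scale1r.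
Qed.

Lemma in_span_comp X Y Z (P : hom X Y -> Prop) (P' : hom Y Z -> Prop) (P'' : hom X Z -> Prop) F G :
  (forall u v, P u -> P' v -> P'' (comp v u)) ->
  in_span P F -> in_span P' G -> in_span P'' (comp G F).
Proof.
move=> PP [J [c [g [Pg ->]]]] [J' [c' [g' [Pg' ->]]]].
exists (J' * J)%type, (fun j => c' j.1 * c j.2), (fun j => comp (g' j.1) (g j.2)).
split=> [j|]; first exact: PP.
rewrite comp_suml -(pair_bigA _ (fun j' j => cst (c' j' * c j) *: exth phi (comp (g' j') (g j)))).
apply: eq_bigr => j' _; rewrite comp_sumr; apply: eq_bigr => j _ /=.
by rewrite compZl compZr scalerA -rmorphM exth_comp.
Qed.

Lemma in_span0 X Y (P : hom X Y -> Prop) F : (forall u, P u -> u = 0) -> in_span P F -> F = 0.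
Proof.
move=> P0 [J [c [g [Pg ->]]]]; rewrite big1 // => j _.
by rewrite (P0 _ (Pg j)) exth0 scaler0.
Qed.

(** Being a morphism is a linear condition with coefficients in K, so the
    coordinates over K of a morphism over E are morphisms. *)
Lemma in_span_all X Y (F : hom (ext phi X) (ext phi Y)) : in_span (fun _ => True) F.
Proof.
pose T := {i : vertex Q & ('I_(rk Y i) * 'I_(rk X i) * 'I_n.+1)%type}.
pose v (t : T) := (F (tag t) (tagged t).1.1 (tagged t).1.2 : {poly E})`_(tagged t).2.
have [m [b [ind sp]]] := independent_span f (codom v).
have /choice[c cP] : forall t : T, exists c : 'I_m -> K, v t = \sum_j f (c j) * b j.
  by move=> t; apply: sp; exact: codom_f.
pose cf j i k l (a : nat) : K := c (@Tagged _ i (fun i => ('I_(rk Y i) * 'I_(rk X i) * 'I_n.+1)%type) (k, l, inord a)) j.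
pose G j i : 'M[R]_(rk Y i, rk X i) := \matrix_(k, l) in_qpoly 'X^(n.+1) (\poly_(a < n.+1) cf j i k l a).
have coefG j i k l a : (a <= n)%N -> (G j i k l : {poly K})`_a = cf j i k l a.
  by move=> an; rewrite mxE coef_in_qpoly // coef_poly ltnS an.
have FG i : F i = \sum_j cst (b j) *: map_mx phi (G j i).
  apply/matrixP => k l; rewrite summxE; apply/truncpoly_inj => a an.
  rewrite (big_morph (fun p : R' => (p : {poly E})`_a) (id1 := 0) (op1 := +%R)) //=; last first.
  - by rewrite coef0.
  - by move=> p q; rewrite coefD.
  have := cP (@Tagged _ i (fun i => ('I_(rk Y i) * 'I_(rk X i) * 'I_n.+1)%type) (k, l, inord a)).
  rewrite /v /= inordK ?ltnS // => ->; apply: eq_bigr => j _.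
  by rewrite !mxE coef_truncpolyZ // coef_truncpoly_map coef_in_qpoly // coef_poly ltnS an mulrC.
have Ghom j a : G j (tgt a) *m act X a = act Y a *m G j (src a).
  apply/eqP; rewrite -subr_eq0; apply/eqP; move: j.
  pose D j := G j (tgt a) *m act X a - act Y a *m G j (src a).
  have D0 : \sum_j cst (b j) *: map_mx phi (D j) = 0.
    have := hom_act F a; rewrite !FG /= mulmx_suml mulmx_sumr => /eqP.
    rewrite -subr_eq0 -sumrB => /eqP h; rewrite -[RHS]h; apply: eq_bigr => j _.
    by rewrite map_mxB !map_mxM scalerBr scalemxAl -scalemxAr.
  move=> j; apply/matrixP => k l; rewrite [RHS]mxE; apply/truncpoly_inj => d dn.
  rewrite coef0; apply: (ind (fun j => (D j k l : {poly K})`_d)).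
  have := congr1 (fun M : 'M[R']__ => (M k l : {poly E})`_d) D0; rewrite summxE mxE coef0.
  rewrite (big_morph (fun p : R' => (p : {poly E})`_d) (id1 := 0) (op1 := +%R)) //=; last first.
  - by rewrite coef0.
  - by move=> p q; rewrite coefD.
  move=> h; rewrite -[RHS]h; apply: eq_bigr => j' _.
  by move: (D j') => M; rewrite !mxE coef_truncpolyZ // coef_truncpoly_map mulrC.
exists 'I_m, b, (fun j => @mkhom Q R X Y (G j) (Ghom j)); split=> //.
apply: homP => i; rewrite FG.
rewrite (big_morph (fun h : hom (ext phi X) (ext phi Y) => h i) (id1 := 0) (op1 := +%R)).
- apply: eq_bigr => j _; rewrite homE exthE; congr (_ *: map_mx phi _).
  by rewrite mkhomE.
- by move=> h h'; rewrite homE.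
- by rewrite homE.
Qed.

(** A power of F is a combination of extensions of long products of nilpotents,
    which vanish uniformly. *)
Lemma in_span_nilp X F :
  (exists N, forall s : seq (hom X X), size s = N -> (forall x, x \in s -> nilp x) ->
    \prod_(x <- s) x = 0) ->
  in_span (@nilp (hom X X)) F -> nilp F.
Proof.
case=> N JN FJ; exists N.
pose Jpow m (u : hom X X) := exists s : seq (hom X X),
  [/\ size s = m, forall x, x \in s -> nilp x & u = \prod_(x <- s) x].
have : in_span (Jpow N) (F ^+ N).
  elim: N {JN} => [|N IH].
    rewrite expr0 end1E -exth1; apply: in_span_ext; exists [::]; split=> //.
    by rewrite big_nil.
  rewrite exprSr endME; apply: in_span_comp FJ IH => u v nu [s [sN sn ->]].
  exists (rcons s u); split; first by rewrite size_rcons sN.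
    by move=> x; rewrite mem_rcons inE => /orP[/eqP->|/sn].
  by rewrite -cats1 big_cat big_seq1.
by apply: in_span0 => u [s [sN sn ->]]; exact: JN.
Qed.

End Span.

(** * Absolutely indecomposable representations *)

Section AbsLocal.
Context (Q : quiver) (E : fieldType) (n : nat).
Local Notation R := (truncpoly E n.+1).
Local Notation cst := (qpolyC ('X^(n.+1) : {poly E})).
Implicit Types N X Y : rep Q R.

(** A form of absolute indecomposability that makes sense over the base field and
    survives every extension of it. *)
Definition abs_local N : Prop :=
  idh N <> 0 /\ forall g : hom N N, exists c : E, nilp (g - cst c *: idh N).

Lemma scale_end_comm X (c : R) (g : hom X X) : GRing.comm g (c *: idh X).
Proof. by rewrite /GRing.comm !endME compZl compZr comp1l comp1r. Qed.

Lemma scale_end_unit X (c : E) : c != 0 -> invertible (cst c *: idh X).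
Proof.
move=> c0; exists (cst c^-1 *: idh X); rewrite !endME !compZl !compZr !scalerA -!rmorphM.
by rewrite mulVf // divff // rmorph1 !scale1r comp1l.
Qed.

Lemma scale_plus_nilp X (c : E) (g : hom X X) : c != 0 -> nilp (g - cst c *: idh X) ->
  invertible g.
Proof.
move=> c0 ng; pose s := cst c^-1 *: idh X.
have sc : s * (cst c *: idh X) = 1.
  by rewrite endME compZl compZr scalerA -rmorphM mulVf // rmorph1 scale1r comp1l.
have gE : g = (1 - - ((g - cst c *: idh X) * s)) * (cst c *: idh X).
  rewrite opprK mulrDl -mulrA sc mul1r mulr1 [RHS]addrC subrK //.
rewrite gE; apply: invertibleM; last exact: scale_end_unit.
apply: nilp_sub1_inv; apply: nilpN; apply: nilp_comm ng; exact: scale_end_comm.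
Qed.

Lemma abs_local_local N : abs_local N -> local_ring (hom N N).
Proof.
case=> N0 sc; split=> // g; have [c ngc] := sc g.
have [c0|c0] := eqVneq c 0; [left|by right; apply: scale_plus_nilp ngc].
by move: ngc; rewrite c0 rmorph0 scale0r subr0.
Qed.

Lemma abs_local_indec N : abs_local N -> indec N.
Proof.
move=> aN; split=> [|e ee]; first exact: aN.1.
case: (local_nilp_or (abs_local_local aN) e); [left|right].
  exact: (idempotent_nilp (E := hom N N)).
exact: (idempotent_invertible (E := hom N N)).
Qed.

Lemma abs_local_scalar_uniq N (g : hom N N) c c' : abs_local N ->
  nilp (g - cst c *: idh N) -> nilp (g - cst c' *: idh N) -> c = c'.
Proof.
move=> aN nc nc'; apply/eqP; rewrite -subr_eq0; apply/negPn/negP => cc'.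
have loc := abs_local_local aN.
have : nilp (cst (c - c') *: idh N).
  rewrite rmorphB scalerBl; have := local_nilpB loc nc' nc.
  by rewrite opprB addrC addrA subrK.
have [x [_ sx]] := scale_end_unit N cc'.
by move/nilp_invF => /(_ _ loc.1 sx).
Qed.

Lemma abs_local_residue N : abs_local N ->
  exists rs : {rmorphism hom N N -> E},
    (forall g, nilp (g - cst (rs g) *: idh N)) /\ (forall c, rs (cst c *: idh N) = c).
Proof.
move=> aN; have loc := abs_local_local aN; have [rs rsP] := choice aN.2.
have uniq g c : nilp (g - cst c *: idh N) -> rs g = c.
  exact: abs_local_scalar_uniq aN (rsP g).
have rsB : zmod_morphism rs.
  move=> g h; apply: uniq.
  have -> : g - h - cst (rs g - rs h) *: idh N =
    (g - cst (rs g) *: idh N) - (h - cst (rs h) *: idh N).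
    rewrite rmorphB scalerBl opprB [X in _ + X = _]addrC addrACA opprB.
    by congr (_ + _); rewrite addrC.
  exact: local_nilpB.
have rsM : monoid_morphism rs.
  split; first by apply: uniq; rewrite rmorph1 scale1r subrr; exact: nilp0.
  move=> g h; apply: uniq.
  have -> : g * h - cst (rs g * rs h) *: idh N =
     (g - cst (rs g) *: idh N) * h + cst (rs g) *: idh N * (h - cst (rs h) *: idh N).
    rewrite mulrBl mulrBr addrA subrK; congr (_ - _).
    by rewrite endME compZl compZr scalerA -rmorphM comp1l.
  by apply: (local_nilpD loc); [apply: (local_nilpMr loc)|apply: (local_nilpMl loc)].
pose m1 := GRing.isZmodMorphism.Build _ _ rs rsB.
pose m2 := GRing.isMonoidMorphism.Build _ _ rs rsM.
pose rm : {rmorphism hom N N -> E} := HB.pack rs m1 m2.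
exists rm; split=> // c; apply: uniq; rewrite subrr; exact: nilp0.
Qed.

End AbsLocal.

(** * The splitting of an indecomposable under extension of scalars *)

(** The lift h of the residue field F is K-linear, because the lift of a scalar and
    the scalar itself are both fixed by Frobenius and agree modulo nilpotents. *)
Lemma indec_residue_over (Q : quiver) (K : finFieldType) n (I : rep Q (truncpoly K n.+1)) :
  indec I ->
  exists (F : finFieldType) (f : {rmorphism hom I I -> F}) (h : {rmorphism F -> hom I I})
     (k : {rmorphism K -> F}) (d : nat),
    [/\ forall u, f (h u) = u, forall x, f x = 0 <-> nilp x,
        forall c, h (k c) = qpolyC 'X^(n.+1) c *: idh I,
        #|F| = (#|K| ^ d)%N & kappa I = (#|K| ^ d)%N].
Proof.
move=> iI; have [F [f [h [hK fker]]]] := indec_residue (qpolyC 'X^(n.+1)) iI.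
pose s c : hom I I := qpolyC 'X^(n.+1) c *: idh I.
have sB : zmod_morphism s by move=> c d; rewrite /s rmorphB scalerBl.
have sM : monoid_morphism s.
  split=> [|c d]; first by rewrite /s rmorph1 scale1r.
  by rewrite /s endME compZl compZr scalerA -rmorphM comp1l.
pose m1 := GRing.isZmodMorphism.Build _ _ s sB.
pose m2 := GRing.isMonoidMorphism.Build _ _ s sM.
pose sm : {rmorphism K -> hom I I} := HB.pack s m1 m2.
pose k : {rmorphism K -> F} := f \o sm.
have [d cardF] := card_finField_ext k; exists F, f, h, k, d; split=> //; last first.
  by rewrite (kappa_residue iI hK fker).
move=> c; have [p [e [p_pr pK e0 cardK]]] := card_finField_pchar K.
have d0 := card_ext_pos cardF.
apply: (frobenius_fixed_eq p_pr (end_pchar (qpolyC 'X^(n.+1)) I pK) (e := (e * d)%N)).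
- by rewrite muln_gt0 e0.
- exact: scale_end_comm.
- by rewrite -rmorphXn expnM -cardK -cardF expf_card.
- rewrite -[qpolyC _ c *: _]/(sm c) -rmorphXn expnM -cardK; congr (sm _).
  exact: expf_card_exp.
- by apply/fker; rewrite rmorphB hK subrr.
Qed.

Section ResidueSplitting.
Context (Q : quiver) (K : finFieldType) (E : fieldType) (f : {rmorphism K -> E}) (n : nat).
Local Notation R := (truncpoly K n.+1).
Local Notation R' := (truncpoly E n.+1).
Local Notation phi := (@truncpoly_map n.+1 K E f : {rmorphism R -> R'}).
Local Notation cst := (qpolyC ('X^(n.+1) : {poly E})).

Lemma end_nilp_ideal (I : rep Q R) : local_ring (hom I I) ->
  exists N, forall s : seq (hom I I), size s = N -> (forall x, x \in s -> nilp x) ->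
    \prod_(x <- s) x = 0.
Proof. exact: (@nilp_ideal_nilpotent (hom I I)). Qed.

Lemma span_nilp_comp (I : rep Q R) (rho G : hom (ext phi I) (ext phi I)) :
  local_ring (hom I I) -> in_span (@nilp (hom I I)) rho ->
  in_span (@nilp (hom I I)) (comp G rho) /\ in_span (@nilp (hom I I)) (comp rho G).
Proof.
move=> loc nr; split.
  apply: in_span_comp nr (in_span_all G) => u v nu _; exact: local_nilpMl.
apply: in_span_comp (in_span_all G) nr => u v _ nv; exact: local_nilpMr.
Qed.

Lemma span_nilp_cut (I : rep Q R) Z rho (a : hom (ext phi I) Z) (b : hom Z (ext phi I)) :
  local_ring (hom I I) -> in_span (@nilp (hom I I)) rho -> nilp (comp a (comp rho b)).
Proof.
move=> loc nr; apply: comp_cycle_nilp; rewrite -compA.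
apply: (in_span_nilp (end_nilp_ideal loc)).
by have [] := span_nilp_comp (comp b a) loc nr.
Qed.

(** A common summand of ext I and ext J would factor its identity through
    composites I -> J -> I, which are nilpotent when I and J are not
    isomorphic. *)
Lemma ext_common_summand (I J : rep Q R) N (i : hom N (ext phi I)) (p : hom (ext phi I) N)
    (j : hom N (ext phi J)) (q : hom (ext phi J) N) : indec I -> indec J ->
  idh N <> 0 -> comp p i = idh N -> comp q j = idh N -> iso I J.
Proof.
move=> iI iJ N0 pi qj; apply: contrapT => nIJ; have loc := indec_local iI.
have nr : in_span (@nilp (hom I I)) (comp (comp i q) (comp j p)).
  apply: in_span_comp (in_span_all (comp j p)) (in_span_all (comp i q)) => u v _ _.
  case: (local_nilp_or loc (comp v u)) => // -[w [wvu _]].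
  case: nIJ; apply: (indec_split_mono_iso iJ iI.1 (u := u)).
  by exists (comp w v); rewrite -compA.
have := span_nilp_cut p i loc nr.
have -> : comp p (comp (comp (comp i q) (comp j p)) i) = idh N.
  by rewrite -!compA pi comp1r qj comp1r pi.
by move=> n1; apply: (nilp_invF (E := hom N N) (y := 1) N0 n1); rewrite mulr1.
Qed.

Context (I : rep Q R) (iI : indec I).
Context (F : finFieldType) (rs : {rmorphism hom I I -> F}) (h : {rmorphism F -> hom I I}).
Context (k : {rmorphism K -> F}) (d : nat).
Hypothesis hK : forall u, rs (h u) = u.
Hypothesis rs_ker : forall x, rs x = 0 <-> nilp x.
Hypothesis hk : forall c, h (k c) = qpolyC 'X^(n.+1) c *: idh I.
Hypothesis cardF : #|F| = (#|K| ^ d)%N.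
Let loc := indec_local iI.
Local Notation X := (ext phi I).
Implicit Types (G : hom X X) (t : {rmorphism F -> E}).

Lemma nilp_sub_lift g : nilp (g - h (rs g)).
Proof. by apply/rs_ker; rewrite rmorphB hK subrr. Qed.

(** The idempotent of E (x) F that projects to the factor E along t; up to sign it
    is the average of t(u)^-1 u over the units of F, whose number is -1 in F. *)
Definition etau t : hom X X := - \sum_(u : F | u != 0) cst (t u^-1) *: exth phi (h u).

Lemma exth_h_mul u v : comp (exth phi (h u)) (exth phi (h v)) = exth phi (h (u * v)).
Proof. by rewrite -exth_comp -endME -rmorphM. Qed.

Lemma etau_mull t v : comp (exth phi (h v)) (etau t) = cst (t v) *: etau t.
Proof.
have [->|v0] := eqVneq v 0; first by rewrite !rmorph0 exth0 comp0l scale0r.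
rewrite /etau compNr comp_sumr scalerN scaler_sumr; congr (- _).
rewrite (reindex_onto (fun u => v^-1 * u) (fun u => v * u)) /= => [|u _]; last first.
  by rewrite mulrA mulVf // mul1r.
apply: eq_big => [u|u _].
  by rewrite mulf_eq0 invr_eq0 (negbTE v0) /= mulrA divff // mul1r eqxx andbT.
rewrite compZr exth_h_mul mulrA divff // mul1r scalerA -rmorphM -rmorphM.
by rewrite invfM invrK mulrC.
Qed.

Lemma etau_mulr t v : comp (etau t) (exth phi (h v)) = cst (t v) *: etau t.
Proof.
transitivity (comp (exth phi (h v)) (etau t)); last exact: etau_mull.
rewrite /etau compNl compNr comp_suml comp_sumr.
apply: (congr1 (fun z => - z)); apply: eq_bigr => u _.
by rewrite compZl compZr !exth_h_mul mulrC.
Qed.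

Lemma etau_idem t : comp (etau t) (etau t) = etau t.
Proof.
rewrite {1}/etau compNl comp_suml.
under eq_bigr => u u0 do rewrite compZl etau_mull scalerA -rmorphM -rmorphM mulVf //.
by rewrite -scaler_suml -!rmorph_sum sum1_units !rmorphN !rmorph1 scaleN1r opprK.
Qed.

Lemma etau_orth t t' v : t v != t' v -> comp (etau t) (etau t') = 0.
Proof.
move=> tv; have : cst (t v - t' v) *: comp (etau t) (etau t') = 0.
  rewrite rmorphB scalerBl -compZl -etau_mulr -compA etau_mull compZr subrr //.
move=> e; rewrite -[LHS]scale1r -(rmorph1 cst) -(mulVf (x := t v - t' v)) ?subr_eq0 //.
by rewrite rmorphM -scalerA e scaler0.
Qed.

(** Modulo extensions of nilpotents, G is a combination of elements of F, and
    those act on the image of etau t through t. *)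
Lemma etau_scalar t G : exists c rho,
  in_span (@nilp (hom I I)) rho /\ comp (etau t) G = cst c *: etau t + rho.
Proof.
have [J [b [g [_ ->]]]] := in_span_all G.
exists (\sum_j b j * t (rs (g j))), (comp (etau t) (\sum_j cst (b j) *: exth phi (g j - h (rs (g j))))); split.
  apply: (span_nilp_comp _ loc _).1; exists J, b, (fun j => g j - h (rs (g j))); split=> // j.
  exact: nilp_sub_lift.
rewrite !comp_sumr rmorph_sum scaler_suml -big_split; apply: eq_bigr => j _ /=.
rewrite !compZr rmorphM -scalerA -etau_mulr -scalerDr -compDr.
by rewrite -exthD addrC subrK.
Qed.

(** The sum over the conjugates is - sum_u Tr(u^-1) u, the sum over j of
    - sum_u u^(1 - q^j), where the sum over u in F^* vanishes except for j = 0. *)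
Lemma etau_sum t : (forall c, t (k c) = f c) ->
  \sum_(j < d) etau (conj_embedding k t j) = idh X.
Proof.
move=> tk; pose Tr (u : F) := \sum_(j < d) u ^+ (#|K| ^ j).
have TrK u : Tr u ^+ #|K| = Tr u.
  have frobD := rmorph_sum (frobenius_over k 1); rewrite /= /frobenius_over expn1 in frobD.
  rewrite /Tr frobD; have d0 := card_ext_pos cardF.
  rewrite -(prednK d0) [LHS]big_ord_recr [RHS]big_ord_recl /= expn0 expr1 addrC -exprM -expnSr prednK // -cardF expf_card; congr (_ + _).
  by apply: eq_bigr => j _; rewrite -exprM -expnSr /bump /= ?add1n.
have TrE u : exists c, Tr u = k c by apply: frobenius_fixed_base; exact: TrK.
have step u : \sum_(j < d) cst (conj_embedding k t j u^-1) *: exth phi (h u) = exth phi (h (Tr u^-1 * u)).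
  rewrite -scaler_suml -rmorph_sum.
  have -> : \sum_(j < d) conj_embedding k t j u^-1 = t (Tr u^-1).
    by rewrite rmorph_sum; apply: eq_bigr => j _.
  have [c ->] := TrE u^-1; rewrite tk rmorphM hk endME compZl comp1l exthZ.
  by rewrite /= truncpoly_mapC.
rewrite /etau sumrN exchange_big /=; under eq_bigr => u _ do rewrite step.
rewrite -exth_sum -rmorph_sum -exthN -rmorphN.
suff -> : - \sum_(u : F | u != 0) Tr u^-1 * u = 1 by rewrite rmorph1 exth1.
under eq_bigr => u _ do rewrite mulr_suml.
rewrite exchange_big /= (bigD1 (Ordinal (card_ext_pos cardF))) //= [X in _ + X]big1 ?addr0.
  under eq_bigr => u u0 do rewrite expn0 expr1 mulVf //.
  apply/eqP; rewrite eqr_oppLR; apply/eqP.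
  exact: sum1_units.
move=> j j0; have [v vj] : exists v : F, v ^+ (#|K| ^ j) != v.
  apply: contrapT => nv; move/eqP: j0; apply; apply: val_inj => /=.
  apply: (frobenius_over_trivial cardF (ltn_ord j)) => x.
  by apply/eqP/negPn/negP => xj; apply: nv; exists x.
have v0 : v != 0.
  by apply: contraNneq vj => ->; rewrite expr0n expn_eq0 -leqn0 leqNgt ltnW ?finNzRing_gt1.
set S := \sum_(u | _) _; have SE : S = (v^-1 ^+ (#|K| ^ j) * v) * S.
  rewrite {1}/S (reindex_onto (fun u => v * u) (fun u => v^-1 * u)) /= => [|u _]; last first.
    by rewrite mulrA divff // mul1r.
  rewrite mulr_sumr; apply: eq_big => [u|u _].
    by rewrite mulf_eq0 (negbTE v0) /= mulrA mulVf // mul1r eqxx andbT.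
  by rewrite invfM exprMn mulrACA.
apply: contrapT => /eqP S0; have := mulIf S0 (etrans (mul1r S) SE).
rewrite exprVn => e; move/eqP: vj => []; apply/esym.
have vq0 : v ^+ (#|K| ^ j) != 0 by rewrite expf_neq0.
by apply: (mulfI (x := (v ^+ (#|K| ^ j))^-1)); rewrite ?invr_eq0 // -e mulVf.
Qed.

Section Factor.
Context (t : {rmorphism F -> E}) (N : rep Q R') (i : hom N X) (p : hom X N).
Hypotheses (pi : comp p i = idh N) (ip : comp i p = etau t).

Lemma factor_scalar (g : hom N N) : exists c, nilp (g - cst c *: idh N).
Proof.
have [c [rho [nr e]]] := etau_scalar t (comp i (comp g p)); exists c.
have -> : g - cst c *: idh N = comp p (comp rho i).
  have := congr1 (fun z => comp p (comp z i)) e.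
  rewrite -ip -!compA pi comp1r compDl compDr compZl compZr -compA pi comp1r pi.
  rewrite [comp p (comp i _)]compA pi comp1l [comp p (comp i g)]compA pi comp1l => ->.
  by rewrite addrC addKr.
exact: span_nilp_cut.
Qed.

End Factor.

(** For distinct t and t', a morphism from the image of one idempotent to that of the
    other comes from nilpotents, since the idempotents are orthogonal. *)
Lemma factor_iso_eq t t' N N' (i : hom N X) (p : hom X N) (i' : hom N' X) (p' : hom X N') :
  comp p i = idh N -> comp i p = etau t -> comp p' i' = idh N' -> comp i' p' = etau t' ->
  idh N <> 0 -> iso N N' -> t =1 t'.
Proof.
move=> pi ip pi' ip' N0 [u [v [vu uv]]] a; apply/eqP; apply: contrapT => /negP ta.
have tt' : comp (etau t') (etau t) = 0 by apply: (etau_orth (v := a)); rewrite eq_sym.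
have p'i : comp p' i = 0.
  have : comp (comp p' (comp (etau t') (etau t))) i = 0 by rewrite tt' comp0r comp0l.
  by rewrite -ip -ip' -!compA pi comp1r [comp p' (comp i' _)]compA pi' comp1l.
have [c [rho [nr e]]] := etau_scalar t' (comp i' (comp u p)).
have uE : u = comp p' (comp rho i).
  have := congr1 (fun z => comp p' (comp z i)) e.
  rewrite -ip' -!compA pi comp1r compDl compDr compZl compZr -compA p'i !comp0r scaler0 add0r.
  by rewrite [comp p' (comp i' _)]compA pi' comp1l [comp p' (comp i' _)]compA pi' comp1l.
have : nilp (comp v u).
  rewrite uE compA compA -compA; apply: comp_cycle_nilp.
  rewrite -compA; apply: (in_span_nilp (end_nilp_ideal loc)).
  by have [] := span_nilp_comp (comp i (comp v p')) loc nr.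
rewrite vu => n1; apply: (nilp_invF (E := hom N N) (y := 1) N0 n1); rewrite mulr1 //.
Qed.

(** An absolutely indecomposable summand N of ext I reads off a K-embedding of F
    in E: the action of F on N modulo nilpotents is multiplicative because every
    endomorphism of ext I is a combination of elements of F up to nilpotents. *)
Lemma summand_embedding N (i : hom N X) (p : hom X N) : abs_local N -> comp p i = idh N ->
  exists t : {rmorphism F -> E}, (forall c, t (k c) = f c) /\
    forall N' (i' : hom N' X) (p' : hom X N'),
      comp p' i' = idh N' -> comp i' p' = etau t -> abs_local N' -> iso N N'.
Proof.
move=> aN pi; have locN := abs_local_local aN; have [rN [rNP rNs]] := abs_local_residue aN.
have rNn g : nilp g -> rN g = 0.
  move=> ng; apply: (abs_local_scalar_uniq aN (rNP g)); rewrite rmorph0 scale0r subr0 //.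
have rNZ c g : rN (cst c *: g) = c * rN g.
  by rewrite -[in RHS](rNs c) -rmorphM endME compZl comp1l.
pose chi u := rN (comp p (comp (exth phi (h u)) i)).
have chiB : zmod_morphism chi.
  by move=> u v; rewrite /chi rmorphB exthD exthN compDl compNl compDr compNr rmorphB.
have [J [b [g [_ ipE]]]] := in_span_all (comp i p).
pose H w := \sum_j b j * chi (rs (g j) * w).
have HE u v : chi u * chi v = H (u * v).
  pose rho := \sum_j cst (b j) *: exth phi (g j - h (rs (g j))).
  have nr : in_span (@nilp (hom I I)) rho.
    by exists J, b, (fun j => g j - h (rs (g j))); split=> // j; exact: nilp_sub_lift.
  have ipE' : comp i p = \sum_j cst (b j) *: exth phi (h (rs (g j))) + rho.
    rewrite ipE -big_split; apply: eq_bigr => j _ /=.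
    by rewrite -scalerDr -exthD addrC subrK.
  rewrite /chi -rmorphM endME.
  have cc (x y : hom X X) : comp (comp p (comp x i)) (comp p (comp y i)) =
      comp p (comp (comp x (comp (comp i p) y)) i) by rewrite !compA.
  rewrite cc.
  rewrite ipE' compDl compDr compDl compDr rmorphD [X in _ + X]rNn ?addr0; last first.
    by apply: span_nilp_cut => //; apply: (span_nilp_comp _ loc _).1; apply: (span_nilp_comp _ loc _).2.
  rewrite comp_suml comp_sumr comp_suml comp_sumr rmorph_sum; apply: eq_bigr => j _.
  by rewrite compZl compZr compZl compZr rNZ !exth_h_mul (mulrCA u).
have chi1 : chi 1 = 1 by rewrite /chi rmorph1 exth1 comp1l pi rmorph1.
have chiM : monoid_morphism chi.
  by split=> // u v; have e := HE 1 (u * v); rewrite chi1 !mul1r in e; rewrite HE e.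
pose m1 := GRing.isZmodMorphism.Build _ _ chi chiB.
pose m2 := GRing.isMonoidMorphism.Build _ _ chi chiM.
pose t : {rmorphism F -> E} := HB.pack chi m1 m2.
have tE u : t u = chi u by [].
exists t; split=> [c|N' i' p' pi' ip' aN'].
  rewrite tE /chi hk exthZ compZl compZr /= truncpoly_mapC rNZ exth1 comp1l pi.
  by rewrite [rN _]rmorph1 mulr1.
apply: (indec_split_mono_iso (u := comp p' i) (abs_local_indec aN') aN.1).
have res1 : rN (comp (comp p i') (comp p' i)) = 1.
  rewrite -!compA [comp i' (comp p' i)]compA ip' /etau compNl compNr rmorphN.
  rewrite comp_suml comp_sumr rmorph_sum.
  under eq_bigr => u u0 do rewrite compZl compZr rNZ -[rN _]/(t u) -rmorphM mulVf //.
  by rewrite -rmorph_sum sum1_units rmorphN rmorph1 opprK.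
have [w [wu _]] : invertible (comp (comp p i') (comp p' i)).
  apply: (scale_plus_nilp (c := 1)); first exact: oner_neq0.
  by have := rNP (comp (comp p i') (comp p' i)); rewrite res1.
by exists (comp w (comp p i')); rewrite -compA.
Qed.

End ResidueSplitting.

(** * Indecomposability and idempotents *)

Section IndecomposableIdempotents.
Context (Q : quiver) (r : {ffun vertex Q -> nat}) (O : comUnitRingType) (x : lfrep r O).
Local Notation X := (to_rep x).

Lemma nonzero_predT : nonzero_family (fun i => predT : {pred 'cV[O]_(r i)}) <-> idh X <> 0.
Proof.
split=> [[i [v _ v0]] id0|/rank_total_gt0].
  move/eqP: v0; apply; have := congr1 (fun h : hom X X => h i *m v) id0.
  by rewrite !homE mul1mx mul0mx.
rewrite /rank_total lt0n sum_nat_eq0 negb_forall => /existsP[i /= ri].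
exists i, (const_mx 1) => //; apply/eqP => /colP; case: (r i) ri => // m _ /(_ ord0).
by rewrite !mxE => /eqP; rewrite oner_eq0.
Qed.

Lemma indecomposable_indec : indecomposable x -> indec X.
Proof.
case=> /nonzero_predT X0 ndec; split=> // e ee.
apply: contrapT => /not_orP[e0 e1]; apply: ndec.
have eeE i : e i *m e i = e i by have := congr1 (fun h : hom X X => h i) ee; rewrite homE.
have col0 (g : hom X X) : g <> 0 -> exists i (v : 'cV[O]_(r i)), g i *m v != 0.
  move=> g0; apply: contrapT => nex; apply: g0; apply: homP => i; rewrite homE.
  apply/matrixP => a b; have : g i *m delta_mx b 0 = 0 :> 'cV_(r i).
    by apply/eqP/negPn/negP => nz; apply: nex; exists i, (delta_mx b 0).
  by rewrite -colE => /colP/(_ a); rewrite !mxE.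
pose U i : {pred 'cV[O]_(r i)} := fun v => e i *m v == v.
pose W i : {pred 'cV[O]_(r i)} := fun v => e i *m v == 0.
have UE i v : (v \in U i) = (e i *m v == v) by [].
have WE i v : (v \in W i) = (e i *m v == 0) by [].
exists U, W; split.
- split=> [i|a v]; last by rewrite !UE => /eqP ev; rewrite mulmxA (hom_act e a) -mulmxA ev.
  split=> [|c u v]; rewrite !UE ?mulmx0 // => /eqP eu /eqP ev.
  by rewrite mulmxDr -scalemxAr eu ev.
- split=> [i|a v].
    split=> [|c u v]; rewrite !WE ?mulmx0 // => /eqP eu /eqP ev.
    by rewrite mulmxDr -scalemxAr eu ev scaler0 addr0.
  by rewrite !WE => /eqP ev; rewrite mulmxA (hom_act e a) -mulmxA ev mulmx0.
- have [i [v ev]] := col0 e e0; exists i, (e i *m v) => //.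
  by rewrite UE mulmxA eeE.
- have [|i [v ev]] := col0 (1 - e).
    by move/eqP; rewrite subr_eq0 eq_sym => /eqP.
  exists i, ((1 - e) i *m v) => //.
  by rewrite WE !homE mulmxA mulmxBr mulmx1 eeE subrr mul0mx.
- split=> [i v|i v]; last by rewrite UE WE => /eqP ev /eqP ev0; rewrite -ev ev0.
  exists (e i *m v), (v - e i *m v).
  rewrite UE WE mulmxA eeE mulmxBr mulmxA eeE subrr !eqxx.
  by rewrite addrC subrK.
Qed.

(** The projection to one summand along the other is an idempotent endomorphism,
    whose matrices are built column by column. *)
Lemma indec_indecomposable : indec X -> indecomposable x.
Proof.
case=> X0 idem; split; first exact/nonzero_predT.
case=> U [W [[Usub Uact] [Wsub Wact] [i0 [u0 u0U u0nz]] [i1 [w0 w0W w0nz]] [dec cap]]].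
have U0 i : 0 \in U i by case: (Usub i).
have W0 i : 0 \in W i by case: (Wsub i).
have UD i c u v : u \in U i -> v \in U i -> c *: u + v \in U i by case: (Usub i) => _; apply.
have WD i c u v : u \in W i -> v \in W i -> c *: u + v \in W i by case: (Wsub i) => _; apply.
have ex i v : exists u, u \in U i /\ v - u \in W i.
  by have [u [w [uU wW ->]]] := dec i v; exists u; rewrite addrC addKr.
pose P i : 'M[O]_(r i) := \matrix_(a, b) (sval (cid (ex i (delta_mx b 0)))) a 0.
have PU i b : P i *m delta_mx b 0 \in U i /\ delta_mx b 0 - P i *m delta_mx b 0 \in W i.
  have -> : P i *m delta_mx b 0 = sval (cid (ex i (delta_mx b 0))).
    by rewrite -colE; apply/colP => a; rewrite !mxE.
  exact: svalP (cid (ex i (delta_mx b 0))).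
have sumU i (V : {pred 'cV[O]_(r i)}) (g : 'I_(r i) -> 'cV[O]_(r i)) (c : 'I_(r i) -> O) :
    0 \in V -> (forall a u v, u \in V -> v \in V -> a *: u + v \in V) ->
    (forall b, g b \in V) -> \sum_b c b *: g b \in V.
  move=> V0 VD gV; elim: (index_enum _) => [|b s IH]; first by rewrite big_nil.
  by rewrite big_cons; apply: VD.
have vE i (v : 'cV[O]_(r i)) : v = \sum_b v b 0 *: delta_mx b 0.
  by rewrite {1}[v]matrix_sum_delta; apply: eq_bigr => b _; rewrite big_ord1.
have PvU i v : P i *m v \in U i.
  rewrite {1}[v]vE mulmx_sumr; under eq_bigr => b _ do rewrite -scalemxAr.
  by apply: sumU => [//|a u w|b]; [exact: UD|exact: (PU i b).1].
have PvW i v : v - P i *m v \in W i.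
  have -> : v - P i *m v = \sum_b v b 0 *: (delta_mx b 0 - P i *m delta_mx b 0).
    rewrite {1 2}[v]vE mulmx_sumr -sumrB; apply: eq_bigr => b _.
    by rewrite scalerBr -scalemxAr.
  by apply: sumU => [//|a u w|b]; [exact: WD|exact: (PU i b).2].
have NW i w : w \in W i -> - w \in W i.
  by move=> wW; rewrite -[- w]addr0 -scaleN1r; apply: WD (W0 i).
have uniq i u v : u \in U i -> v - u \in W i -> P i *m v = u.
  move=> uU vuW; apply/eqP; rewrite -subr_eq0; apply/eqP; apply: (cap i).
    by rewrite -[- u]scaleN1r addrC; apply: UD => //; exact: PvU.
  have -> : P i *m v - u = -1 *: (v - P i *m v) + (v - u).
    by rewrite scaleN1r opprB addrA subrK.
  by apply: WD vuW; exact: PvW.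
have Phom a : P (tgt a) *m act X a = act X a *m P (src a).
  apply/matrixP => b c.
  have /colP/(_ b) : (P (tgt a) *m act X a) *m delta_mx c 0 = (act X a *m P (src a)) *m delta_mx c 0 :> 'cV_(r (tgt a)).
    rewrite -!mulmxA; apply: uniq; first by apply: Uact; exact: PvU.
    by rewrite -mulmxBr; apply: Wact; exact: PvW.
  by rewrite -!colE !mxE.
pose e : hom X X := @mkhom Q O X X P Phom.
have eE i : e i = P i by rewrite mkhomE.
have PP i u : u \in U i -> P i *m u = u by move=> uU; apply: uniq => //; rewrite subrr; apply: W0.
have P0 i w : w \in W i -> P i *m w = 0 by move=> wW; apply: uniq; [exact: U0|rewrite subr0].
case: (idem e).
- apply: homP => i; rewrite homE eE; apply/matrixP => b c.
  by have := PP i _ (PvU i (delta_mx c 0)); rewrite mulmxA -!colE => /colP/(_ b); rewrite !mxE.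
- move=> e0; move/eqP: u0nz; apply; rewrite -(PP _ _ u0U) -eE e0 homE mul0mx //.
- move=> e1; move/eqP: w0nz; apply.
  have := P0 _ _ w0W; rewrite -eE e1 end1E homE mul1mx => -> //.
Qed.

End IndecomposableIdempotents.

(** Otherwise all of them are 0, and so is their sum. *)
Lemma sum_idempotents_eq1 (A : pzRingType) (J : finType) (e : J -> A) :
  (1 : A) <> 0 -> (forall x : A, x * x = x -> x = 0 \/ x = 1) ->
  (forall j, e j * e j = e j) -> \sum_j e j = 1 -> exists j, e j = 1.
Proof.
move=> A0 idem ee sum1; apply: contrapT => ne; apply: A0; rewrite -sum1 big1 // => j _.
by case: (idem _ (ee j)) => // e1; case: ne; exists j.
Qed.

Section AbsIndecomposable.
Context (Q : quiver) (K : finFieldType) (n : nat) (E : fieldType) (f : {rmorphism K -> E}).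
Local Notation R := (truncpoly K n.+1).
Local Notation R' := (truncpoly E n.+1).
Local Notation phi := (@truncpoly_map n.+1 K E f : {rmorphism R -> R'}).
Local Notation cst := (qpolyC ('X^(n.+1) : {poly E})).
Implicit Types X Y : rep Q R.

Lemma truncpoly_map_inj : injective phi.
Proof.
move=> p q e; apply/truncpoly_inj => i _; apply: (fmorph_inj f).
by rewrite -!coef_truncpoly_map e.
Qed.

Lemma exth_inj X Y : injective (@exth Q R R' phi X Y).
Proof.
move=> g h e; apply: homP => i; have := congr1 (fun z : hom _ _ => z i) e; rewrite !exthE.
by move/matrixP => ee; apply/matrixP => a b; apply: truncpoly_map_inj; have := ee a b; rewrite !mxE.
Qed.

Lemma ext_neq0 X : idh X <> 0 -> idh (ext phi X) <> 0.
Proof. by move=> X0 e; apply: X0; apply: exth_inj; rewrite exth1 exth0. Qed.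

(** Every endomorphism of ext X is a combination of extensions of endomorphisms of X,
    which are scalars up to nilpotents. *)
Lemma abs_local_ext X : abs_local X -> abs_local (ext phi X).
Proof.
move=> aX; split=> [|e]; first exact: ext_neq0 aX.1.
have locX := abs_local_local aX; have [rX [rXP _]] := abs_local_residue aX.
have [J [b [g [_ eE]]]] := in_span_all e.
exists (\sum_j b j * f (rX (g j))).
have -> : e - cst (\sum_j b j * f (rX (g j))) *: idh _ =
    \sum_j cst (b j) *: exth phi (g j - qpolyC 'X^(n.+1) (rX (g j)) *: idh X).
  rewrite eE rmorph_sum scaler_suml -sumrB; apply: eq_bigr => j _.
  by rewrite exthD exthN exthZ exth1 scalerBr rmorphM -scalerA /= truncpoly_mapC.
apply: (in_span_nilp (end_nilp_ideal locX)).
by exists J, b, (fun j => g j - qpolyC 'X^(n.+1) (rX (g j)) *: idh X); split=> // j; exact: rXP.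
Qed.

Lemma ext_indec X : indec (ext phi X) -> indec X.
Proof.
case=> X0 idem; split=> [e0|e ee]; first by apply: X0; rewrite -exth1 e0 exth0.
have : exth phi e * exth phi e = exth phi e by rewrite endME -exth_comp -endME ee.
case/idem => h; [left|right]; apply: exth_inj; first by rewrite h exth0.
by rewrite h end1E exth1.
Qed.

Lemma exth_scalar X (g : hom X X) (c : E) : idh X <> 0 -> exth phi g = cst c *: idh (ext phi X) ->
  exists a : K, g = qpolyC 'X^(n.+1) a *: idh X.
Proof.
move=> /rank_total_gt0; rewrite /rank_total lt0n sum_nat_eq0 negb_forall.
case/existsP => i /=; rewrite -lt0n => Xi e; pose o := Ordinal Xi.
have cE : c = f ((g i o o : {poly K})`_0).
  have := congr1 (fun z : hom (ext phi X) (ext phi X) => z i o o) e.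
  rewrite exthE !homE !mxE eqxx mulr1 => /(congr1 (fun z : R' => (z : {poly E})`_0)).
  by rewrite coef_truncpoly_map coef_qpolyC.
exists ((g i o o : {poly K})`_0); apply: (@exth_inj X X).
by rewrite exthZ exth1 /= truncpoly_mapC -cE e.
Qed.

(** When every non-constant polynomial over K has a root in E, the residue field F of
    the endomorphism ring embeds in E, and one of the orthogonal idempotents attached to the
    embeddings must be 1; hence F acts on ext X by scalars and so equals K. *)
Lemma ext_indec_abs_local X :
  (forall P : {poly K}, (1 < size P)%N -> exists z, root (map_poly f P) z) ->
  indec (ext phi X) -> abs_local X.
Proof.
move=> split_f iE; have iX := ext_indec iE.
have [F [rs [h [k [d [hK rs_ker hk cardF _]]]]]] := indec_residue_over iX.
have [t tk] : exists t : {rmorphism F -> E}, forall c, t (k c) = f c.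
  by apply: (finField_embedding k cardF) => P _; apply: split_f.
have [j ej] := sum_idempotents_eq1 iE.1 iE.2
  (fun j : 'I_d => etau_idem f h (conj_embedding k t j)) (etau_sum hk cardF tk).
split=> [|g]; first exact: iX.1.
have [|c hc] := @exth_scalar X (h (rs g)) (conj_embedding k t j (rs g)) iX.1.
  have := etau_mull f h (conj_embedding k t j) (rs g).
  by rewrite ej end1E comp1r.
by exists c; rewrite -hc; apply/rs_ker; rewrite rmorphB hK subrr.
Qed.

End AbsIndecomposable.

Lemma abs_indecomposable_local (Q : quiver) (K : finFieldType) (n : nat)
    (r : {ffun vertex Q -> nat}) (x : lfrep r (truncpoly K n.+1)) :
  abs_indecomposable x <-> abs_local (to_rep x).
Proof.
set f := @to_closure K.
have extE : to_rep (base_change f x) =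
    ext (@truncpoly_map n.+1 K _ f : {rmorphism truncpoly K n.+1 -> truncpoly _ n.+1}) (to_rep x).
  by rewrite /to_rep /ext /=; congr Rep; apply: functional_extensionality_dep => a; rewrite ffunE.
split=> [/indecomposable_indec|ax].
  rewrite extE; apply: ext_indec_abs_local => P szP; apply/closed_rootP.
  by rewrite size_map_poly eq_sym; case: (size P) szP => [|[]].
by apply: indec_indecomposable; rewrite extE; apply/abs_local_indec/abs_local_ext.
Qed.

(** * The summands of the extension of an indecomposable to a finite field *)

Section IdempotentRanks.
Context (k : fieldType) (n : nat).

Lemma mxrank_split r (B : 'M[k]_(n, r)) (C : 'M[k]_(r, n)) :
  C *m B = 1%:M -> \rank (B *m C) = r.
Proof.
move=> CB; apply/eqP; rewrite eqn_leq mulmx_max_rank /= -{1}(mxrank1 k r) -CB.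
have -> : C *m B = C *m (B *m C) *m B by rewrite mulmxA CB mul1mx CB.
by apply: leq_trans (mxrankM_maxl _ _) (mxrankM_maxr _ _).
Qed.

(** The row spaces are independent and contained in that of a + b. *)
Lemma mxrank_orthogonal_idempotents (a b : 'M[k]_n) :
  a *m a = a -> b *m b = b -> a *m b = 0 -> b *m a = 0 ->
  \rank (a + b)%R = (\rank a + \rank b)%N.
Proof.
move=> aa bb ab ba; apply/eqP; rewrite eqn_leq mxrank_add /=.
rewrite -mxrank_disjoint_sum; last first.
  apply/eqP; rewrite -submx0; apply/rV_subP => v; rewrite sub_capmx => /andP[/submxP[x vx] /submxP[y vy]].
  have va : v *m a = v by rewrite vx -mulmxA aa.
  have vb : v *m b = v by rewrite vy -mulmxA bb.
  by rewrite -vb -va -mulmxA ab mulmx0 sub0mx.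
apply: mxrankS; rewrite addsmx_sub; apply/andP; split; apply/submxP.
  by exists a; rewrite mulmxDr aa ab addr0.
by exists b; rewrite mulmxDr bb ba add0r.
Qed.

Lemma mxrank_sum_idempotents (J : eqType) (s : seq J) (e : J -> 'M[k]_n) : uniq s ->
  (forall j, e j *m e j = e j) -> (forall i j, i != j -> e i *m e j = 0) ->
  \rank (\sum_(j <- s) e j)%R = (\sum_(j <- s) \rank (e j))%N.
Proof.
move=> + ee eo; elim: s => [_|j s IH /= /andP[js us]]; first by rewrite !big_nil mxrank0.
have jo i : i \in s -> j != i by move=> si; apply: contraNneq js => ->.
rewrite !big_cons -(IH us); apply: mxrank_orthogonal_idempotents => //.
- rewrite mulmx_sumr [LHS]big_seq [RHS]big_seq; apply: eq_bigr => i si.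
  rewrite mulmx_suml (bigD1_seq i) //= ee big1 ?addr0 // => l li; exact: eo.
- by rewrite mulmx_sumr big_seq big1 // => i si; apply/eo/jo.
- by rewrite mulmx_suml big_seq big1 // => i si; apply: eo; rewrite eq_sym jo.
Qed.

End IdempotentRanks.

Lemma hom_sumE (Q : quiver) (R : comNzRingType) (X Y : rep Q R) (J : Type) (s : seq J)
    (P : pred J) (g : J -> hom X Y) v :
  (\sum_(j <- s | P j) g j) v = \sum_(j <- s | P j) g j v.
Proof.
by apply: (big_morph (fun g : hom X Y => g v)) => [a b|]; rewrite homE.
Qed.

Section ExtFactors.
Context (Q : quiver) (K L : finFieldType) (f : {rmorphism K -> L}) (n : nat).
Local Notation R := (truncpoly K n.+1).
Local Notation R' := (truncpoly L n.+1).
Local Notation phi := (@truncpoly_map n.+1 K L f : {rmorphism R -> R'}).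
Local Notation cst := (qpolyC ('X^(n.+1) : {poly L})).
Local Notation res := (@truncpoly_res L n : {rmorphism R' -> L}).

(** The j-th power of Frobenius acting on coefficients; it fixes the image of R and
    therefore permutes the idempotents etau. *)
Definition sigma (j : nat) : {rmorphism R' -> R'} :=
  @truncpoly_map n.+1 L L (frobenius_over f j : {rmorphism L -> L}).

Lemma coef_sigma j p i : (sigma j p : {poly L})`_i = ((p : {poly L})`_i) ^+ (#|K| ^ j).
Proof. by rewrite [sigma j p]/(truncpoly_map _ p) coef_truncpoly_map. Qed.

Lemma sigma_phi j p : sigma j (phi p) = phi p.
Proof.
apply/truncpoly_inj => i _; rewrite coef_sigma coef_truncpoly_map.
by rewrite -(frobenius_overE f) frobenius_over_base.
Qed.

Lemma sigma_cst j c : sigma j (cst c) = cst (c ^+ (#|K| ^ j)).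
Proof. by rewrite [LHS]truncpoly_mapC. Qed.

Lemma res_sigma j p : res (sigma j p) = frobenius_over f j (res p).
Proof. by rewrite /= /truncpoly_res coef_sigma. Qed.

Context (I : rep Q R) (iI : indec I).
Context (F : finFieldType) (h : {rmorphism F -> hom I I}).
Context (k : {rmorphism K -> F}) (d : nat) (t : {rmorphism F -> L}).
Hypothesis hk : forall c, h (k c) = qpolyC 'X^(n.+1) c *: idh I.
Hypothesis cardF : #|F| = (#|K| ^ d)%N.
Hypothesis tk : forall c, t (k c) = f c.
Local Notation X := (ext phi I).

Lemma etauE (s : {rmorphism F -> L}) v :
  etau f h s v = - \sum_(u : F | u != 0) cst (s u^-1) *: map_mx phi (h u v).
Proof.
rewrite /etau homNE hom_sumE; apply: (congr1 (fun z => - z)); apply: eq_bigr => u _.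
by rewrite homZE exthE.
Qed.

Lemma etau_ext (s s' : {rmorphism F -> L}) : s =1 s' -> etau f h s = etau f h s'.
Proof. by move=> ss; rewrite /etau; under eq_bigr => u _ do rewrite ss. Qed.

Lemma etau_conj j v :
  etau f h (conj_embedding k t j) v = map_mx (sigma j) (etau f h t v).
Proof.
rewrite !etauE map_mxN map_mx_sum; apply: (congr1 (fun z => - z)); apply: eq_bigr => u _.
rewrite conj_embeddingE map_mxZ sigma_cst; congr (_ *: _).
by apply/matrixP => a b; rewrite [RHS]mxE [in RHS]mxE [in LHS]mxE sigma_phi.
Qed.

Lemma rk_factor v N (i : hom N X) (p : hom X N) (t' : {rmorphism F -> L}) :
  comp p i = idh N -> comp i p = etau f h t' ->
  rk N v = \rank (map_mx res (etau f h t' v)).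
Proof.
move=> pi ip; have := congr1 (fun z : hom N N => map_mx res (z v)) pi.
rewrite compE idhE map_mxM map_mx1 => /mxrank_split e.
by rewrite -ip compE map_mxM; exact: esym e.
Qed.

Lemma rank_etau_conj v j : \rank (map_mx res (etau f h (conj_embedding k t j) v)) =
  \rank (map_mx res (etau f h t v)).
Proof.
rewrite etau_conj; move: (etau f h t v) => A.
have -> : map_mx res (map_mx (sigma j) A) = map_mx (frobenius_over f j) (map_mx res A).
  by apply/matrixP => a b; rewrite 4!mxE res_sigma.
exact: mxrank_map.
Qed.

(** The d conjugate idempotents are orthogonal with sum 1 and have equal ranks. *)
Lemma rank_etau v : (d * \rank (map_mx res (etau f h t v)))%N = rk I v.
Proof.
have := congr1 (fun z : hom X X => map_mx res (z v)) (etau_sum hk cardF tk).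
rewrite hom_sumE map_mx_sum idhE map_mx1 => /(congr1 (fun A => \rank A)); rewrite mxrank1.
rewrite mxrank_sum_idempotents ?index_enum_uniq //.
- by under eq_bigr => j _ do rewrite rank_etau_conj; rewrite sum_nat_const card_ord.
- by move=> j; rewrite -map_mxM -compE etau_idem.
- move=> i j ij; rewrite -map_mxM -compE.
  have [u tu] : exists u, conj_embedding k t i u != conj_embedding k t j u.
    apply: contrapT => ne; move/eqP: ij; apply.
    apply: (conj_embedding_inj (f := k) (h0 := t) cardF) => u.
    by apply/eqP/negPn/negP => nu; apply: ne; exists u.
  by rewrite (etau_orth f h tu) homE map_mx0.
Qed.

End ExtFactors.

(** The absolutely indecomposable summands of ext I correspond to the K-embeddings of
    its residue field F in L. When d divides m these are the d conjugates of one
    embedding, and the images of the d idempotents have equal ranks because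
    Frobenius permutes the idempotents. *)
Lemma ext_factors (Q : quiver) (K L : finFieldType) (f : {rmorphism K -> L}) (n m : nat)
    (I : rep Q (truncpoly K n.+1)) : #|L| = (#|K| ^ m)%N -> indec I ->
  let X := ext (@truncpoly_map n.+1 K L f : {rmorphism truncpoly K n.+1 -> truncpoly L n.+1}) I in
  exists d, [/\ kappa I = (#|K| ^ d)%N,
    forall N (i : hom N X), abs_local N -> split_mono i -> (d %| m)%N &
    (d %| m)%N -> exists N : 'I_d -> rep Q (truncpoly L n.+1),
      [/\ forall j, abs_local (N j), forall j v, (d * rk (N j) v)%N = rk I v,
          forall j, exists i : hom (N j) X, split_mono i,
          forall i j, iso (N i) (N j) -> i = j &
          forall N' (i : hom N' X), abs_local N' -> split_mono i -> exists j, iso N' (N j)]].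
Proof.
move=> cardL iI X; have [F [rs [h [k [d [hK rs_ker hk cardF kap]]]]]] := indec_residue_over iI.
have d0 := card_ext_pos cardF; exists d; split=> // [N i aN [p pi]|/dvdnP[e em]].
  have [t [tk _]] := summand_embedding iI hK rs_ker hk aN pi.
  exact: (embedding_degree_dvd t cardF cardL).
have [t tk] : exists t : {rmorphism F -> L}, forall c, t (k c) = f c.
  by apply: (finField_embedding_finite k f cardF (k := e)); rewrite cardL em mulnC expnM -cardF.
have split_e (s : {rmorphism F -> L}) : exists N (i : hom N X) (p : hom X N),
    comp p i = idh N /\ comp i p = etau f h s.
  by apply: (idempotent_split (truncpoly_coefficient_ring L n)); exact: etau_idem.
have /choice[W WP] : forall j : 'I_d, exists W : {N : rep Q (truncpoly L n.+1) & (hom N X * hom X N)%type},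
    comp (tagged W).2 (tagged W).1 = idh (tag W) /\
    comp (tagged W).1 (tagged W).2 = etau f h (conj_embedding k t j).
  move=> j; have [N [i [p ipe]]] := split_e (conj_embedding k t j).
  by exists (existT _ N (i, p)).
pose N j := tag (W j); pose ip j : hom (N j) X * hom X (N j) := tagged (W j).
have ipP j : comp (ip j).2 (ip j).1 = idh (N j) /\
    comp (ip j).1 (ip j).2 = etau f h (conj_embedding k t j) := WP j.
have rkN j v : (d * rk (N j) v)%N = rk I v.
  by rewrite (rk_factor v (ipP j).1 (ipP j).2) rank_etau_conj (rank_etau hk cardF tk).
have aN j : abs_local (N j).
  split=> [/eqP|g]; last exact: (factor_scalar iI hK rs_ker (ipP j).1 (ipP j).2).
  move=> N0; have := (rank_total_gt0 I).1 iI.1; rewrite /rank_total.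
  under eq_bigr => v _ do rewrite -(rkN j v); rewrite -big_distrr muln_gt0 => /andP[_].
  by move/(rank_total_gt0 (N j)).2 => []; apply/eqP.
exists N; split=> //.
- by move=> j; exists (ip j).1, (ip j).2; exact: (ipP j).1.
- move=> i j ij; apply: (conj_embedding_inj (f := k) (h0 := t) cardF).
  exact: (factor_iso_eq iI hK rs_ker (ipP i).1 (ipP i).2 (ipP j).1 (ipP j).2 (aN i).1 ij).
- move=> N' i' aN' [p' p'i']; have [t' [tk' isoN]] := summand_embedding iI hK rs_ker hk aN' p'i'.
  have [j tj] := embedding_conj cardF tk tk'; exists j; apply: isoN (aN j); first exact: (ipP j).1.
  by rewrite (ipP j).2; apply: etau_ext => u; rewrite tj.
Qed.

(** * Every absolutely indecomposable is a summand of an extension *)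

(** A basis b of L over K and its dual basis c for the trace form. The element
    sum b_i (x) c_i of L (x)_K L splits the multiplication map, and W z is the matrix of the
    multiplication by z in the basis b. *)
Lemma finField_dual_bases (K L : finFieldType) (f : {rmorphism K -> L}) m :
  #|L| = (#|K| ^ m)%N ->
  exists (b c : 'I_m -> L) (W : L -> 'I_m -> 'I_m -> K),
    [/\ \sum_i b i * c i = 1, forall z j, \sum_i f (W z i j) * b i = z * b j &
        forall z i, \sum_j f (W z i j) * c j = z * c i].
Proof.
move=> cardL; have m0 := card_ext_pos cardL; have [th _ thgen] := finField_generator L.
pose U := Vandermonde m (\row_(k < m) th ^+ (#|K| ^ k)); pose b (i : 'I_m) := th ^+ i.
have UE i k : U i k = b i ^+ (#|K| ^ k) by rewrite !mxE /b -!exprM mulnC.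
have Uunit : U \in unitmx.
  rewrite unitmxE det_Vandermonde unitfE; apply/prodf_neq0 => i _; apply/prodf_neq0 => j ij.
  rewrite !mxE subr_eq0; apply/negP => /eqP/(frobenius_conj_inj f cardL thgen) e.
  by rewrite e ltnn in ij.
clearbody U.
have frob k (a : 'I_m -> K) (y : L) : \sum_i f (a i) * b i = y ->
    \sum_i f (a i) * U i k = y ^+ (#|K| ^ k).
  move=> <-; rewrite -(frobenius_overE f) rmorph_sum; apply: eq_bigr => i _.
  by rewrite rmorphM /= frobenius_over_base UE.
have /choice[co coP] : forall y : L, exists a : {ffun 'I_m -> K}, \sum_i f (a i) * b i = y.
  pose g (a : {ffun 'I_m -> K}) := \sum_i f (a i) * b i.
  have ginj : injective g.
    move=> a a' /esym eg; apply/ffunP => i; apply: (fmorph_inj f).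
    have : (\row_i f (a i)) *m U = (\row_i f (a' i)) *m U.
      apply/rowP => k; rewrite !mxE.
      under eq_bigr => l _ do rewrite mxE; under [RHS]eq_bigr => l _ do rewrite mxE.
      by rewrite (frob k _ _ (erefl (g a))) (frob k _ _ eg).
    move/(congr1 (fun A => A *m invmx U)); rewrite -!mulmxA mulmxV // !mulmx1.
    by move/rowP/(_ i); rewrite !mxE.
  move=> y; have /codomP[a ->] : y \in codom g; last by exists a.
  by apply: inj_card_onto ginj _ _; rewrite card_ffun card_ord -cardL.
pose C := invmx U; pose o := Ordinal m0.
exists b, (fun i => C o i), (fun z i j => co (z * b j) i); split.
- have <- : (C *m U) o o = 1 by rewrite mulVmx // mxE eqxx.
  rewrite mxE; apply: eq_bigr => i _.
  by rewrite UE expn0 expr1 mulrC.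
- by move=> z j; exact: coP.
move=> z i; pose A := \matrix_(j, i) f (co (z * b j) i).
have AU : A *m U = U *m diag_mx (\row_k z ^+ (#|K| ^ k)).
  apply/matrixP => j k; rewrite mul_mx_diag mxE; under eq_bigr => l _ do rewrite mxE.
  by rewrite (frob k _ _ (coP _)) exprMn !mxE UE mulrC.
have CA : C *m A = diag_mx (\row_k z ^+ (#|K| ^ k)) *m C.
  by rewrite -[A]mulmx1 -(mulmxV Uunit) [A *m _]mulmxA AU !mulmxA mulVmx // mul1mx.
have /matrixP/(_ o i) := CA; rewrite mul_diag_mx !mxE expn0 expr1 => <-.
by apply: eq_bigr => j _; rewrite mxE mulrC.
Qed.

Section DescentForm.
Context (Q : quiver) (K L : finFieldType) (f : {rmorphism K -> L}) (n m : nat).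
Hypothesis cardL : #|L| = (#|K| ^ m)%N.
Local Notation R := (truncpoly K n.+1).
Local Notation R' := (truncpoly L n.+1).
Local Notation phi := (@truncpoly_map n.+1 K L f : {rmorphism R -> R'}).
Local Notation cst := (qpolyC ('X^(n.+1) : {poly L})).

Lemma truncpoly_dual_bases :
  exists (b c : 'I_m -> R') (W : R' -> 'I_m -> 'I_m -> R),
    [/\ \sum_i b i * c i = 1, forall z j, \sum_i b i * phi (W z i j) = z * b j &
        forall z i, \sum_j phi (W z i j) * c j = z * c i].
Proof.
have [b [c [W [bc Wb Wc]]]] := finField_dual_bases f cardL.
pose W' (z : R') i j : R := in_qpoly 'X^(n.+1) (\poly_(l < n.+1) W (z : {poly L})`_l i j).
have W'E z i j l : (l <= n)%N -> (phi (W' z i j) : {poly L})`_l = f (W (z : {poly L})`_l i j).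
  by move=> ln; rewrite coef_truncpoly_map coef_in_qpoly // coef_poly ltnS ln.
have coef_sum (J : finType) (F : J -> R') l : (\sum_j F j : {poly L})`_l = \sum_j (F j : {poly L})`_l.
  by elim/big_rec2: _ => [|j x y _ <-]; rewrite ?coef0 // -coef_truncpolyD.
exists (fun i => cst (b i)), (fun i => cst (c i)), W'; split.
- by under eq_bigr => i _ do rewrite -rmorphM; rewrite -rmorph_sum bc rmorph1.
- move=> z j; apply/truncpoly_inj => l ln; rewrite coef_sum mulrC coef_truncpolyZ // mulrC -Wb.
  by apply: eq_bigr => i _; rewrite coef_truncpolyZ // W'E // mulrC.
- move=> z j; apply/truncpoly_inj => l ln; rewrite coef_sum mulrC coef_truncpolyZ // mulrC -Wc.
  by apply: eq_bigr => i _; rewrite mulrC coef_truncpolyZ // W'E // mulrC.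
Qed.

(** N is a summand of the extension of its own restriction of scalars M to K: the
    multiplication map p is split by the element sum b_i (x) c_i. *)
Lemma split_restriction (N : rep Q R') :
  exists (M : rep Q R) (i : hom N (ext phi M)), split_mono i.
Proof.
have [b [c [W [bc Wb Wc]]]] := truncpoly_dual_bases.
(* M has the basis consisting of the products of the basis of N with the b_i. *)
pose ix v : finType := ('I_(rk N v) * 'I_m)%type.
pose M : rep Q R := @Rep Q R (fun v => #|{: ix v}|) (fun a =>
  \matrix_(x, y) W (act N a (enum_val x).1 (enum_val y).1) (enum_val x).2 (enum_val y).2).
have sumix v (F : 'I_(rk N v) -> 'I_m -> R') :
    \sum_(x < #|{: ix v}|) F (enum_val x).1 (enum_val x).2 = \sum_a \sum_j F a j.
  by rewrite pair_bigA -(big_enum_val (fun z : ix v => F z.1 z.2)); apply: eq_bigl.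
pose p v : 'M[R']_(rk N v, rk (ext phi M) v) :=
  \matrix_(a, y) if (enum_val y).1 == a then b (enum_val y).2 else 0.
pose i v : 'M[R']_(rk (ext phi M) v, rk N v) :=
  \matrix_(x, a) if (enum_val x).1 == a then c (enum_val x).2 else 0.
have iP a : i (tgt a) *m act N a = act (ext phi M) a *m i (src a).
  apply/matrixP => x s; rewrite [LHS]mxE [RHS]mxE.
  rewrite (bigD1 (enum_val x).1) //= big1 ?addr0 => [|u /negbTE ux]; last first.
    by rewrite mxE eq_sym ux mul0r.
  rewrite mxE eqxx mulrC -Wc.
  pose G u j := phi (W (act N a (enum_val x).1 u) (enum_val x).2 j) * (if u == s then c j else 0).
  transitivity (\sum_(y < #|{: ix (src a)}|) G (enum_val y).1 (enum_val y).2).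
    rewrite (sumix (src a) G) /G (bigD1 s) //= [X in _ + X]big1 ?addr0 => [|u /negbTE us].
      by apply: eq_bigr => j _; rewrite eqxx.
    by rewrite big1 // => j _; rewrite us mulr0.
  by apply: eq_bigr => y _; rewrite !mxE.
have pP a : p (tgt a) *m act (ext phi M) a = act N a *m p (src a).
  apply/matrixP => s x; rewrite [LHS]mxE [RHS]mxE.
  rewrite [RHS](bigD1 (enum_val x).1) //= [X in _ + X]big1 ?addr0 => [|u /negbTE ux]; last first.
    by rewrite mxE eq_sym ux mulr0.
  rewrite mxE eqxx -Wb.
  pose G u j := (if u == s then b j else 0) * phi (W (act N a u (enum_val x).1) j (enum_val x).2).
  transitivity (\sum_(y < #|{: ix (tgt a)}|) G (enum_val y).1 (enum_val y).2).
    by apply: eq_bigr => y _; rewrite !mxE.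
  rewrite (sumix (tgt a) G) /G (bigD1 s) //= [X in _ + X]big1 ?addr0 => [|u /negbTE us].
    by apply: eq_bigr => j _; rewrite eqxx.
  by rewrite big1 // => j _; rewrite us mul0r.
exists M, (@mkhom Q R' N (ext phi M) i iP), (@mkhom Q R' (ext phi M) N p pP).
apply: homP => v; rewrite !homE; apply/matrixP => s s'; rewrite !mxE.
pose G u j := (if u == s then b j else 0) * (if u == s' then c j else 0).
transitivity (\sum_(y < #|{: ix v}|) G (enum_val y).1 (enum_val y).2).
  by apply: eq_bigr => y _; rewrite !mxE.
rewrite (sumix v G) /G (bigD1 s) //= [X in _ + X]big1 ?addr0 => [|u /negbTE us].
  rewrite eqxx; case: eqP => _; first exact: bc.
  by rewrite big1 // => j _; rewrite mulr0.
by rewrite big1 // => j _; rewrite us mul0r.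
Qed.

(** By locality, one of the indecomposable summands of a K-form M carries N. *)
Lemma abs_local_summand (N : rep Q R') : abs_local N ->
  exists I : rep Q R, indec I /\ exists i : hom N (ext phi I), split_mono i.
Proof.
move=> aN; have [M] := split_restriction N.
move: M; apply: (rep_ind_dsum (truncpoly_coefficient_ring K n) (P := fun M =>
  (exists i : hom N (ext phi M), split_mono i) -> exists I : rep Q R, indec I /\ exists i : hom N (ext phi I), split_mono i))
  => [X X0|X iX|X Y IX IY|X Y XY IX] [i [p pi]].
- by case: aN.1; rewrite -pi -[i]comp1l -exth1 X0 exth0 comp0l comp0r.
- by exists X; split=> //; exists i, p.
- move: i p pi; rewrite ext_dsum; move: IX IY; set A := ext phi X; set B := ext phi Y => IX IY i p pi.
  pose a := comp (comp p (inl A B)) (comp (prl A B) i).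
  have [na|[u [ua _]]] := local_nilp_or (abs_local_local aN) a; last first.
    by apply: IX; exists (comp (prl A B) i), (comp u (comp p (inl A B))); rewrite -compA.
  have [u [ua _]] := nilp_sub1_inv na; apply: IY.
  exists (comp (prr A B) i), (comp u (comp p (inr A B))); rewrite -compA -[RHS]ua endME.
  apply: (congr1 (comp u)); rewrite end1E -pi -[i in RHS](comp1l) -dsum_id compDl compDr /a !compA.
  by rewrite [RHS]addrAC subrr add0r.
- have [g [g' [g'g gg']]] := ext_iso phi XY; apply: IX; exists (comp g' i), (comp p g).
  by rewrite -compA [comp g _]compA gg' comp1l.
Qed.

End DescentForm.

(** * The number of absolutely indecomposable classes *)

Lemma abs_local_iso (Q : quiver) (E : fieldType) n (X Y : rep Q (truncpoly E n.+1)) :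
  iso X Y -> abs_local X -> abs_local Y.
Proof.
case=> f [g [gf fg]] [X0 scX]; split=> [Y0|e].
  by apply: X0; rewrite -gf -[f]comp1l Y0 comp0l comp0r.
have [c nc] := scX (comp g (comp e f)); exists c.
have -> : e - qpolyC 'X^(n.+1) c *: idh Y =
    comp (comp f (comp g (comp e f) - qpolyC 'X^(n.+1) c *: idh X)) g.
  rewrite compDr compDl compNr compNl compZr compZl comp1r fg !compA fg comp1l.
  by rewrite -compA fg comp1r.
by apply: comp_cycle_nilp; rewrite compA gf comp1l.
Qed.

Lemma hom_unitmx_inverse (Q : quiver) (O : comUnitRingType) (r : {ffun vertex Q -> nat})
    (x y : lfrep r O) (f : hom (to_rep x) (to_rep y)) :
  (forall i, (f i : 'M[O]_(r i)) \in unitmx) ->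
  exists g, comp g f = idh (to_rep x) /\ comp f g = idh (to_rep y).
Proof.
move=> fU; have fP a : f (tgt a) *m x a = y a *m f (src a) := hom_act f a.
have hP a : invmx (f (tgt a) : 'M_(r _)) *m y a = x a *m invmx (f (src a) : 'M_(r _)).
  by rewrite -[y a](mulmxK (fU (src a))) -(fP a) mulmxA mulKmx.
exists (@mkhom Q O (to_rep y) (to_rep x) (fun i => invmx (f i : 'M_(r i))) hP).
by split; apply: homP => i; rewrite compE idhE mkhomE; [exact: mulVmx (fU i)|exact: mulmxV (fU i)].
Qed.

Lemma isomorphic_iso (Q : quiver) (O : comUnitRingType) (r : {ffun vertex Q -> nat}) (x y : lfrep r O) :
  isomorphic x y <-> iso (to_rep x) (to_rep y).
Proof.
split=> [[g gP gU]|[f [g [gf fg]]]].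
  exists (@mkhom Q O (to_rep x) (to_rep y) g gP); apply: hom_unitmx_inverse => i.
  by rewrite mkhomE.
exists (fun i => f i) => [a|i]; first exact: (hom_act f a).
have e : f i *m g i = 1%:M by rewrite -compE fg idhE.
by case: (mulmx1_unit e).
Qed.

Definition abs_class (Q : quiver) (L : finFieldType) (n : nat) (r : {ffun vertex Q -> nat})
  (x : lfrep r (truncpoly L n.+1)) := is_class x && `[< abs_local (to_rep x) >].

Lemma nb_abs_indecomposable_class (Q : quiver) (L : finFieldType) (n : nat)
    (r : {ffun vertex Q -> nat}) :
  nb_abs_indecomposable r n.+1 L = #|[set x : lfrep r (truncpoly L n.+1) | abs_class x]|.
Proof.
pose cl (x : lfrep r (truncpoly L n.+1)) := [set y | `[< isomorphic x y >]].
have clP x y : cl x = cl y <-> iso (to_rep x) (to_rep y).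
  split=> [exy|xy]; last first.
    apply/setP => z; rewrite !inE; apply: asbool_equiv_eq; rewrite !isomorphic_iso.
    by split; apply: iso_trans => //; exact: iso_sym.
  have : y \in cl x by rewrite exy inE; apply/asboolP/isomorphic_iso/iso_refl.
  by rewrite inE => /asboolP/isomorphic_iso.
rewrite /nb_abs_indecomposable -(card_in_imset (f := cl)) => [|x y]; last first.
  by rewrite !inE => /andP[cx _] /andP[cy _] /clP; exact: class_inj.
apply: eq_card => A; apply/imsetP/imsetP => -[x]; rewrite inE.
  move=> /asboolP/abs_indecomposable_local ax ->; exists (canon x).
    rewrite inE /abs_class canon_class /=; apply/asboolP; exact: abs_local_iso (canon_iso x) ax.
  by apply/clP; exact: canon_iso.
move=> /andP[_ /asboolP ax] ->; exists x => //.
by rewrite inE; apply/asboolP/abs_indecomposable_local.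
Qed.

Lemma exp_mulrnE (J : finType) (r : {ffun J -> nat}) d v : (r *+ d) v = (r v * d)%N.
Proof. by elim: d => [|d IH]; rewrite ?mulr0n ?ffunE ?muln0 // mulrS ffunE IH mulnS. Qed.

Section CountByDescent.
Context (Q : quiver) (K L : finFieldType) (f : {rmorphism K -> L}) (n m : nat).
Hypothesis cardL : #|L| = (#|K| ^ m)%N.
Local Notation R := (truncpoly K n.+1).
Local Notation R' := (truncpoly L n.+1).
Local Notation phi := (@truncpoly_map n.+1 K L f : {rmorphism R -> R'}).

(** The degree over K of the residue field of the endomorphism ring. *)
Definition res_degree (I : rep Q R) : nat := trunc_log #|K| (kappa I).

Lemma res_degreeE I d : kappa I = (#|K| ^ d)%N -> res_degree I = d.
Proof. by move=> kI; rewrite /res_degree kI trunc_expnK // finNzRing_gt1. Qed.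

Definition is_summand (N X : rep Q R') := exists i : hom N X, split_mono i.

Lemma is_summand_iso N N' X : iso N N' -> is_summand N X -> is_summand N' X.
Proof.
case=> g [g' [g'g gg']] [i [p pi]]; exists (comp i g'), (comp g p).
by rewrite -compA [comp p _]compA pi comp1l.
Qed.

Lemma is_summand_isor N X X' : iso X X' -> is_summand N X -> is_summand N X'.
Proof.
case=> g [g' [g'g gg']] [i [p pi]]; exists (comp g i), (comp p g').
by rewrite -compA [comp g' _]compA g'g comp1l.
Qed.

(** The classes counted are those of the d factors of ext I, whose common rank is the
    rank of I divided by d. *)
Lemma card_summands (r s : {ffun vertex Q -> nat}) (I : lfrep s R) : indec (to_rep I) ->
  #|[set x : lfrep r R' | abs_class x && `[< is_summand (to_rep x) (ext phi (to_rep I)) >]]| =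
  if (res_degree (to_rep I) %| m)%N && (s == r *+ res_degree (to_rep I))
  then res_degree (to_rep I) else 0%N.
Proof.
move=> iI; have [d [kI dvd ex]] := ext_factors f cardL iI; rewrite (res_degreeE kI).
have d0 : (0 < d)%N.
  by rewrite lt0n; apply/eqP => d0; have := (card_end_kappa (qpolyC 'X^(n.+1)) iI).2; rewrite kI d0.
case: (boolP (_ && _)) => [/andP[dm /eqP sr]|nd]; last first.
  apply/eqP; rewrite cards_eq0 -subset0; apply/subsetP => x; rewrite inE => /andP[/andP[_ /asboolP ax] /asboolP[i si]].
  have dm := dvd _ i ax si; have [N [aN rkN iN Ninj Nall]] := ex dm.
  have [j /iso_rk e] := Nall _ i ax si; case/negP: nd; rewrite dm /=; apply/eqP/ffunP => v.
  by rewrite exp_mulrnE mulnC -[s v]/(rk (to_rep I) v) -(rkN j v) -e.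
have [N [aN rkN iN Ninj Nall]] := ex dm.
have /choice[x xP] : forall j, exists x : lfrep r R', is_class x /\ iso (N j) (to_rep x).
  move=> j; have [v|x cx ix] := @class_of_rep Q R' r (N j); last by exists x.
  by apply/eqP; rewrite -(eqn_pmul2l d0) rkN /= sr exp_mulrnE mulnC.
have xinj : injective x.
  move=> i j xij; apply: Ninj; apply: iso_trans (xP i).2 _; rewrite xij; exact/iso_sym/(xP j).2.
rewrite -[RHS]card_ord -(card_imset _ xinj); apply: eq_card => y; rewrite inE.
apply/andP/imsetP => [[/andP[cy /asboolP ay] /asboolP[i si]]|[j _ ->]].
  have [j yj] := Nall _ i ay si; exists j => //; apply: class_inj cy (xP j).1 _.
  exact: iso_trans yj (xP j).2.
have [cx ix] := xP j; rewrite /abs_class cx; split; apply/asboolP.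
  exact: abs_local_iso ix (aN j).
exact: is_summand_iso ix (iN j).
Qed.

(** Each absolutely indecomposable representation over L of rank r is a summand of
    the extension of exactly one indecomposable class over K. *)
Lemma nb_abs_indecomposable_descent N r : (0 < m)%N -> (mdegree r * m <= N)%N ->
  nb_abs_indecomposable r n.+1 L =
  (\sum_(c : exp_box (vertex Q) N) \sum_(I : lfrep (exp_of_box c) R | indec_class I)
    if (res_degree (to_rep I) %| m) && (exp_of_box c == (r *+ res_degree (to_rep I))%R)
    then res_degree (to_rep I) else 0)%N.
Proof.
move=> m0 rN; rewrite nb_abs_indecomposable_class.
pose S (c : exp_box (vertex Q) N) (I : lfrep (exp_of_box c) R) (x : lfrep r R') :=
  `[< is_summand (to_rep x) (ext phi (to_rep I)) >].
transitivity (\sum_(c : exp_box (vertex Q) N) \sum_(I : lfrep (exp_of_box c) R | indec_class I)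
    \sum_(x : lfrep r R' | abs_class x) S c I x)%N; last first.
  apply: eq_bigr => c _; apply: eq_bigr => I /andP[_ /asboolP iI].
  rewrite -(card_summands r iI) -sum1_card [RHS](eq_bigl (fun x => abs_class x && S c I x)).
    by rewrite [RHS]big_mkcondr; apply: eq_bigr => x _; case: (S c I x).
  by move=> x; rewrite inE.
under eq_bigr => c _ do rewrite exchange_big /=.
rewrite exchange_big /= -sum1_card [LHS](eq_bigl (@abs_class Q L n r)) => [|x]; last by rewrite inE.
apply: eq_bigr => x /andP[cx /asboolP ax].
have [I0 [iI0 sI0]] := abs_local_summand f cardL ax.
have [d [kI dvd ex]] := ext_factors f cardL iI0.
have [i si] := sI0; have dm := dvd _ i ax si; have [M [aM rkM iM Minj Mall]] := ex dm.
have [j /iso_rk rkj] := Mall _ i ax si.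
have rkI0 v : rk I0 v = (r *+ d) v.
  by rewrite -(rkM j) -rkj exp_mulrnE mulnC.
pose c0 := box_of_exp N (r *+ d).
have c0E : exp_of_box c0 = r *+ d.
  apply: box_of_expK => v; rewrite exp_mulrnE (leq_trans _ rN) //.
  by apply: leq_mul; [exact: leq_mdegree|exact: dvdn_leq].
have [v|I cI isoI] := @class_of_rep Q R (exp_of_box c0) I0; first by rewrite c0E.
have iI : indec (to_rep I) := indec_iso isoI iI0.
have uniq c (J : lfrep (exp_of_box c) R) : indec_class J -> S c J x -> iso (to_rep I) (to_rep J).
  move=> /andP[_ /asboolP iJ] /asboolP[j' [q' qj]].
  have [i' [p' pi']] := is_summand_isor (ext_iso phi isoI) sI0.
  exact: ext_common_summand iI iJ ax.1 pi' qj.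
rewrite (bigD1 c0) //= [X in (_ + X)%N]big1 ?addn0 => [|c cc0]; last first.
  rewrite big1 // => J cJ; case: (boolP (S c J x)) => // /(uniq c J cJ)/iso_to_rep_rank e.
  by case/eqP: cc0; apply: exp_of_box_inj.
rewrite (bigD1 I) /=; last by rewrite /indec_class cI; apply/asboolP.
rewrite [X in (_ + X)%N]big1 ?addn0 => [|J /andP[cJ JI]]; last first.
  case: (boolP (S c0 J x)) => // /(uniq c0 J cJ)/(class_inj cI (andP cJ).1) e.
  by rewrite e eqxx in JI.
by have -> : S c0 I x by apply/asboolP/(is_summand_isor (ext_iso phi isoI)).
Qed.

End CountByDescent.

Section LogarithmOfClasses.
Context (Q : quiver) (K : finFieldType) (n : nat) (L : nat -> finFieldType).
Hypothesis cardL : forall m, (0 < m)%N -> #|L m| = (#|K| ^ m)%N.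
Local Notation R := (truncpoly K n.+1).

(** The coefficients of the logarithm of the plethystic exponential of
    A / (1 - 1/q). *)
Definition abs_log (r : {ffun vertex Q -> nat}) : rat :=
  \sum_(0 <= k < (mdegree r).+1) k.+1%:R^-1 *
    (if [forall i, (k.+1 %| r i)%N] then
       (nb_abs_indecomposable [ffun i => (r i %/ k.+1)%N] n.+1 (L k.+1))%:R /
       (1 - (#|K| ^ k.+1)%:R^-1)
     else 0).

Lemma res_degree_props (I : rep Q R) : indec I ->
  [/\ (0 < res_degree I)%N, kappa I = (#|K| ^ res_degree I)%N &
      forall v, (res_degree I %| rk I v)%N].
Proof.
move=> iI; have [F [rs [h [k [d [_ _ _ cardF kI]]]]]] := indec_residue_over iI.
have d0 := card_ext_pos cardF; have [f] := finField_morphism (cardL d0).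
have [d' [kI' _ ex]] := ext_factors f (cardL d0) iI.
have dd' : d' = d by rewrite -(res_degreeE kI') -(res_degreeE kI).
rewrite (res_degreeE kI); split=> // v; rewrite dd' in ex.
have [N [_ /(_ (Ordinal d0) v) <- _ _ _]] := ex (dvdnn d).
exact: dvdn_mulr.
Qed.

Lemma mdegree_mulrn (r : {ffun vertex Q -> nat}) k : mdegree (r *+ k) = (mdegree r * k)%N.
Proof. by rewrite /mdegree big_distrl; apply: eq_bigr => i _; rewrite exp_mulrnE. Qed.

(** Let I be indecomposable of rank s with residue degree d. The term of index n of
    I on the left, which concerns r = n s, matches the term of index m = d n on the
    right: over the extension of degree m the d factors of I have rank s / d = r / m,
    they contribute with total weight d |r| / m = |s|, and q^-m = kappa^-n. *)
Lemma indec_log_abs N r : (mdegree r <= N)%N ->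
  @indec_log Q R N r = (mdegree r)%:R * abs_log r.
Proof.
move=> rN; have [r0|r0] := posnP (mdegree r).
  rewrite r0 mul0r /indec_log big1 // => c _; rewrite big1 // => I _; rewrite big_nat_cond big1 //.
  move=> k /andP[/andP[k0 _] /eqP e]; have := mdegree_mulrn (exp_of_box c) k; rewrite e r0.
  by move/esym/eqP; rewrite muln_eq0 -[k == _]leqn0 leqNgt k0 orbF => /eqP ->; rewrite mul0r.
pose T (c : exp_box (vertex Q) N) (I : lfrep (exp_of_box c) R) k : rat :=
  if [&& [forall i, (k.+1 %| r i)%N], (res_degree (to_rep I) %| k.+1)%N &
         exp_of_box c == [ffun i => (r i %/ k.+1)%N] *+ res_degree (to_rep I)]
  then (mdegree r)%:R / k.+1%:R * ((res_degree (to_rep I))%:R / (1 - (#|K| ^ k.+1)%:R^-1)) else 0.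
transitivity (\sum_(c : exp_box (vertex Q) N) \sum_(I : lfrep (exp_of_box c) R | indec_class I)
    \sum_(0 <= k < (mdegree r).+1) T c I k); last first.
  under eq_bigr => c _ do rewrite exchange_big /=.
  rewrite exchange_big /abs_log mulr_sumr; apply: eq_bigr => k _ /=.
  rewrite /T; case: forallP => [dvd|_]; last first.
    by rewrite !mulr0 big1 // => c _; rewrite big1.
  have cardLk : #|L k.+1| = (#|K| ^ k.+1)%N := cardL (ltn0Sn k).
  have [f] := finField_morphism cardLk.
  have rE : [ffun i => (r i %/ k.+1)%N] *+ k.+1 = r.
    by apply/ffunP => i; rewrite exp_mulrnE ffunE divnK.
  rewrite (@nb_abs_indecomposable_descent Q K (L k.+1) f n k.+1 cardLk N) //; last first.
    by rewrite -mdegree_mulrn rE.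
  rewrite [X in _ = _ * (_ * (X / _))]natr_sum [RHS]mulrA [X in _ = _ * X]mulr_suml [RHS]mulr_sumr; apply: eq_bigr => c _.
  rewrite [X in _ = _ * (X / _)]natr_sum [X in _ = _ * X]mulr_suml [RHS]mulr_sumr; apply: eq_bigr => I _ /=.
  by case: ifP => _ //; rewrite mul0r mulr0.
apply: eq_bigr => c _; apply: eq_bigr => I /andP[_ /asboolP iI].
have [] := res_degree_props iI; set d := res_degree _ => d0 kI dvd_d.
have c0 : (0 < mdegree (exp_of_box c))%N by rewrite -(rank_total_to_rep I); apply/rank_total_gt0/iI.1.
have [[k0 ck]|nk] := EM (exists k, exp_of_box c *+ k = r); last first.
  rewrite big1 => [|k /eqP ck]; last by case: nk; exists k.
  rewrite big1 // => k _; rewrite /T; case: and3P => // -[/forallP dvd /dvdnP[e ek] /eqP cE].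
  case: nk; exists e; apply/ffunP => i; rewrite cE !exp_mulrnE ffunE -mulnA -/d.
  by rewrite [(d * e)%N]mulnC -ek divnK.
have ck' : (mdegree (exp_of_box c) * k0)%N = mdegree r by rewrite -mdegree_mulrn ck.
have k00 : (0 < k0)%N by move: r0; rewrite -ck' muln_gt0 => /andP[].
have dk0 : (0 < d * k0)%N by rewrite muln_gt0 d0.
have k0N : (1 <= k0 < N.+1)%N by rewrite k00 ltnS (leq_trans _ rN) // -ck' leq_pmull.
have dc : (d <= mdegree (exp_of_box c))%N.
  apply: dvdn_leq => //; apply: dvdn_sum => i _; exact: dvd_d.
transitivity ((mdegree (exp_of_box c))%:R / (1 - kinv (to_rep I) ^+ k0)).
  rewrite -[RHS](_ : (\sum_(1 <= k < N.+1 | k == k0) (mdegree (exp_of_box c))%:R / (1 - kinv (to_rep I) ^+ k)) = _); last first.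
    by rewrite big_nat1_eq k0N.
  apply: eq_bigl => k; apply/eqP/eqP => [e|-> //].
  by apply/eqP; rewrite -(eqn_pmul2l c0) ck' -e mdegree_mulrn.
have TE k : T c I k = if k == (d * k0).-1 then (mdegree (exp_of_box c))%:R / (1 - kinv (to_rep I) ^+ k0) else 0.
  rewrite /T -/d; have -> : [&& [forall i, (k.+1 %| r i)%N], (d %| k.+1)%N &
      exp_of_box c == [ffun i => (r i %/ k.+1)%N] *+ d] = (k == (d * k0).-1).
    apply/and3P/eqP => [[/forallP dvd dk /eqP cE]|->]; last rewrite prednK //.
      have rE : [ffun i => (r i %/ k.+1)%N] *+ k.+1 = r.
        by apply/ffunP => i; rewrite exp_mulrnE ffunE divnK.
      have e1 := mdegree_mulrn [ffun i => (r i %/ k.+1)%N] k.+1.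
      have e2 := mdegree_mulrn [ffun i => (r i %/ k.+1)%N] d.
      rewrite rE in e1; rewrite -cE in e2.
      move: r0 ck'; rewrite e2 e1; set y := mdegree _ => y0 /eqP.
      by rewrite -mulnA eqn_pmul2l ?muln_gt0 ?(ltn_trans _ y0) // => [/eqP->|]; move: y0; rewrite muln_gt0 => /andP[].
    have dvd i : (d * k0 %| r i)%N by rewrite -ck exp_mulrnE dvdn_mul // dvd_d.
    split; [exact/forallP|exact: dvdn_mulr|apply/eqP/ffunP => i].
    rewrite exp_mulrnE ffunE -ck exp_mulrnE divnMr // divnK //; exact: dvd_d.
  case: eqP => // ->; rewrite prednK // /kinv kI -ck' !natrM.
  rewrite expnM natrX -exprVn.
  rewrite mulrA; congr (_ / _); rewrite invfM.
  have h0 : d%:R != 0 :> rat by rewrite pnatr_eq0 -lt0n.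
  have h1 : k0%:R != 0 :> rat by rewrite pnatr_eq0 -lt0n.
  by field; rewrite h0 h1.
under [RHS]eq_bigr => k _ do rewrite TE.
rewrite -big_mkcond big_nat1_eq ifT //=.
by rewrite ltnS (leq_trans (leq_pred _)) // -ck' leq_mul2r dc orbT.
Qed.

End LogarithmOfClasses.

Lemma comp_middle (Q : quiver) (R : comNzRingType) (X Y Z W V : rep Q R)
    (h : hom W V) (g : hom Z W) (f : hom Y Z) (e : hom X Y) :
  comp (comp h g) (comp f e) = comp h (comp (comp g f) e).
Proof. by rewrite !compA. Qed.

(** * Counting the zeros of a bilinear form *)

Section Orthogonality.
Context (K : finFieldType).

Lemma card_level_set (W : finType) (l : W -> K) (tau : K -> W -> W) :
  (forall c w, l (tau c w) = l w + c) -> (forall c, injective (tau c)) ->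
  (#|[set w | l w == 0%R]| * #|K|)%N = #|W|.
Proof.
move=> ltau tau_inj; rewrite -[#|W|]sum1_card [RHS](partition_big l predT) //=.
rewrite mulnC -sum_nat_const; apply: eq_bigr => c _; rewrite sum1_card.
have le a b : (#|[set w | l w == a]| <= #|[set w | l w == b]|)%N.
  rewrite -(card_imset _ (tau_inj (b - a))); apply/subset_leq_card/subsetP => _ /imsetP[w + ->].
  by rewrite !inE ltau => /eqP ->; rewrite addrC subrK.
rewrite (_ : #|[pred i | l i == c]| = #|[set w | l w == c]|); last by apply: eq_card => w; rewrite !inE.
by apply/eqP; rewrite eqn_leq !le.
Qed.

(** Counting the pairs with B v w = 0 along the fibres over V and over W: a form
    B v, if not zero, takes each value equally often. *)
Lemma card_left_right_kernel (V W : finType) (B : V -> W -> K) (V0 : {set V}) (W0 : {set W}) :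
  (forall v w, v \in V0 -> B v w = 0) -> (forall v w, w \in W0 -> B v w = 0) ->
  (forall v, v \notin V0 -> exists tau : K -> W -> W,
     (forall c w, B v (tau c w) = B v w + c) /\ (forall c, injective (tau c))) ->
  (forall w, w \notin W0 -> exists tau : K -> V -> V,
     (forall c v, B (tau c v) w = B v w + c) /\ (forall c, injective (tau c))) ->
  (#|V0| * #|W|)%N = (#|W0| * #|V|)%N.
Proof.
move=> BV0 BW0 tauV tauW; have K1 := finNzRing_gt1 K.
have side (A A' : finType) (b : A -> A' -> K) (A0 : {set A}) :
    (forall v w, v \in A0 -> b v w = 0) ->
    (forall v, v \notin A0 -> exists tau : K -> A' -> A',
     (forall c w, b v (tau c w) = b v w + c) /\ (forall c, injective (tau c))) ->
    (\sum_v #|[set w | b v w == 0%R]| * #|K| = #|A| * #|A'| + #|K|.-1 * (#|A0| * #|A'|))%N.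
  move=> b0 btau; rewrite (bigID [in A0]) /= -(cardC [in A0]) mulnDl [RHS]addnAC.
  congr addn.
    rewrite -mulSn prednK ?(ltnW K1) // mulnC -mulnA -sum_nat_const; apply: eq_bigr => v vA.
    congr muln; rewrite -cardsT; apply: eq_card => w; rewrite !inE b0 ?eqxx //.
  rewrite -sum_nat_const; apply: eq_big => [v|v /btau[tau [h1 h2]]]; first by rewrite inE.
  exact: card_level_set h1 h2.
have := side W V (fun w v => B v w) W0 (fun w v => BW0 v w) tauW.
have := side V W B V0 BV0 tauV.
have -> : (\sum_v #|[set w | B v w == 0%R]| * #|K| = \sum_w #|[set v | B v w == 0%R]| * #|K|)%N.
  rewrite -!big_distrl; congr muln.
  under eq_bigr => v _ do rewrite -sum1_card big_mkcond.
  rewrite exchange_big; apply: eq_bigr => w _; rewrite -sum1_card [RHS]big_mkcond.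
  by apply: eq_bigr => v _; rewrite !inE.
move=> -> /eqP; rewrite [(#|W| * #|V|)%N]mulnC eqn_add2l eqn_pmul2l ?ltn_predRL // => /eqP.
by [].
Qed.

End Orthogonality.

(** * The trace pairing *)

Section TracePairing.
Context (J : finType) (K : finFieldType) (n : nat).
Local Notation O := (truncpoly K n.+1).
Implicit Types (a b : J -> nat).

(** The coefficient of the highest power is a Frobenius form: it vanishes on no
    nonzero ideal. *)
Definition top_coef (p : O) : K := (p : {poly K})`_n.

Lemma top_coefD p q : top_coef (p + q) = top_coef p + top_coef q.
Proof. exact: coef_truncpolyD. Qed.

(** Divide by the lowest non-zero coefficient and shift it to the top. *)
Lemma top_coef_onto (p : O) (c : K) : p != 0 -> exists s : O, top_coef (p * s) = c.
Proof.
move=> p0; have [j jn pj] : exists2 j, (j <= n)%N & (p : {poly K})`_j != 0.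
  apply: contrapT => h; move/eqP: p0; apply; apply/truncpoly_inj => i ni.
  by rewrite coef0; apply/eqP/negPn/negP => pi; apply: h; exists i.
have ex : exists j, (p : {poly K})`_j != 0 by exists j.
case: (ex_minnP ex) => i pi mini; have ni : (i <= n)%N := leq_trans (mini j pj) jn.
exists (in_qpoly 'X^(n.+1) ((c / (p : {poly K})`_i) *: 'X^(n - i))).
rewrite /top_coef mulrC coef_truncpolyM // (bigD1 (Ordinal (leq_ltn_trans (leq_subr i n) (ltnSn n)))) //= big1 ?addr0.
  by rewrite coef_in_qpoly ?leq_subr // coefZ coefXn eqxx mulr1 subKn // divfK.
move=> l; rewrite -val_eqE /= => /negbTE ln.
by rewrite coef_in_qpoly -1?ltnS // coefZ coefXn ln mulr0 mul0r.
Qed.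

Definition trace_pairing a b (v : fam O a b) (w : fam O b a) : K :=
  top_coef (\sum_i \tr (v i *m w i)).

Lemma trace_pairingC a b (v : fam O a b) (w : fam O b a) :
  trace_pairing v w = trace_pairing w v.
Proof. by congr top_coef; apply: eq_bigr => i _; exact: mxtrace_mulC. Qed.

Lemma trace_pairingD a b (v : fam O a b) (w w' : fam O b a) :
  trace_pairing v (w + w') = trace_pairing v w + trace_pairing v w'.
Proof.
rewrite /trace_pairing -top_coefD -big_split; congr top_coef; apply: eq_bigr => i _.
by rewrite famDE mulmxDr mxtraceD.
Qed.

Lemma trace_pairing0 a b (w : fam O b a) : trace_pairing (0 : fam O a b) w = 0.
Proof.
rewrite /trace_pairing big1 ?/top_coef ?coef0 // => i _.
by rewrite fam0E mul0mx mxtrace0.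
Qed.

Lemma trace_pairing_onto a b (v : fam O a b) (c : K) : v != 0 -> exists w, trace_pairing v w = c.
Proof.
move=> v0; have [i [s [t vst]]] : exists i s t, v i s t != 0.
  apply: contrapT => h; move/eqP: v0; apply; apply: famP => i; apply/matrixP => s t.
  by rewrite fam0E mxE; apply/eqP/negPn/negP => ne; apply: h; exists i, s, t.
have [u <-] := top_coef_onto c vst.
exists [ffun j => \matrix_(y, z) if [&& j == i, val y == val t & val z == val s] then u else 0].
congr top_coef; rewrite (bigD1 i) //= big1 ?addr0 => [|j ji]; last first.
  rewrite ffunE; apply: big1 => y _; rewrite mxE big1 // => z _.
  by rewrite mxE (negbTE ji) mulr0.
rewrite ffunE /mxtrace (bigD1 s) //= big1 ?addr0 => [|y ys].
  rewrite mxE (bigD1 t) //= big1 ?addr0 => [|z zt]; first by rewrite mxE !eqxx.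
  by rewrite mxE eqxx !val_eqE (negbTE zt) mulr0.
by rewrite mxE big1 // => z _; rewrite mxE !val_eqE (negbTE ys) !andbF mulr0.
Qed.

Lemma trace_pairing_shift a b (v : fam O a b) : v != 0 -> exists tau : K -> fam O b a -> fam O b a,
  (forall c w, trace_pairing v (tau c w) = trace_pairing v w + c) /\ (forall c, injective (tau c)).
Proof.
move=> v0; have /choice[s sP] : forall c, exists w, trace_pairing v w = c.
  by move=> c; exact: trace_pairing_onto.
exists (fun c w => w + s c); split=> [c w|c]; first by rewrite trace_pairingD sP.
exact: addIr.
Qed.

End TracePairing.

(** * The fibres of the moment map *)

Section MomentFibre.
Context (Q : quiver) (K : finFieldType) (n : nat) (r : {ffun vertex Q -> nat}).
Local Notation O := (truncpoly K n.+1).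
Local Notation gl_fam := (fam O (fun i : vertex Q => r i) (fun i => r i)).
Local Notation dual_fam := (fam O (fun a : arrow Q => r (src a)) (fun a => r (tgt a))).
Local Notation arrow_fam := (fam O (fun a : arrow Q => r (tgt a)) (fun a => r (src a))).
Context (x : lfrep r O).

Definition moment_at (y : dual_fam) : gl_fam := moment ((x, y) : lfrep_double r O).

(** The differential at x of the action of GL: its kernel is the endomorphism ring
    of x, and it is the transpose of y |-> moment (x, y) for the trace pairing. *)
Definition coboundary (g : gl_fam) : arrow_fam := [ffun a => g (tgt a) *m x a - x a *m g (src a)].

Lemma moment_pairing (y : dual_fam) (g : gl_fam) :
  trace_pairing (moment_at y) g = trace_pairing y (coboundary g).
Proof.
have trB m (A B : 'M[O]_m) : \tr (A - B) = \tr A - \tr B by exact: raddfB.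
have tr_sum m (P : pred (arrow Q)) (A : arrow Q -> 'M[O]_m) :
  \tr (\sum_(a | P a) A a) = \sum_(a | P a) \tr (A a) by exact: raddf_sum.
congr top_coef; under eq_bigr => i _ do rewrite /moment_at ffunE mulmxBl !mulmx_suml trB !tr_sum.
rewrite sumrB /= (exchange_big_dep predT) //= [X in _ - X](exchange_big_dep predT) //= -sumrB.
apply: eq_bigr => a _; rewrite ffunE.
rewrite (big_pred1 (tgt a)) => [|i]; last by rewrite /= eq_sym.
rewrite (big_pred1 (src a)) => [|i]; last by rewrite /= eq_sym.
rewrite !conform_mx_id mulmxBr trB /=; congr (_ - _).
  by rewrite -mulmxA mxtrace_mulC mulmxA.
by rewrite mulmxA.
Qed.

Lemma card_coboundary_ker :
  #|[set g : gl_fam | coboundary g == 0%R]| = #|hom (to_rep x) (to_rep x)|.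
Proof.
pose F (g : hom (to_rep x) (to_rep x)) : gl_fam := g.
have Finj : injective F by move=> g h e; apply: val_inj.
rewrite -(card_imset _ Finj); apply: eq_card => g; rewrite inE; apply/eqP/imsetP => [g0|[h _ ->]].
  have gP : g \is a is_hom (to_rep x) (to_rep x).
    apply/is_homP => a; have /ffunP/(_ a) := g0; rewrite ffunE famE => /eqP.
    by rewrite subr_eq0 => /eqP.
  by exists (Hom gP).
by apply: famP => a; rewrite ffunE famE /F (hom_act h a) subrr.
Qed.

(** The kernels of a linear map and of its transpose for a non-degenerate pairing
    have proportional sizes. *)
Lemma card_moment_fibre :
  (#|[set y : dual_fam | moment_at y == 0%R]| * #|{: gl_fam}| =
   #|hom (to_rep x) (to_rep x)| * #|{: dual_fam}|)%N.
Proof.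
rewrite -card_coboundary_ker.
apply: (card_left_right_kernel (B := fun y g => trace_pairing (moment_at y) g)).
- by move=> y g; rewrite inE => /eqP ->; exact: trace_pairing0.
- move=> y g; rewrite inE moment_pairing => /eqP ->.
  by rewrite trace_pairingC trace_pairing0.
- by move=> y; rewrite inE; exact: trace_pairing_shift.
- move=> g; rewrite inE => /trace_pairing_shift[tau [h1 h2]].
  have mp y : trace_pairing (moment_at y) g = trace_pairing (coboundary g) y.
    by apply: etrans (moment_pairing y g) _; exact: trace_pairingC.
  exists tau; split=> [c y|]; last exact: h2.
  apply: etrans (mp _) _; apply: etrans (h1 _ _) _.
  apply: (congr1 (fun z => z + c)); exact: esym (mp y).
Qed.

End MomentFibre.

Section MomentCount.
Context (Q : quiver) (K : finFieldType) (n : nat) (r : {ffun vertex Q -> nat}).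
Local Notation O := (truncpoly K n.+1).
Local Notation gl_fam := (fam O (fun i : vertex Q => r i) (fun i => r i)).
Local Notation dual_fam := (fam O (fun a : arrow Q => r (src a)) (fun a => r (tgt a))).

Lemma card_truncpoly : #|O| = (#|K| ^ n.+1)%N.
Proof. by rewrite card_monic_qpoly ?size_polyXn // monicXn. Qed.

Lemma card_fam (J : finType) (a b : J -> nat) :
  #|{: fam O a b}| = (#|K| ^ (n.+1 * \sum_i a i * b i))%N.
Proof.
rewrite [LHS]card_dep_ffun foldrE big_image /= big_distrr /= expn_sum.
by apply: eq_bigr => i _; rewrite card_mx card_truncpoly -expnM.
Qed.

Lemma nb_moment_zero_sum :
  (nb_moment_zero r n.+1 K * #|{: gl_fam}| =
   (\sum_(x : lfrep r O) #|hom (to_rep x) (to_rep x)|) * #|{: dual_fam}|)%N.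
Proof.
rewrite /nb_moment_zero -sum1_card big_distrl big_distrl /=.
under [RHS]eq_bigr => x _ do rewrite -card_moment_fibre -sum1_card.
rewrite [RHS](_ : _ = (\sum_(x : lfrep r O) \sum_(y in [set y : dual_fam | moment_at x y == 0%R]) #|{: gl_fam}|)%N); last first.
  by apply: eq_bigr => x _; rewrite big_distrl /=; apply: eq_bigr => y _; rewrite mul1n.
rewrite pair_big_dep /=; apply: eq_big => [[x y]|[x y] _]; last by rewrite mul1n.
by rewrite !inE.
Qed.

(** Count the pairs of g in GL and y with g an isomorphism c -> y: each g has one y,
    and each y in the orbit has as many g as c has automorphisms. *)
Lemma card_orbit_stabiliser (c : lfrep r O) :
  nb_GL r n.+1 K = (#|[set y : lfrep r O | `[< iso (to_rep c) (to_rep y) >]]| * nb_aut (to_rep c))%N.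
Proof.
pose mor (g : gl r O) (y : lfrep r O) := [forall a, g (tgt a) *m c a == y a *m g (src a)].
transitivity (\sum_(g : gl r O | [forall i, g i \in unitmx]) \sum_(y : lfrep r O | mor g y) 1)%N.
  rewrite /nb_GL -sum1_card; apply: eq_big => [g|g gU]; first by rewrite inE.
  have {}gU i : g i \in unitmx by move: gU; rewrite inE => /forallP; apply.
  rewrite (big_pred1 ([ffun a => g (tgt a) *m c a *m invmx (g (src a))] : lfrep r O)) // => y.
  apply/forallP/eqP => [gy|-> a]; last by rewrite ffunE (mulmxKV (gU (src a))).
  by apply/ffunP => a; rewrite ffunE (eqP (gy a)) (mulmxK (gU (src a))).
rewrite (exchange_big_dep predT) //= (bigID (fun y => `[< iso (to_rep c) (to_rep y) >])) /=.
rewrite [X in (_ + X)%N]big1 ?addn0 => [|y /asboolP ny]; last first.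
  apply: big_pred0 => g; apply/negP => /andP[/forallP gU /forallP gy]; apply: ny.
  by apply/isomorphic_iso; exists g => // a; exact/eqP.
rewrite -sum_nat_const; apply: eq_big => [y|y /asboolP[u [v [vu uv]]]]; first by rewrite inE.
rewrite sum1_card /nb_aut /countp.
pose F (h : hom (to_rep c) (to_rep c)) : gl r O := (comp u h : hom (to_rep c) (to_rep y)).
have Finj : injective F.
  move=> h h' /(@val_inj _ _ (hom (to_rep c) (to_rep y))) e.
  by rewrite -[h]comp1l -vu -compA e compA vu comp1l.
rewrite -(card_imset _ Finj); apply: eq_card => g; rewrite [LHS]unfold_in /=.
apply/andP/imsetP => [[/forallP gU /forallP gy]|[h + ->]].
  have gP : forall a, g (tgt a) *m act (to_rep c) a = act (to_rep y) a *m g (src a).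
    by move=> a; exact/eqP.
  pose G : hom (to_rep c) (to_rep y) := @mkhom Q O (to_rep c) (to_rep y) g gP.
  have GE i : G i = g i by rewrite mkhomE.
  have [|G' [G'G GG']] := hom_unitmx_inverse (f := G); first by move=> i; rewrite GE.
  exists (comp v G); last by apply/ffunP => i; rewrite /F compA uv comp1l GE.
  rewrite inE; apply/asboolP; exists (comp G' u); rewrite !endME !end1E; split.
    rewrite comp_middle uv comp1l; exact: G'G.
  rewrite comp_middle GG' comp1l; exact: vu.
rewrite inE => /asboolP[h' [h'h hh']]; split; apply/forallP => a; last first.
  by rewrite /F; apply/eqP; exact: (hom_act (comp u h) a).
have e : comp u h a *m comp h' v a = 1%:M.
  by rewrite -compE -idhE -uv -!compA [comp h (comp h' v)]compA -endME hh' end1E comp1l.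
exact: (mulmx1_unit e).1.
Qed.

(** The classes are weighted by the size of their orbits, #GL / #Aut. *)
Lemma sum_card_end :
  ((\sum_(x : lfrep r O) #|hom (to_rep x) (to_rep x)|)%:R / (nb_GL r n.+1 K)%:R : rat) =
  class_weight O r.
Proof.
rewrite (partition_big (@canon Q O r) (@is_class Q O r)) => [|x _] /=; last exact: canon_class.
rewrite natr_sum mulr_suml; apply: eq_bigr => c cc.
have orb x : (canon x == c) = `[< iso (to_rep c) (to_rep x) >].
  apply/eqP/asboolP => [<-|cx]; first exact/iso_sym/canon_iso.
  by rewrite -(eqP cc); apply/canon_eq/iso_sym.
have -> : (\sum_(x : lfrep r O | canon x == c) #|hom (to_rep x) (to_rep x)| =
   #|[set y : lfrep r O | `[< iso (to_rep c) (to_rep y) >]]| * #|hom (to_rep c) (to_rep c)|)%N.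
  rewrite -sum_nat_const; apply: eq_big => [x|x]; first by rewrite inE orb.
  by rewrite orb => /asboolP cx; exact: esym (card_end_iso cx).
rewrite (card_orbit_stabiliser c) !natrM /weight invfM mulrACA divff ?mul1r //.
rewrite pnatr_eq0 -lt0n; apply/card_gt0P; exists c; rewrite inE; apply/asboolP; exact: iso_refl.
Qed.

(** The exponent of q compares the sizes of gl and of the space of the y. *)
Lemma moment_zero_class_weight :
  ((nb_moment_zero r n.+1 K)%:R / (nb_GL r n.+1 K)%:R) *
    (#|K|%:R : rat) ^ (n.+1%:Z * euler_form r r) = class_weight O r.
Proof.
have q0 : (#|K|%:R : rat) != 0 by rewrite pnatr_eq0 -lt0n; apply/card_gt0P; exists 0.
have e := congr1 (fun z : nat => z%:R : rat) nb_moment_zero_sum.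
rewrite /= !natrM !card_fam !natrX in e.
rewrite -sum_card_end; set S := (\sum_(x : lfrep r O) _)%N in e *.
set A := (\sum_i r i * r i)%N in e; set B := (\sum_(a : arrow Q) _)%N in e.
have -> : euler_form r r = A%:Z - B%:Z.
  rewrite /euler_form /A /B !(big_morph Posz PoszD (erefl 0%:Z)).
  by congr (_ - _); apply: eq_bigr.
rewrite mulrBr expfzDr // -invr_expz -!PoszM -!exprnP.
have -> : (nb_moment_zero r n.+1 K)%:R = S%:R * #|K|%:R ^+ (n.+1 * B) / #|K|%:R ^+ (n.+1 * A) :> rat.
  by rewrite -e mulfK // expf_neq0.
have := expf_neq0 (n.+1 * A) q0; have := expf_neq0 (n.+1 * B) q0.
move: (_ ^+ (n.+1 * A)) (_ ^+ (n.+1 * B)) (_ %:R^-1) => a b g b0 a0.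
by field; rewrite a0 b0.
Qed.

End MomentCount.

(** * The exponential of a power series and its recursion *)

Section ExpRecursion.
Context (I : finType).
Implicit Types (F G : mps I Vring) (r : {ffun I -> nat}).

(** The Euler derivation, the sum of the operators t_i d/dt_i. *)
Definition euler_der F : mps I Vring := fun r => F r *+ mdegree r.

Lemma euler_der_mul F G : euler_der (F * G) = euler_der F * G + F * euler_der G.
Proof.
apply/funext => r; have -> : (euler_der F * G + F * euler_der G) r =
  mps_mul (euler_der F) G r + mps_mul F (euler_der G) r by [].
rewrite /euler_der mps_mulrE /mps_mul -big_split -sumrMnl; apply: eq_bigr => p /eqP pr /=.
have e : mdegree r = (mdegree (exp_of_box p.1) + mdegree (exp_of_box p.2))%N by rewrite -mdegreeD pr.
by rewrite [X in _ *+ X = _]e mulrnDr mulrnAl mulrnAr.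
Qed.

Lemma euler_der_one : euler_der (1 : mps I Vring) = 0.
Proof.
apply/funext => r; rewrite /euler_der.
have -> : (1 : mps I Vring) r = (r == 0)%:R by [].
case: eqP => [->|_]; last by rewrite mul0rn.
by rewrite /mdegree big1 // => i _; rewrite ffunE.
Qed.

Lemma euler_der_exp F k : euler_der (F ^+ k.+1) = (euler_der F * F ^+ k) *+ k.+1.
Proof.
elim: k => [|k IH]; first by rewrite expr1 expr0 mulr1.
by rewrite exprS euler_der_mul IH mulrnAr [RHS]mulrS mulrCA -exprS.
Qed.

Lemma Vring_sumE (T : Type) (s : seq T) (P : pred T) (f : T -> Vring) j :
  (\sum_(t <- s | P t) f t) j = \sum_(t <- s | P t) f t j.
Proof. by apply: (big_morph (fun a : Vring => a j)). Qed.

Lemma Vring_mulrnE (a : Vring) k j : (a *+ k) j = a j *+ k.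
Proof. by elim: k => // k IH; rewrite !mulrS -IH. Qed.

Lemma mps_mulrnE F k r : (F *+ k) r = F r *+ k.
Proof. by elim: k => // k IH; rewrite !mulrS -IH. Qed.

Lemma euler_derE F r j : euler_der F r j = (mdegree r)%:R * F r j.
Proof. by rewrite /euler_der Vring_mulrnE mulr_natl. Qed.

Lemma mps_exp_zero F : mps_exp F 0 = 1.
Proof.
have m0 : mdegree (0 : {ffun I -> nat}) = 0%N.
  by rewrite /mdegree big1 // => i _; rewrite ffunE.
rewrite /mps_exp /mps_sum m0 big_nat1; apply/funext => j.
have -> : (0`!%:R^-1 *: (F ^+ 0 : mps I Vring)) 0 j = 0`!%:R^-1 * (1 : mps I Vring) 0 j by [].
have -> : (1 : mps I Vring) 0 = 1 by rewrite -[LHS]/((0 == 0)%:R) eqxx.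
by rewrite fact0 invr1 mul1r.
Qed.

(** The identity D exp(F) = D(F) exp(F), read off at r. *)
Lemma mps_exp_rec F r j : mps_order_ge 1 F ->
  (mdegree r)%:R * mps_exp F r j =
  \sum_(p : exp_box I (mdegree r) * exp_box I (mdegree r) | exp_of_box p.1 + exp_of_box p.2 == r)
    ((mdegree (exp_of_box p.1))%:R * F (exp_of_box p.1) j) * mps_exp F (exp_of_box p.2) j.
Proof.
move=> F1; have ord k : mps_order_ge k (k`!%:R^-1 *: (F ^+ k : mps I Vring)) by exact: mps_order_exp.
have expE N s : (mdegree s < N)%N ->
    mps_exp F s j = \sum_(0 <= k < N) k`!%:R^-1 * (F ^+ k) s j.
  by move=> sN; rewrite /mps_exp -(mps_sumE ord sN) Vring_sumE.
rewrite (expE (mdegree r).+2) // mulr_sumr big_nat_recl //=.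
have der k : (mdegree r)%:R * (k`!%:R^-1 * (F ^+ k) r j) = k`!%:R^-1 * euler_der (F ^+ k) r j.
  by rewrite euler_derE mulrCA.
rewrite der expr0 euler_der_one mulr0 add0r.
transitivity (\sum_(0 <= k < (mdegree r).+1) \sum_(p : exp_box I (mdegree r) * exp_box I (mdegree r)
   | exp_of_box p.1 + exp_of_box p.2 == r) ((mdegree (exp_of_box p.1))%:R * F (exp_of_box p.1) j) *
     (k`!%:R^-1 * (F ^+ k) (exp_of_box p.2) j)).
  apply: eq_bigr => k _; rewrite der euler_der_exp mps_mulrnE Vring_mulrnE mps_mulrE /mps_mul.
  rewrite Vring_sumE -[X in _ * X]mulr_natl mulrA.
  have -> : (k.+1)`!%:R^-1 * k.+1%:R = k`!%:R^-1 :> rat.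
    by rewrite factS natrM invfM mulrAC mulVf ?mul1r // pnatr_eq0.
  rewrite mulr_sumr; apply: eq_bigr => p _.
  have -> : (euler_der F (exp_of_box p.1) * (F ^+ k) (exp_of_box p.2)) j =
     euler_der F (exp_of_box p.1) j * (F ^+ k) (exp_of_box p.2) j by [].
  by rewrite euler_derE mulrCA.
rewrite exchange_big; apply: eq_bigr => p /eqP pr /=.
have e : mdegree r = (mdegree (exp_of_box p.1) + mdegree (exp_of_box p.2))%N by rewrite -mdegreeD pr.
by rewrite -mulr_sumr -expE // ltnS [X in (_ <= X)%N]e leq_addl.
Qed.

End ExpRecursion.

(** The terms with p.1 = 0 vanish, and in the others p.2 has smaller degree. *)
Lemma degree_recursion_uniq (I : finType) (f g h : {ffun I -> nat} -> rat) :
  f 0 = g 0 ->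
  (forall r, (mdegree r)%:R * f r =
    \sum_(p : exp_box I (mdegree r) * exp_box I (mdegree r) | exp_of_box p.1 + exp_of_box p.2 == r)
      ((mdegree (exp_of_box p.1))%:R * h (exp_of_box p.1)) * f (exp_of_box p.2)) ->
  (forall r, (mdegree r)%:R * g r =
    \sum_(p : exp_box I (mdegree r) * exp_box I (mdegree r) | exp_of_box p.1 + exp_of_box p.2 == r)
      ((mdegree (exp_of_box p.1))%:R * h (exp_of_box p.1)) * g (exp_of_box p.2)) ->
  forall r, f r = g r.
Proof.
move=> fg0 fr gr r; have [N] := ubnP (mdegree r); elim: N r => // N IH r; rewrite ltnS => rN.
have [r0|r0] := posnP (mdegree r).
  suff -> : r = 0 by [].
  apply/ffunP => i; rewrite ffunE; apply/eqP; rewrite -leqn0 -r0; exact: leq_mdegree.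
apply: (@mulfI _ (mdegree r)%:R); first by rewrite pnatr_eq0 -lt0n.
rewrite fr gr; apply: eq_bigr => p /eqP pr.
have [d0|d0] := posnP (mdegree (exp_of_box p.1)); first by rewrite d0 !mul0r.
have e : mdegree r = (mdegree (exp_of_box p.1) + mdegree (exp_of_box p.2))%N by rewrite -mdegreeD pr.
by rewrite IH // (leq_trans _ rN) // [X in (_ < X)%N]e -[X in (X < _)%N]add0n ltn_add2r.
Qed.

Lemma class_weight_zero (Q : quiver) (O : finComUnitRingType) :
  class_weight O (0 : {ffun vertex Q -> nat}) = 1.
Proof.
have eqx (x y : lfrep (0 : {ffun vertex Q -> nat}) O) : x = y.
  by apply/ffunP => a; apply/matrixP => i; have := ltn_ord i; rewrite {2}ffunE.
pose x0 : lfrep (0 : {ffun vertex Q -> nat}) O := [ffun a => 0].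
rewrite /class_weight (big_pred1 x0) => [|x]; last by rewrite (eqx x x0) /= eqxx; apply/eqP.
have id0 : idh (to_rep x0) = 0.
  apply/asboolP; rewrite -rank_total0 rank_total_to_rep /mdegree big1 // => i _.
  by rewrite ffunE.
have hom0 (f : hom (to_rep x0) (to_rep x0)) : f = 0 by rewrite -[f]comp1l id0 comp0l.
have card1 : #|hom (to_rep x0) (to_rep x0)| = 1%N.
  by apply/eqP/card1P; exists 0 => f; rewrite !inE (hom0 f) eqxx.
have aut1 : nb_aut (to_rep x0) = 1%N.
  apply/eqP; rewrite eqn_leq nb_aut_gt0 andbT -card1; exact: max_card.
by rewrite /weight card1 aut1 divr1.
Qed.

Lemma mdegree0 (J : finType) (r : {ffun J -> nat}) : (mdegree r == 0)%N = (r == 0).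
Proof.
apply/eqP/eqP => [r0|->]; last by rewrite /mdegree big1 // => i _; rewrite ffunE.
by apply/ffunP => i; rewrite ffunE; apply/eqP; rewrite -leqn0 -r0 leq_mdegree.
Qed.

Section Assembly.
Context (F : finFieldType) (Q : quiver) (n : nat).
Local Notation A_series := (fun r : {ffun vertex Q -> nat} =>
  (if r == 0 then 0 else
   Vdiv (Vcount F (nb_abs_indecomposable r n.+1)) (Vfun F (fun q => 1 - q^-1)) : Vring)).
Local Notation log_series :=
  (mps_sum (fun k => (k.+1%:R^-1 : rat) *: mps_adams k.+1 (A_series : mps (vertex Q) Vring))).

Lemma log_series_order : mps_order_ge 1 log_series.
Proof.
move=> r; rewrite ltnS leqn0 => /eqP r0; rewrite /mps_sum r0 big_nat1.
have -> : r = 0 by apply/eqP; rewrite -mdegree0 r0.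
apply/funext => j.
have -> : (1%:R^-1 *: mps_adams 1 (A_series : mps (vertex Q) Vring)) 0 j =
   1%:R^-1 * mps_adams 1 (A_series : mps (vertex Q) Vring) 0 j by [].
rewrite /mps_adams; case: forallP => [_|_]; last by rewrite mulr0.
rewrite ifT ?mulr0 //; apply/eqP/ffunP => i; rewrite !ffunE //.
Qed.

(** The j-th component lives over the field K with #|F|^(j+1) elements, and the Adams
   operator of index m takes it to the extension of K of degree m. *)
Lemma log_series_abs_log r j : r != 0 ->
  log_series r j = @abs_log Q (Fext F j.+1) n (fun m => Fext F (m * j.+1)) r.
Proof.
move=> r0; rewrite /mps_sum Vring_sumE; apply: eq_bigr => k _.
have -> : (k.+1%:R^-1 *: mps_adams k.+1 (A_series : mps (vertex Q) Vring)) r j =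
   k.+1%:R^-1 * mps_adams k.+1 (A_series : mps (vertex Q) Vring) r j by [].
rewrite /mps_adams; case: forallP => [dvd|] //; congr (_ * _).
rewrite ifF; last first.
  apply: contra_neqF r0 => /eqP e; apply/ffunP => i; have /ffunP/(_ i) := e; rewrite !ffunE.
  by move=> ri; rewrite -(divnK (dvd i)) ri mul0n.
rewrite /adams /Vdiv /Vcount /Vfun /Vseq prednK ?muln_gt0 //.
by rewrite card_Fext // -expnM [(j.+1 * _)%N]mulnC.
Qed.

End Assembly.

Theorem theorem1p0p1 (F : finFieldType) (Q : quiver) (alpha : nat)
    (alpha_gt0 : (0 < alpha)%N) :
  (fun r : {ffun vertex Q -> nat} =>
     Vdiv (Vcount F (nb_moment_zero r alpha)) (Vcount F (nb_GL r alpha))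
     * Vfun F (fun q => q ^ (alpha%:Z * euler_form r r)))
    = plethystic_exp (fun r : {ffun vertex Q -> nat} =>
        if r == 0 then 0 else
        Vdiv (Vcount F (nb_abs_indecomposable r alpha))
             (Vfun F (fun q => 1 - q^-1)))
    :> mps (vertex Q) Vring.
Proof.
case: alpha alpha_gt0 => // n _; apply/funext => r; apply/funext => j.
set K := Fext F j.+1; have cardK : #|K| = (#|F| ^ j.+1)%N := card_Fext F (ltn0Sn j).
transitivity (class_weight (truncpoly K n.+1) r).
  have -> : (Vdiv (Vcount F (nb_moment_zero r n.+1)) (Vcount F (nb_GL r n.+1))
     * Vfun F (fun q => q ^ (n.+1%:Z * euler_form r r))) j =
     (nb_moment_zero r n.+1 K)%:R / (nb_GL r n.+1 K)%:R *
       ((#|F| ^ j.+1)%:R : rat) ^ (n.+1%:Z * euler_form r r) by [].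
  by rewrite -cardK moment_zero_class_weight.
have cardL m : (0 < m)%N -> #|Fext F (m * j.+1)| = (#|K| ^ m)%N.
  by move=> m0; rewrite card_Fext ?muln_gt0 ?m0 // cardK -expnM mulnC.
rewrite /plethystic_exp; set G := mps_sum _.
apply: (@degree_recursion_uniq (vertex Q) (class_weight (truncpoly K n.+1)) (fun s => mps_exp G s j)
  (@abs_log Q K n (fun m => Fext F (m * j.+1)))) => [|s|s].
- by rewrite class_weight_zero mps_exp_zero.
- rewrite (class_weight_rec (truncpoly_coefficient_ring K n) (leqnn _)).
  apply: eq_bigr => p /eqP ps; rewrite (indec_log_abs n cardL) //.
  have e : mdegree s = (mdegree (exp_of_box p.1) + mdegree (exp_of_box p.2))%N by rewrite -mdegreeD ps.
  by rewrite [X in (_ <= X)%N]e leq_addr.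
- rewrite mps_exp_rec; last exact: log_series_order.
  apply: eq_bigr => p _; congr (_ * _).
  have [->|p0] := eqVneq (exp_of_box p.1) 0; last first.
    by apply: (congr1 (fun z => _ * z)); exact: log_series_abs_log.
  by rewrite (_ : mdegree 0 = 0%N) ?mul0r //; apply/eqP; rewrite mdegree0.
Qed.
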